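(* Every $10$-edge-connected planar graph admits a circular $5/2$-flow.
   Context: Graphs are finite and may have multiple (parallel) edges but no loops. For integers $a\ge 2b>0$, a circular $a/b$-flow of a graph $G$ is an orientation of $G$ together with an integer flow (i.e. an assignment of integers to edges such that at every vertex the total inflow equals the total outflow) all of whose values lie in $\{\pm b,\pm(b+1),\dots,\pm(a-b)\}$. *)

(* Defs.v *)
From HB Require Import structures.
From mathcomp Require Import all_boot all_order all_algebra.
From mathcomp Require Import all_classical all_reals all_analysis.

Set Implicit Arguments.
Unset Strict Implicit.
Unset Printing Implicit Defensive.

Import Order.TTheory GRing.Theory Num.Theory.
Import numFieldNormedType.Exports.

Local Open Scope classical_set_scope.
Local Open Scope ring_scope.

(* Finite loopless multigraphs: [ends] need not be injective, so parallel
   edges are allowed; every edge has two distinct ends. *)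
Record mgraph := MGraph {
  vertex : finType;
  edge : finType;
  ends : edge -> {set vertex};
  card_ends : forall e : edge, #|ends e| = 2%N
}.

Definition adj_avoiding (G : mgraph) (F : {set edge G}) : rel (vertex G) :=
  fun u v => [exists e : edge G, (e \notin F) && (ends e == [set u; v]%SET)].

Definition connected_avoiding (G : mgraph) (F : {set edge G}) : Prop :=
  forall u v : vertex G, connect (adj_avoiding F) u v.

Definition edge_connected (k : nat) (G : mgraph) : Prop :=
  (1 < #|vertex G|)%N /\
  forall F : {set edge G}, (#|F| < k)%N -> connected_avoiding F.

(* A drawing of G in the plane R * R: [p] places the vertices, and the edge e
   is drawn as the simple arc [arc e], parametrised by the interval [0, 1]
   (the values of [arc e] outside [0, 1] are irrelevant). *)
Record plane_drawing (R : realType) (G : mgraph)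
    (p : vertex G -> R * R) (arc : edge G -> R -> R * R) : Prop :=
  PlaneDrawing {
    drawing_vertex_inj : injective p;
    drawing_arc_continuous :
      forall e, {within `[0, 1], continuous (arc e)};
    drawing_arc_inj : forall e, {in `[0, 1] &, injective (arc e)};
    drawing_arc_ends : forall e, exists u v : vertex G,
      [/\ ends e = [set u; v]%SET, arc e 0 = p u & arc e 1 = p v];
    drawing_arc_vertex : forall e t v, t \in `]0, 1[ -> arc e t <> p v;
    drawing_arc_arc : forall e e' s t,
      s \in `]0, 1[ -> t \in `]0, 1[ -> arc e s = arc e' t -> e = e'
  }.

Definition planar (R : realType) (G : mgraph) : Prop :=
  exists (p : vertex G -> R * R) (arc : edge G -> R -> R * R),
    plane_drawing p arc.

Definition orientation (G : mgraph) (tail head : edge G -> vertex G) : Prop :=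
  forall e, ends e = [set tail e; head e]%SET.

Definition integer_flow (G : mgraph) (tail head : edge G -> vertex G)
    (f : edge G -> int) : Prop :=
  forall v, \sum_(e | head e == v) f e = \sum_(e | tail e == v) f e.

(* Meaningful for a >= 2b > 0; the subtraction is the one of int. *)
Definition has_circular_flow (a b : nat) (G : mgraph) : Prop :=
  exists (tail head : edge G -> vertex G) (f : edge G -> int),
    [/\ orientation tail head, integer_flow tail head f
      & forall e, b%:Z <= `|f e| <= a%:Z - b%:Z].

(* Main.v *)
(** The flow is obtained from an orientation whose out-degree minus in-degree is
    divisible by 5 at every vertex.  By splitting off pairs of edges consecutive
    on a face and by contracting, one may assume that all degrees are 11 and that
    no odd cut is smaller.  A partition of the vertices minimizing
    [\sum d(P_i) - 11 n] then has a class inducing a subgraph that is dense in the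
    following sense: [\sum d(P_i) - 11 n + 19 >= 0] for all partitions into [n]
    classes, apart from stronger bounds for two and three classes.  Planar graphs
    that are dense in this sense realize every balanced boundary modulo 5.
    In a minimal counterexample contractible configurations are excluded, and
    discharging over the faces of the underlying simple graph contradicts the
    edge count.

    Planarity is used through Mac Lane's criterion, which is stable under
    deletion, contraction and splitting along a face; a topological drawing
    satisfies it because it exhibits the graph as a minor of a fine triangular
    lattice.  *)

From HB Require Import structures.
Require Import Defs.
From mathcomp Require Import all_boot all_order all_algebra.
From mathcomp Require Import boolp.
From mathcomp Require Import zify ring lra.

Set Implicit Arguments.
Unset Strict Implicit.
Unset Printing Implicit Defensive.
Import Order.TTheory GRing.Theory Num.Theory.

(** * Mac Lane planarity *)

Local Open Scope ring_scope.

(** All boundaries, not only the zero one, have to be realized by the dense subgraphs: once the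
    contracted graph is oriented, the contracted part is left with an arbitrary defect to correct.
    Only odd cuts are kept large, because splitting off lowers a cut by 0 or 2; even cuts may
    shrink. The constant 11 is the degree, so that by the handshake identity the partition into
    singletons has [\sum d(P_i) - 11 n = 0]. The constant 19 has to stay below 22: discharging with
    Euler's inequality yields [2 * #|D| <= 11 * #|U| - 22]. The obstacle is that some
    configurations, such as a triple edge in a triangle or a doubled triangle with two doubled
    neighbours, realize all boundaries only after pairs of edges leaving them are lifted.
    Contraction then loses up to four further edges, so it must be shown that a minimal
    counterexample is denser than required; this is the role of the [gap] lemmas. *)

Lemma addrr_bool (x : bool) : x + x = 0.
Proof. by case: x. Qed.

Lemma bool_add_eq0 (x y : bool) : (x + y = 0) <-> x = y.
Proof. by case: x; case: y. Qed.

Lemma sum_indicator_bool (I : finType) (i : I) (f : I -> bool) :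
  \sum_k (k == i) * f k = f i.
Proof.
rewrite (bigD1 i) //= eqxx mul1r big1 ?addr0 // => k /negbTE->.
by rewrite mul0r.
Qed.

Section Boundary.
Variables (V E : finType) (s t : E -> V).

(** [bool] serves as the field F_2, with exclusive or as addition; a loop is therefore incident with
    no vertex. *)
Definition inc (e : E) (v : V) : bool := (s e == v) + (t e == v).

Definition bd (z : E -> bool) (v : V) : bool := \sum_e z e * inc e v.

Lemma eq_bd z z' : z =1 z' -> bd z =1 bd z'.
Proof. by move=> h v; apply: eq_bigr => e _; rewrite h. Qed.

Lemma bdD z z' v : bd (fun e => z e + z' e) v = bd z v + bd z' v.
Proof. by rewrite -big_split; apply: eq_bigr => e _; rewrite mulrDl. Qed.

Lemma bd_sum (I : finType) (a : I -> bool) (F : I -> E -> bool) v :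
  bd (fun e => \sum_i a i * F i e) v = \sum_i a i * bd (F i) v.
Proof.
rewrite /bd; under eq_bigr do rewrite mulr_suml.
rewrite exchange_big; apply: eq_bigr => i _.
by rewrite mulr_sumr; apply: eq_bigr => e _; rewrite mulrA.
Qed.

Lemma bd1 e v : bd (fun f => f == e) v = inc e v.
Proof. exact: sum_indicator_bool. Qed.

Lemma sum_inc (A : {set V}) e : \sum_(v in A) inc e v = (s e \in A) + (t e \in A).
Proof.
have h x : \sum_(v in A) (x == v) = (x \in A) :> bool.
  case: (boolP (x \in A)) => xA.
    rewrite (bigD1 x) //= eqxx big1 // => v /andP[_ ne].
    by rewrite eq_sym (negbTE ne).
  rewrite big1 // => v vA; apply/negbTE; apply: contra xA => /eqP->//.
by rewrite big_split /= !h.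
Qed.

Lemma sum_bd (A : {set V}) z :
  \sum_(v in A) bd z v = \sum_e z e * ((s e \in A) + (t e \in A)).
Proof.
rewrite exchange_big; apply: eq_bigr => e _.
by rewrite -mulr_sumr sum_inc.
Qed.

Definition link (e : E) (u v : V) :=
  ((s e == u) && (t e == v)) || ((s e == v) && (t e == u)).

Lemma linkC e u v : link e u v = link e v u.
Proof. by rewrite /link orbC. Qed.

Lemma link_ends e : link e (s e) (t e).
Proof. by rewrite /link !eqxx. Qed.

Lemma link_inc e u v : link e u v -> forall w, inc e w = (w == u) + (w == v).
Proof.
by rewrite /inc => /orP[] /andP[/eqP-> /eqP->] w; rewrite ![_ == w]eq_sym 1?addrC.
Qed.

Definition adj (D : {set E}) : rel V := fun u v => [exists e in D, link e u v].

Lemma adj_sym D : symmetric (adj D).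
Proof. by move=> u v; apply: eq_existsb => e; rewrite linkC. Qed.

Lemma adj_connect_sym D : connect_sym (adj D).
Proof. exact: sym_connect_sym (@adj_sym D). Qed.

Lemma adj_sub (D D' : {set E}) : D \subset D' -> subrel (adj D) (connect (adj D')).
Proof.
move=> sub u v /existsP[e /andP[eD l]]; apply: connect1.
by apply/existsP; exists e; rewrite (subsetP sub).
Qed.

Lemma adj_ends (D : {set E}) e : e \in D -> adj D (s e) (t e).
Proof. by move=> eD; apply/existsP; exists e; rewrite eD link_ends. Qed.

(** The edges of a walk are added modulo 2; repetitions cancel, so the walk need not be simple. *)
Lemma path_chain (D : {set E}) u v : connect (adj D) u v ->
  exists z : E -> bool, (forall e, z e -> e \in D) /\
    forall w, bd z w = (w == u) + (w == v).
Proof.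
move=> /connectP[p]; elim: p u => [|x p IH] u /=.
  move=> _ ->; exists (fun=> false); split=> // w.
  by rewrite addrr_bool /bd big1 // => e _; rewrite mul0r.
move=> /andP[/existsP[e /andP[eD l]] px] lst.
have [z [zD zb]] := IH _ px lst.
exists (fun f => (f == e) + z f); split=> [f|w].
  by have [->|_] := eqVneq f e; rewrite ?add0r // => /zD.
rewrite bdD bd1 zb (link_inc l).
by case: (w == u); case: (w == x); case: (w == v).
Qed.

(** Orthogonality over F_2 of [S] to the cycle space of [D]. *)
Definition cut_cond (D : {set E}) (S : {set E}) :=
  forall z : E -> bool, (forall e, z e -> e \in D) -> (forall v, bd z v = 0) ->
  \sum_(e in S) z e = 0 :> bool.

(* An edge [e] of [S] and a path of [D :\: S] between its ends would form a
   cycle meeting [S] exactly once. *)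
Lemma star_cut (D S : {set E}) (v : V) :
  S \subset D -> (forall e, e \in S -> inc e v) -> cut_cond D S ->
  exists X : {set V}, v \notin X /\
    forall e, e \in D -> (e \in S) = (s e \in X) + (t e \in X) :> bool.
Proof.
move=> SD Sv Scut.
set C := [set w | connect (adj (D :\: S)) v w].
have key e w : e \in S -> link e v w -> w \notin C.
  move=> eS l; rewrite inE; apply/negP => /path_chain[z [zD zb]].
  have := Scut (fun f => (f == e) + z f).
  have -> : \sum_(e0 in S) ((e0 == e) + z e0) = 1 :> bool.
    rewrite big_split /= [X in _ + X]big1 ?addr0; last first.
      by move=> f fS; apply/negbTE/negP => /zD; rewrite inE fS.
    rewrite (bigD1 e) //= eqxx big1 ?addr0 // => f /andP[_ /negbTE] //.
  move=> h; suff: true = 0 :> bool by [].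
  apply: h => [f|x].
    have [->|_] := eqVneq f e; first by rewrite (subsetP SD).
    by rewrite add0r => /zD; rewrite inE => /andP[].
  by rewrite bdD bd1 zb (link_inc l) addrr_bool.
exists (~: C); split; first by rewrite !inE negbK connect0.
move=> e eD.
have vC : v \in C by rewrite inE connect0.
case: (boolP (e \in S)) => eS.
  have := Sv _ eS; rewrite /inc.
  case: eqP => [se|ne]; case: eqP => [te|ne'] //= _.
    have := key e (t e) eS; rewrite /link se !eqxx => /(_ isT) tC.
    by rewrite !inE; move: vC tC; rewrite !inE => -> ->.
  have := key e (s e) eS; rewrite /link te !eqxx orbT => /(_ isT) tC.
  by rewrite !inE; move: vC tC; rewrite !inE => -> /negbTE->.
have a : adj (D :\: S) (s e) (t e) by apply: adj_ends; rewrite inE eS.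
by rewrite !inE (same_connect_r (@adj_connect_sym _) (connect1 a)) addrr_bool.
Qed.

End Boundary.

Section PairCover.
Variables (I E : finType).
Implicit Types (F : I -> E -> bool) (l : I -> bool).

Definition two_or_none l :=
  (forall k, l k = false) \/
  exists i j, i != j /\ forall k, l k = (k == i) || (k == j).

Definition pair_cover F := forall e, two_or_none (fun i => F i e).

Lemma two_or_noneP l :
  two_or_none l <-> \sum_k (l k : nat) = 0%N \/ \sum_k (l k : nat) = 2%N.
Proof.
have cE : (\sum_k (l k : nat) = #|[set k | l k]|)%N.
  by rewrite -sum1dep_card [RHS]big_mkcond; apply: eq_bigr => k _; case: (l k).
rewrite cE; split=> [[l0|[i [j [ij lE]]]]|[/eqP|/eqP]].
- by left; apply/eqP; rewrite cards_eq0; apply/eqP/setP => k; rewrite !inE l0.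
- right; apply/eqP/cards2P; exists i, j; split=> //.
  by apply/setP => k; rewrite !inE lE.
- by rewrite cards_eq0 => /eqP/setP h; left=> k; have := h k; rewrite !inE.
move=> /cards2P[i [j [ij /setP h]]]; right; exists i, j; split=> // k.
by have := h k; rewrite !inE.
Qed.

(** The two faces selected by [l] are replaced by their sum and by the empty face. A combination [a]
    of faces survives when it gives both the same coefficient, which is the meaning of
    [\sum_k a k * l k = 0]. *)
Lemma merge_faces F l : pair_cover F -> two_or_none l ->
  exists F' : I -> E -> bool,
  [/\ pair_cover F',
      forall a : I -> bool, \sum_k a k * l k = 0 ->
        forall e, \sum_k a k * F' k e = \sum_k a k * F k e &
      forall k, [\/ l k = false /\ F' k =1 F k, F' k =1 (fun=> false)
        | exists i j, [/\ l i, l j, i != j &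
            F' k =1 (fun e => F i e + F j e)]]].
Proof.
move=> Fc [l0|[i [j [ij lE]]]].
  by exists F; split=> // k; constructor 1; split.
have ji : j != i by rewrite eq_sym.
exists (fun k e => if k == j then false else
         if k == i then F i e + F j e else F k e); split.
- move=> e; apply/two_or_noneP; move/two_or_noneP: (Fc e).
  rewrite [in X in X -> _](bigD1 i) //= [in X in X -> _](bigD1 j) //=.
  rewrite [in X in _ -> X](bigD1 i) //= [in X in _ -> X](bigD1 j) //=.
  rewrite !eqxx (negbTE ij).
  rewrite [in X in _ -> X](eq_bigr (fun k => F k e : nat)); last first.
    by move=> k /andP[/negbTE-> /negbTE->].
  by move: (\sum_(k | _) _)%N => n; case: (F i e); case: (F j e) => /=; lia.
- move=> a; rewrite (bigD1 i) //= (bigD1 j) //=.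
  rewrite !lE !eqxx orbT !mulr1 [X in _ + (_ + X)]big1; last first.
    by move=> k /andP[ki kj]; rewrite lE (negbTE ki) (negbTE kj) mulr0.
  rewrite addr0 => /bool_add_eq0 aij e.
  rewrite [LHS](bigD1 i) //= [X in _ + X = _](bigD1 j) //=.
  rewrite [RHS](bigD1 i) //= [X in _ = _ + X](bigD1 j) //=.
  rewrite !eqxx (negbTE ij) -aij mulr0 add0r mulrDr -addrA; congr (_ + (_ + _)).
  by apply: eq_bigr => k /andP[/negbTE-> /negbTE->].
- move=> k; case: (eqVneq k j) => [|kj]; first by constructor 2.
  case: (eqVneq k i) => [|ki].
    by constructor 3; exists i, j; rewrite !lE !eqxx orbT.
  by constructor 1; rewrite lE (negbTE ki) (negbTE kj).
Qed.

End PairCover.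

Section Planar.
Variables (V E : finType).

Definition faces (s t : E -> V) (D : {set E}) (I : finType) (F : I -> E -> bool) :=
  [/\ forall i e, F i e -> e \in D, forall i v, bd s t (F i) v = 0,
      pair_cover F &
      forall z : E -> bool, (forall e, z e -> e \in D) ->
        (forall v, bd s t z v = 0) ->
        exists a : I -> bool, forall e, z e = \sum_i a i * F i e].

(* Mac Lane's criterion: the cycle space is spanned by cycles, the faces, such
   that every edge lies on exactly two of them or on none. *)
Definition maclane s t D :=
  exists (I : finType) (F : I -> E -> bool), faces s t D F.

Variables (s t : E -> V).

(** The two faces through [e] are merged; a cycle avoiding [e] uses both or neither. *)
Lemma planar_del1 (D : {set E}) e : maclane s t D -> maclane s t (D :\ e).
Proof.
move=> [I [F [FD Fb Fc Fs]]].
have [F' [Fc' Fs' Fk]] := merge_faces Fc (Fc e).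
exists I, F'; split=> //.
- move=> k f; have [[ke ->]|->|[i [j [ie je _ ->]]]] // := Fk k.
    move=> kf; rewrite !inE (FD _ _ kf) andbT; apply: contraTneq kf => ->.
    by rewrite ke.
  move=> ijf; rewrite !inE; apply/andP; split.
    by apply: contraTneq ijf => ->; rewrite ie je.
  have : F i f || F j f by move: ijf; case: (F i f).
  by move=> /orP[] /FD.
- move=> k v; have [[ke /(eq_bd s t)->]|/(eq_bd s t)->|[i [j [ie je _]]]] := Fk k.
  + exact: Fb.
  + by rewrite /bd big1 // => f _; rewrite mul0r.
  + by move/(eq_bd s t)->; rewrite bdD !Fb.
move=> z zD zb; have zD' f : z f -> f \in D by move/zD; rewrite inE => /andP[].
have [a az] := Fs z zD' zb; exists a => f.
rewrite Fs' // -az; apply/negbTE/negP => /zD; by rewrite !inE eqxx.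
Qed.

Lemma planar_sub (D D' : {set E}) : maclane s t D -> D' \subset D ->
  maclane s t D'.
Proof.
elim: {D}_.+1 {-2}D (ltnSn #|D :\: D'|) => // n IH D ltn pD sub.
have [/eqP|[e]] := set_0Vmem (D :\: D').
  by rewrite setD_eq0 => sub'; have -> : D' = D by apply/eqP; rewrite eqEsubset sub.
rewrite inE => /andP[eD' eD].
apply: (IH (D :\ e)); last first.
- by rewrite subsetD1 sub.
- exact: planar_del1.
rewrite -ltnS; apply: leq_trans ltn; rewrite ltnS; apply: proper_card; apply/properP; split.
  by apply/subsetP => f; rewrite !inE => /andP[-> /andP[]].
by exists e; rewrite !inE ?eqxx ?eD' ?andbF.
Qed.

(* Replacing two edges [v x], [v y] of a common face by [x y] (carried by the
   name [e1]) draws [x y] inside that face. *)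
Lemma planar_lift (D : {set E}) e1 e2 v x y (I : finType) (F : I -> E -> bool) i0
    (s1 := fun e => if e == e1 then x else s e)
    (t1 := fun e => if e == e1 then y else t e) :
  link s t e1 v x -> link s t e2 v y -> e1 \in D -> e2 \in D -> e1 != e2 ->
  faces s t D F -> F i0 e1 -> F i0 e2 -> maclane s1 t1 (D :\ e2).
Proof.
move=> l1 l2 e1D e2D e12 [FD Fb Fc Fs] F1 F2.
have e21 : e2 != e1 by rewrite eq_sym.
pose dr (z : E -> bool) e := z e && (e != e2).
(* If both edges are used or both are not, their contributions at [v] cancel, so the lift preserves
   the boundary. *)
have bd_lift (z : E -> bool) : z e1 = z e2 -> bd s1 t1 (dr z) =1 bd s t z.
  move=> z12 w; rewrite /bd (bigD1 e1) // (bigD1 e2) //=.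
  rewrite [in RHS](bigD1 e1) // [in RHS](bigD1 e2) //=.
  rewrite /dr eqxx e12 andbT andbF mul0r add0r -z12.
  rewrite (link_inc l1) (link_inc l2) /inc /s1 /t1 eqxx addrA; congr (_ + _).
    by rewrite ![w == _]eq_sym; case: (z e1) (x == w) (y == w) (v == w) => [] [] [] [].
  by apply: eq_bigr => e /andP[/negbTE-> ->]; rewrite andbT.
(* To be merged are the faces through exactly one of [e1], [e2]. As [i0] contains both, these are
   the second faces of [e1] and of [e2], or none if the two coincide. *)
have lE : two_or_none (fun k => F k e1 + F k e2).
  have tw e : F i0 e -> exists2 g, g != i0 & forall k, F k e = (k == i0) || (k == g).
    move=> Fe; case: (Fc e) => [h|[i [j [ij h]]]]; first by rewrite h in Fe.
    move: Fe; rewrite h => /orP[] /eqP->; first by exists j; rewrite // eq_sym.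
    by exists i => // k; rewrite h orbC.
  have [g1 g10 h1] := tw _ F1; have [g2 g20 h2] := tw _ F2.
  have [E12|n12] := eqVneq g1 g2; [left=> k|right; exists g1, g2; split=> // k];
    rewrite h1 h2 ?E12 ?addrr_bool //.
  have [->|] := eqVneq k i0; first by rewrite ![i0 == _]eq_sym (negbTE g10) (negbTE g20).
  have [->|] := eqVneq k g1; first by rewrite (negbTE n12).
  by case: eqVneq.
have [F' [Fc' Fs' Fk]] := merge_faces Fc lE.
have F'12 k : F' k e1 = F' k e2.
  have [[/bool_add_eq0 h h']|h|[i [j [hi hj _ h]]]] := Fk k; rewrite ?h' ?h //.
  by move: hi hj; case: (F i e1); case: (F i e2); case: (F j e1); case: (F j e2).
have F'b k v' : bd s t (F' k) v' = 0.
  have [[ke /(eq_bd s t)->]|/(eq_bd s t)->|[i [j [ie je _]]]] := Fk k.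
  + exact: Fb.
  + by rewrite /bd big1 // => f _; rewrite mul0r.
  + by move/(eq_bd s t)->; rewrite bdD !Fb.
exists I, (fun k => dr (F' k)); split.
- move=> k f /andP[Ff fe2]; rewrite !inE fe2 /=.
  move: Ff; have [[ke ->]|->|[i [j [ie je _ ->]]]] // := Fk k; first exact: FD.
  by move=> ijf; have : F i f || F j f by [move: ijf; case: (F i f)]; case/orP=> /FD.
- by move=> k w; rewrite bd_lift.
- move=> e; have [->|ne] := eqVneq e e2; first by left=> k; rewrite /dr eqxx andbF.
  case: (Fc' e) => [h|[i [j [ij h]]]]; [left=> k|right; exists i, j; split=> // k];
  by rewrite /dr ne andbT h.
move=> z zD zb.
(* A cycle of the lifted graph is pulled back by letting [e2] follow [e1]. *)
pose z' e := if e == e2 then z e1 else z e.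
have z'12 : z' e1 = z' e2 by rewrite /z' eqxx (negbTE e12).
have dz : dr z' =1 z.
  move=> e; rewrite /dr /z'; case: eqVneq => [->|_]; rewrite ?andbT ?andbF //.
  by apply/esym/negbTE/negP => /zD; rewrite !inE eqxx.
have [|w|a az] := Fs z'.
- by move=> e; rewrite /z'; case: eqVneq => [->//|_] /zD; rewrite inE => /andP[].
- by rewrite -bd_lift // (eq_bd _ _ dz) zb.
exists a => e; rewrite -dz /dr az.
have al : \sum_k a k * (F k e1 + F k e2) = 0.
  by under eq_bigr do rewrite mulrDr; rewrite big_split /= -!az z'12 addrr_bool.
rewrite -(Fs' _ al); case: (e != e2); first by rewrite andbT; apply: eq_bigr => k _; rewrite andbT.
by rewrite andbF big1 // => k _; rewrite andbF mulr0.
Qed.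

(** A face that meets [S] has all its edges at [v] in [S], and there is an even number of them since
    the face is a cycle. Every cycle is a sum of faces. *)
Lemma face_closed_cut (D S : {set E}) v (I : finType) (F : I -> E -> bool) :
  faces s t D F -> S \subset D -> (forall e, e \in S -> inc s t e v) ->
  (forall i e e', F i e -> F i e' -> e \in S -> inc s t e' v -> e' \in S) ->
  cut_cond s t D S.
Proof.
move=> [FD Fb Fc Fs] SD Sv Scl z zD zb.
have [a az] := Fs z zD zb.
under eq_bigr do rewrite az.
rewrite exchange_big /= big1 // => i _; rewrite -mulr_sumr.
suff -> : \sum_(e in S) F i e = 0 :> bool by rewrite mulr0.
have [/existsP[e /andP[eS ie]]|none] := boolP [exists e in S, F i e]; last first.
  rewrite big1 // => e eS; apply/negbTE; apply: contra none => ie.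
  by apply/existsP; exists e; rewrite eS.
rewrite -[RHS](Fb i v) /bd big_mkcond; apply: eq_bigr => f _.
case: (boolP (f \in S)) => fS; first by rewrite (Sv _ fS) mulr1.
case: (boolP (F i f)) => fi; last by rewrite mul0r.
apply/esym; rewrite mul1r; apply/negbTE; apply: contra fS.
exact: Scl ie fi eS.
Qed.

End Planar.

Section Contraction.
Variables (V V' E : finType) (s t : E -> V) (c : V -> V').

Definition inner (D : {set E}) := [set e in D | c (s e) == c (t e)].

(* A cycle of the contracted graph has even boundary on each fibre, so it
   extends by paths inside the fibres to a cycle of the original graph. *)
Lemma planar_contract (D : {set E}) :
  (forall u v, c u = c v -> connect (adj s t (inner D)) u v) ->
  maclane s t D -> maclane (c \o s) (c \o t) (D :\: inner D).
Proof.
move=> conn [I [F [FD Fb Fc Fs]]].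
have cin (z : E -> bool) x : bd (c \o s) (c \o t) z x = \sum_(v | c v == x) bd s t z v.
  rewrite (eq_bigl (mem [set v | c v == x])); last by move=> v; rewrite !inE.
  by rewrite sum_bd; apply: eq_bigr => e _; rewrite /inc !inE.
pose out (z : E -> bool) e := z e && (e \notin inner D).
have out_bd (z : E -> bool) : (forall e, z e -> e \in D) ->
    bd (c \o s) (c \o t) (out z) =1 bd (c \o s) (c \o t) z.
  move=> zD x; apply: eq_bigr => e _; rewrite /out.
  case: (boolP (z e)) => [/zD eD|]; rewrite ?mul0r //=.
  case: (boolP (e \in inner D)) => //; rewrite inE eD /inc /= => /eqP->.
  by rewrite addrr_bool mulr0.
exists I, (fun i => out (F i)); split.
- by move=> i e /andP[/FD eD ne]; rewrite inE ne.
- move=> i x; rewrite out_bd; last exact: FD.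
  by rewrite cin big1.
- move=> e; case: (boolP (e \in inner D)) => ei.
    by left=> k; rewrite /out ei andbF.
  case: (Fc e) => [h|[i [j [ij h]]]]; [left=> k|right; exists i, j; split=> // k];
  by rewrite /out ei andbT h.
move=> z zD zb.
pose rep v := odflt v [pick u | c u == c v].
have cr v : c (rep v) = c v.
  by rewrite /rep; case: pickP => //= u /eqP.
have rr u v : c u = c v -> rep u = rep v.
  move=> uv; rewrite /rep (eq_pick (Q := fun w => c w == c v)) ?uv //.
  by case: pickP => // /(_ v); rewrite eqxx.
have /fin_all_exists[p pP] v : exists p : E -> bool,
    (forall e, p e -> e \in inner D) /\
    forall w, bd s t p w = (w == v) + (w == rep v).
  by apply: path_chain; apply: conn; rewrite cr.
(* Each vertex with odd boundary is joined to the representative of its fibre. The representative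
   collects the boundary of the whole fibre, which vanishes because [z] is a cycle after
   contraction. *)
pose y e := z e + \sum_v bd s t z v * p v e.
have yD e : y e -> e \in D.
  rewrite /y; case: (boolP (z e)) => [/zD|_]; first by rewrite inE => /andP[].
  rewrite add0r; case: (boolP (e \in inner D)) => [|ne]; first by rewrite inE => /andP[].
  rewrite big1 // => v _; case: (boolP (p v e)) => [/(pP v).1|_]; last by rewrite mulr0.
  by rewrite (negbTE ne).
have yb v : bd s t y v = 0.
  rewrite bdD bd_sum.
  under eq_bigr do rewrite (pP _).2 mulrDr.
  rewrite big_split /=.
  have -> : \sum_i bd s t z i * (v == i) = bd s t z v.
    under eq_bigr do rewrite mulrC eq_sym; exact: sum_indicator_bool.
  rewrite addrA addrr_bool add0r.
  have [vr|nr] := eqVneq (rep v) v; last first.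
    rewrite big1 // => u _; case: eqVneq => [vu|_]; last by rewrite mulr0.
    by case/eqP: nr; rewrite vu; apply: rr; rewrite cr.
  rewrite -[RHS](zb (c v)) cin [RHS]big_mkcond; apply: eq_bigr => u _.
  case: (eqVneq (c u) (c v)) => uv; first by rewrite (rr _ _ uv) vr eqxx mulr1.
  by case: eqVneq => [vu|_]; rewrite ?mulr0 //; rewrite vu cr eqxx in uv.
have [a ay] := Fs y yD yb; exists a => e.
have zo : z e = out y e.
  rewrite /out; case: (boolP (e \in inner D)) => ei.
    by rewrite andbF; apply/negbTE/negP => /zD; rewrite inE ei.
  rewrite andbT /y big1 ?addr0 // => v _.
  case: (boolP (p v e)) => [/(pP v).1|_]; last by rewrite mulr0.
  by rewrite (negbTE ei).
rewrite zo /out ay; case: (e \in inner D); last first.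
  by rewrite andbT; apply: eq_bigr => i _; rewrite andbT.
by rewrite andbF big1 // => i _; rewrite andbF mulr0.
Qed.

End Contraction.

(** * Euler's inequality for Mac Lane faces *)

Section Count.
Variables (V E : finType) (s t : E -> V).

Lemma sum_pair_cover (I : finType) (F : I -> E -> bool) e :
  pair_cover F -> \sum_i F i e = 0 :> bool.
Proof.
move=> Fc; case: (Fc e) => [h|[i [j [ij h]]]].
  by rewrite big1 // => k _; rewrite h.
rewrite (bigD1 i) //= (bigD1 j) 1?eq_sym //= big1 => [|k /andP[/negbTE ki /negbTE kj]].
  by rewrite !h !eqxx orbT.
by rewrite h ki kj.
Qed.

Definition nonzero (I : finType) (F : I -> E -> bool) : {set I} :=
  [set i | [exists e, F i e]].

(* Subsets [z] of [R] are encoded by their boundary on [U :\ v0] and by the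
   faces other than [i0] whose sum is [z] plus a fixed set with that boundary. *)
Lemma face_count (U : {set V}) (R : {set E}) (I : finType) (F : I -> E -> bool) :
  (forall e, e \in R -> (s e \in U) && (t e \in U)) -> U != set0 ->
  faces s t R F ->
  (#|R| + (0 < #|nonzero F|) < #|U| + #|nonzero F|)%N.
Proof.
move=> RU /set0Pn[v0 v0U] [FD Fb Fc Fs].
pose ch (z : {set E}) e := e \in z.
have ch_in (z : {set E}) : z \subset R -> forall e, ch z e -> e \in R.
  by move=> /subsetP zR e; apply: zR.
have bdU (z : {set E}) v : z \subset R -> v \notin U -> bd s t (ch z) v = 0.
  move=> zR vU; rewrite /bd big1 // => e _; rewrite /ch.
  case: (boolP (e \in z)) => [ez|]; last by rewrite mul0r.
  have /andP[sU tU] := RU e (subsetP zR _ ez).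
  rewrite mul1r /inc; case: eqVneq => [h|_]; first by rewrite -h sU in vU.
  by case: eqVneq => [h|_] //; rewrite -h tU in vU.
pose T (z : {set E}) := [set v in U :\ v0 | bd s t (ch z) v].
pose rep (W : {set V}) : {set E} := odflt set0 [pick z : {set E} | (z \subset R) && (T z == W)].
have repP (z : {set E}) : z \subset R -> rep (T z) \subset R /\ T (rep (T z)) = T z.
  move=> zR; rewrite /rep; case: pickP => [w /andP[wR /eqP]//|/(_ z)].
  by rewrite zR eqxx.
have cyc (z z' : {set E}) : z \subset R -> z' \subset R -> T z = T z' ->
    forall v, bd s t (fun e => ch z e + ch z' e) v = 0.
  move=> zR zR' TT.
  have off v : v != v0 -> bd s t (fun e => ch z e + ch z' e) v = 0.
    move=> vv; rewrite bdD; case: (boolP (v \in U)) => vU.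
      have := TT; move/setP/(_ v); rewrite !inE vv vU /= => ->; exact: addrr_bool.
    by rewrite !bdU.
  move=> v; have [->|] := eqVneq v v0; last exact: off.
  have : \sum_(v in [set: V]) bd s t (fun e => ch z e + ch z' e) v = 0.
    by rewrite sum_bd big1 // => e _; rewrite !inE addrr_bool mulr0.
  rewrite (bigD1 v0) ?inE //= big1 ?addr0 // => w /andP[_]; exact: off.
(* All faces sum to zero, so adding [a i0] to every coefficient changes nothing and removes the face
   [i0] from the combination. *)
have [B [cB BP]] : exists B : {set I}, #|nonzero F| = (#|B| + (0 < #|nonzero F|))%N /\
    forall a : I -> bool, exists A : {set I}, A \subset B /\
      forall e, \sum_i a i * F i e = \sum_(i in A) F i e.
  have nz k e : k \notin nonzero F -> F k e = false.
    by rewrite inE => /existsPn/(_ e)/negbTE.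
  have [F0|[i0 i0F]] := set_0Vmem (nonzero F).
    exists set0; rewrite F0 cards0; split=> // a; exists set0; split=> // e.
    by rewrite big_set0 big1 // => i _; rewrite nz ?F0 ?inE // mulr0.
  exists (nonzero F :\ i0); split.
    rewrite (cardsD1 i0 (nonzero F)) i0F [LHS]addnC; congr addn.
  move=> a; exists [set i in nonzero F :\ i0 | a i + a i0]; split.
    by apply/subsetP => i; rewrite inE => /andP[].
  move=> e; transitivity (\sum_i (a i + a i0) * F i e).
    under [RHS]eq_bigr do rewrite mulrDl.
    by rewrite big_split /= -mulr_sumr sum_pair_cover // mulr0 addr0.
  rewrite [RHS]big_mkcond; apply: eq_bigr => i _; rewrite !inE.
  have [->|ne] := eqVneq i i0; first by rewrite addrr_bool mul0r.
  have [iF|iF] := boolP (i \in nonzero F); last by rewrite nz // mulr0; case: ifP.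
  move: iF; rewrite inE => -> /=; by case: (a i + a i0); rewrite ?mul1r ?mul0r.
have exA (z : {set E}) : exists A : {set I}, z \subset R -> A \subset B /\
    forall e, ch z e + ch (rep (T z)) e = \sum_(i in A) F i e.
  case: (boolP (z \subset R)) => zR; last by exists set0.
  have [rR rT] := repP z zR.
  have [e|v|a az] := Fs (fun e => ch z e + ch (rep (T z)) e).
  - by rewrite /ch; case: (boolP (e \in z)) => [ez _|_ /=];
    [exact: (subsetP zR)|exact: (subsetP rR)].
  - by rewrite cyc ?rT.
  by have [A [AB AE]] := BP a; exists A => _; split=> // e; rewrite az AE.
have /fin_all_exists[A AP] := exA.
pose code z := (T z, A z).
have inj : {in powerset R &, injective code}.
  move=> z z'; rewrite !inE => zR zR' [TT AA].
  have [_ hz] := AP z zR; have [_ hz'] := AP z' zR'.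
  apply/setP => e; have := hz e; rewrite AA -hz' TT => /addIr; exact.
have := leq_imset_card code (mem (powerset R)).
rewrite (card_in_imset inj) card_powerset => _.
have sub : code @: powerset R \subset setX (powerset (U :\ v0)) (powerset B).
  apply/subsetP => _ /imsetP[z zR ->]; rewrite !inE in zR *.
  have [-> _] := AP z zR; rewrite andbT; apply/subsetP => v; rewrite inE => /andP[] //.
have := subset_leq_card sub.
rewrite (card_in_imset inj) cardsX !card_powerset -expnD leq_exp2l // => le.
rewrite (cardsD1 v0 U) v0U; lia.
Qed.

End Count.

(** * Boundaries of orientations modulo 5 *)

Section Orient.
Variables (V E : finType).
Notation F5 := 'Z_5.

Definition sgn (x : bool) : F5 := if x then 1 else -1.

Section Fixed.
Variables (s t : E -> V).
Implicit Types (D : {set E}) (A : {set V}) (b : V -> F5).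

Definition net (x : E -> bool) D v : F5 :=
  \sum_(e in D) sgn (x e) * ((s e == v)%:R - (t e == v)%:R).

Definition reach D b := exists x, forall v, net x D v = b v.

Lemma eq_reach D b b' : b =1 b' -> reach D b -> reach D b'.
Proof. by move=> h [x xE]; exists x => v; rewrite xE h. Qed.

Lemma net_in D (x x' : E -> bool) : {in D, x =1 x'} -> net x D =1 net x' D.
Proof. by move=> h v; apply: eq_bigr => e eD; rewrite h. Qed.

Lemma netU D1 D2 x v : [disjoint D1 & D2] ->
  net x (D1 :|: D2) v = net x D1 v + net x D2 v.
Proof.
move=> dis; rewrite /net -bigU //; apply: eq_bigl => e; by rewrite !inE.
Qed.

Lemma reachU D1 D2 b1 b2 : [disjoint D1 & D2] -> reach D1 b1 -> reach D2 b2 ->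
  reach (D1 :|: D2) (fun v => b1 v + b2 v).
Proof.
move=> dis [x1 h1] [x2 h2].
exists (fun e => if e \in D1 then x1 e else x2 e) => v.
rewrite netU // -h1 -h2; congr (_ + _); apply: net_in => e eD; first by rewrite eD.
by have := disjointFl dis eD => ->.
Qed.

Lemma sum_net D x (A : {set V}) : \sum_(v in A) net x D v =
  \sum_(e in D) sgn (x e) * ((s e \in A)%:R - (t e \in A)%:R).
Proof.
have h w : \sum_(v in A) (w == v)%:R = (w \in A)%:R :> F5.
  case: (boolP (w \in A)) => wA.
    rewrite (bigD1 w) //= eqxx big1 ?addr0 // => v /andP[_ ne].
    by rewrite eq_sym (negbTE ne).
  rewrite big1 // => v vA; case: eqVneq => // wv; by rewrite -wv (negbTE wA) in vA.
rewrite exchange_big; apply: eq_bigr => e _.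
by rewrite -mulr_sumr sumrB !h.
Qed.

Definition supported (A : {set V}) b := (forall v, v \notin A -> b v = 0) /\ \sum_v b v = 0.

Lemma supported_in A b : supported A b -> \sum_(v in A) b v = 0.
Proof.
move=> [b0 bs]; rewrite -[RHS]bs [RHS](bigID (mem A)) /= [X in _ + X]big1 ?addr0 //.
Qed.

Lemma reach_supported D A b : (forall e, e \in D -> (s e \in A) && (t e \in A)) ->
  reach D b -> supported A b.
Proof.
move=> DA [x xE]; split=> [v vA|].
  rewrite -xE /net big1 // => e /DA/andP[sA tA].
  case: eqVneq => [h|_]; first by rewrite -h sA in vA.
  case: eqVneq => [h|_]; first by rewrite -h tA in vA.
  by rewrite subrr mulr0.
have <- : \sum_(v in [set: V]) net x D v = \sum_v b v.
  by apply: eq_big => v; rewrite ?inE // xE.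
by rewrite sum_net big1 // => e _; rewrite !inE subrr mulr0.
Qed.

Lemma reach_any D : exists b, reach D b.
Proof. by exists (net (fun=> true) D); exists (fun=> true). Qed.

Definition flow_to x y : V -> F5 := fun v => (v == x)%:R - (v == y)%:R.

(* [D] behaves like [a] parallel edges between [x] and [y]. *)
Definition mlt D x y a :=
  forall j : nat, (j <= a)%N ->
  reach D (fun v => (a%:R - (j.*2)%:R) * flow_to x y v).

Lemma mlt0 x y : mlt set0 x y 0.
Proof.
move=> j; rewrite leqn0 => /eqP->; exists (fun=> true) => v.
by rewrite /net big_set0 subrr mul0r.
Qed.

Lemma mltU D1 D2 x y a1 a2 : [disjoint D1 & D2] -> mlt D1 x y a1 -> mlt D2 x y a2 ->
  mlt (D1 :|: D2) x y (a1 + a2)%N.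
Proof.
move=> dis h1 h2 j ja.
apply: eq_reach (reachU dis (h1 (minn j a1) _) (h2 (j - minn j a1)%N _)); try lia.
move=> v /=; rewrite -mulrDl; congr (_ * _).
have -> : (j.*2 = (minn j a1).*2 + (j - minn j a1).*2)%N by lia.
by rewrite !natrD; ring.
Qed.

Lemma mlt1 e x y : link s t e x y -> mlt [set e] x y 1.
Proof.
move=> l j j1; exists (fun=> (s e == x) (+) (j == 1%N)) => v.
rewrite /net big_set1 /flow_to.
have [jE jN] : (1%:R - (j.*2)%:R = sgn (j == 0%N)) /\ ((j == 1%N) = ~~ (j == 0%N)).
  have [->|->] : j = 0%N \/ j = 1%N by lia.
    by rewrite /sgn subr0.
  by rewrite /sgn /=; split=> //; apply: val_inj.
rewrite jE jN; case/orP: l => /andP[/eqP-> /eqP->]; rewrite ![v == _]eq_sym.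
  by rewrite eqxx addTb negbK.
have [->|_] := eqVneq y x; first by rewrite subrr !mulr0.
rewrite addFb -opprB mulrN -mulNr; congr (_ * _).
by case: (j == 0%N); rewrite /sgn ?opprK.
Qed.

Lemma mlt_set (P : {set E}) x y : (forall e, e \in P -> link s t e x y) ->
  mlt P x y #|P|.
Proof.
elim: {P}_.+1 {-2}P (ltnSn #|P|) => // n IH P ltn lP.
have [->|[e eP]] := set_0Vmem P; first by rewrite cards0; exact: mlt0.
rewrite (cardsD1 e) eP -[X in mlt X](setD1K eP).
apply: mltU; first by rewrite disjoints1 !inE eqxx.
  by apply: mlt1; apply: lP.
apply: IH => [|f]; last by rewrite inE => /andP[_ /lP].
by rewrite (cardsD1 e P) eP in ltn.
Qed.

(* Two edges [x z], [z y] oriented as a path act as one edge [x y]. *)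
Lemma mlt_lift e f x y z : e != f -> link s t e x z -> link s t f z y ->
  mlt [set e; f] x y 1.
Proof.
move=> ef le lf j j1.
have dis : [disjoint [set e] & [set f]] by rewrite disjoints1 inE.
apply: eq_reach (reachU dis (mlt1 le j1) (mlt1 lf j1)) => v /=.
by rewrite /flow_to; move: ((v == x)%:R : F5) ((v == y)%:R : F5) ((v == z)%:R : F5) => ? ? ?; ring.
Qed.

(** Strong Z_5-connectedness of [A]. The set [D] may contain edges leaving [A], such as lifted
    pairs, whose boundary outside [A] cancels. *)
Definition szrel (A : {set V}) D := forall b, supported A b -> reach D b.

Definition inside (A : {set V}) (D : {set E}) := [set e in D | (s e \in A) && (t e \in A)].

(** The additional edges are oriented arbitrarily and [D] corrects their boundary. *)
Lemma szrel_sub A D D' : szrel A D -> D \subset D' ->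
  (forall e, e \in D' :\: D -> (s e \in A) && (t e \in A)) -> szrel A D'.
Proof.
move=> h sub DA b [b0 bs].
have [b' rb'] := reach_any (D' :\: D).
have [b'0 b's] := reach_supported DA rb'.
have dis : [disjoint D & D' :\: D].
  by rewrite -setI_eq0; apply/eqP/setP => e; rewrite !inE; case: (e \in D).
have -> : D' = D :|: (D' :\: D).
  by apply/setP => e; rewrite !inE; case: (boolP (e \in D)) => //= /(subsetP sub).
apply: eq_reach (reachU dis (h (fun v => b v - b' v) _) rb'); first by move=> v; rewrite subrK.
split; first by move=> v vA; rewrite b0 // b'0 // subrr.
by rewrite sumrB bs b's subrr.
Qed.

Definition conn (A : {set V}) D := forall u v, u \in A -> v \in A ->
  connect (adj s t (inside A D)) u v.

(** The boundary 1 at [u], -1 at [v] cannot be realized if [u] and [v] lie in different components,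
    as every component has total boundary 0. *)
Lemma szrel_conn A D : szrel A (inside A D) -> conn A D.
Proof.
move=> sz u v uA vA; apply/negPn/negP => nc.
have nuv : v != u by apply: contraNneq nc => ->; exact: connect0.
have [|x xE] := sz (fun w => (w == u)%:R - (w == v)%:R).
  split=> [w wA|].
    case: eqVneq => [h|_]; first by rewrite h uA in wA.
    case: eqVneq => [h|_]; first by rewrite h vA in wA.
    by rewrite subrr.
  rewrite sumrB (bigD1 u) //= eqxx big1 => [|w /negbTE->//].
  rewrite (bigD1 v) //= eqxx big1 => [|w /negbTE->//]; by rewrite subrr.
pose C := [set w | connect (adj s t (inside A D)) u w].
have uC : u \in C by rewrite inE connect0.
have : \sum_(w in C) net x (inside A D) w = 0.
  rewrite sum_net big1 // => e eD.
  have a := adj_ends s t eD.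
  by rewrite !inE (same_connect_r (@adj_connect_sym _ _ s t _) (connect1 a)) subrr mulr0.
under eq_bigr do rewrite xE.
rewrite (bigD1 u) //= eqxx eq_sym (negbTE nuv) subr0 big1 ?addr0 // => w /andP[wC wu].
rewrite (negbTE wu); case: eqVneq => [h|_]; last by rewrite subrr.
by rewrite h inE (negbTE nc) in wC.
Qed.

Lemma conn1 x D : conn [set x] D.
Proof. by move=> u v; rewrite !inE => /eqP-> /eqP->. Qed.

Lemma connU1 A D e x a : conn A D -> a \in A -> e \in D -> link s t e x a ->
  conn (x |: A) D.
Proof.
move=> cA aA eD l u v.
have sub : inside A D \subset inside (x |: A) D.
  by apply/subsetP => f; rewrite !inE => /and3P[-> -> ->]; rewrite !orbT.
have cA' w : w \in A -> connect (adj s t (inside (x |: A) D)) w a.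
  move=> wA; apply: connect_sub (cA w a wA aA); exact: adj_sub.
have xa : connect (adj s t (inside (x |: A) D)) x a.
  apply: connect1; apply/existsP; exists e; rewrite l andbT !inE eD.
  by case/orP: l => /andP[/eqP-> /eqP->]; rewrite eqxx aA ?orbT.
have all w : w \in x |: A -> connect (adj s t (inside (x |: A) D)) w a.
  by rewrite 2!inE => /orP[/eqP->|/cA'].
move=> /all ua /all va; apply: connect_trans ua _.
by rewrite (@adj_connect_sym _ _ s t).
Qed.

End Fixed.

(** Contraction as a retraction onto a vertex of [A], so that the vertex type stays the same
    throughout the induction. *)
Definition collapse (A : {set V}) a v := if v \in A then a else v.

Lemma collapse_inj (A : {set V}) a u v : a \in A -> collapse A a u = collapse A a v ->
  u <> v -> (u \in A) && (v \in A).
Proof.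
move=> aA; rewrite /collapse; case: ifP => uA; case: ifP => vA // e ne.
  by rewrite -e aA in vA.
by rewrite e aA in uA.
Qed.

Lemma planar_collapse s t (D : {set E}) (A : {set V}) a : a \in A ->
  (forall e, e \in D -> s e != t e) -> conn s t A D -> maclane s t D ->
  maclane (collapse A a \o s) (collapse A a \o t) (D :\: inside s t A D).
Proof.
move=> aA loopless cA pl; apply: (planar_sub (D := D :\: inner s t (collapse A a) D)).
  apply: planar_contract => // u v uv.
  have [->|/eqP ne] := eqVneq u v; first exact: connect0.
  have /andP[uA vA] := collapse_inj aA uv ne.
  apply: connect_sub (cA u v uA vA); apply: adj_sub.
  by apply/subsetP => e; rewrite !inE => /and3P[-> sA tA]; rewrite /collapse sA tA /=.
apply/subsetP => e; rewrite !inE => /andP[ne eD]; rewrite eD andbT /=.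
apply: contra ne => /eqP re; rewrite eD /=.
by apply: collapse_inj aA re _; apply/eqP; exact: loopless.
Qed.

(* Solve the contracted graph first; the remaining defect is supported in [A]. *)
Lemma reach_contract (s t : E -> V) (D DA : {set E}) (A : {set V}) a b
    (r := collapse A a)
    (b' := fun v => if v == a then \sum_(w in A) b w else if v \in A then 0 else b v) :
  a \in A -> DA \subset D -> szrel s t A DA ->
  reach (r \o s) (r \o t) (D :\: DA) b' -> reach s t D b.
Proof.
move=> aA sub sz [x xE].
pose g v := net s t x (D :\: DA) v.
have rE u v : v \notin A -> (r u == v) = (u == v).
  move=> vA; rewrite /r /collapse; case: ifP => uA //.
  case: (eqVneq a v) => [h|_]; first by rewrite -h aA in vA.
  by case: (eqVneq u v) => [h|_] //; rewrite -h uA in vA.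
have gout v : v \notin A -> g v = b v.
  move=> vA; have va : v != a by apply: contraNneq vA => ->.
  have := xE v; rewrite /b' (negbTE va) (negbTE vA) => <-.
  by apply: eq_bigr => e _; rewrite /= !rE.
have rA u : (r u == a) = (u \in A).
  by rewrite /r /collapse; case: ifP => [_|uA]; [rewrite eqxx|apply: contraFF uA => /eqP->].
have gin : \sum_(v in A) g v = \sum_(v in A) b v.
  have := xE a; rewrite /b' eqxx => <-; rewrite sum_net.
  by apply: eq_bigr => e _; rewrite /= !rA.
have -> : D = DA :|: (D :\: DA).
  by apply/setP => e; rewrite !inE; case: (boolP (e \in DA)) => //= /(subsetP sub).
have dis : [disjoint DA & D :\: DA].
  by rewrite -setI_eq0; apply/eqP/setP => e; rewrite !inE; case: (e \in DA).
apply: eq_reach (reachU dis (sz (fun v => b v - g v) _) _); last by exists x => v; exact: erefl.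
  by move=> v; rewrite subrK.
split; first by move=> v vA; rewrite gout // subrr.
rewrite (bigID (mem A)) /= sumrB gin subrr add0r big1 // => v vA.
by rewrite gout // subrr.
Qed.

End Orient.

(** * Small graphs realizing all boundaries *)

Definition Z5_elts : seq 'Z_5 := [:: 0; 1; 2; 3; 4].

Lemma mem_Z5_elts (x : 'Z_5) : x \in Z5_elts.
Proof. by case: x => [[|[|[|[|[|m]]]]] im]. Qed.

(** Four forbidden residues out of five: the circulation around a four-cycle of triple edges, as
    used in [szrel4]. *)
Lemma Z5_avoid4 (p q r : 'Z_5) :
  exists c : 'Z_5, [/\ c != 0, c + p != 0, c + q != 0 & c + r != 0].
Proof.
have chk : all (fun p : 'Z_5 => all (fun q : 'Z_5 => all (fun r : 'Z_5 => has (fun c : 'Z_5 =>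
    [&& c != 0, c + p != 0, c + q != 0 & c + r != 0]) Z5_elts) Z5_elts) Z5_elts) Z5_elts.
  by vm_compute.
move/allP/(_ p (mem_Z5_elts p)): chk => /allP/(_ q (mem_Z5_elts q)) /allP/(_ r (mem_Z5_elts r)).
by case/hasP=> c _ /and4P[]; exists c.
Qed.

(** The net values that a double edge can carry. *)
Definition even2 : seq 'Z_5 := [:: 0; 2; -2].

Lemma Z5_avoid2 (p q : 'Z_5) :
  exists c : 'Z_5, [/\ c \in even2, c + p != 0 & c + q != 0].
Proof.
have chk : all (fun p : 'Z_5 => all (fun q : 'Z_5 => has (fun c : 'Z_5 =>
    (c + p != 0) && (c + q != 0)) even2) Z5_elts) Z5_elts.
  by vm_compute.
move/allP/(_ p (mem_Z5_elts p)): chk => /allP/(_ q (mem_Z5_elts q)).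
by case/hasP=> c ce /andP[]; exists c.
Qed.

(** Prescribed boundary at three vertices of a doubled [K4]: the [a]s run around their triangle, the
    [b]s come from the fourth vertex. *)
Lemma Z5_K4 (p q r : 'Z_5) : exists a1 a2 a3 b1 b2 b3 : 'Z_5,
  [/\ {subset [:: a1; a2; a3; b1; b2; b3] <= even2},
      p = a1 - a3 - b1, q = a2 - a1 - b2 & r = a3 - a2 - b3].
Proof.
have chk : all (fun p : 'Z_5 => all (fun q : 'Z_5 => all (fun r : 'Z_5 =>
   has (fun a1 : 'Z_5 => has (fun a2 : 'Z_5 => has (fun a3 : 'Z_5 =>
   [&& (a1 - a3 - p) \in even2, (a2 - a1 - q) \in even2 & (a3 - a2 - r) \in even2])
   even2) even2) even2) Z5_elts) Z5_elts) Z5_elts.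
  by vm_compute.
move/allP/(_ p (mem_Z5_elts p)): chk => /allP/(_ q (mem_Z5_elts q)) /allP/(_ r (mem_Z5_elts r)).
case/hasP=> a1 h1 /hasP[a2 h2 /hasP[a3 h3 /and3P[b1 b2 b3]]].
exists a1, a2, a3, (a1 - a3 - p), (a2 - a1 - q), (a3 - a2 - r).
split; try by rewrite opprB addrC subrK.
by apply/allP; rewrite /= h1 h2 h3 b1 b2 b3.
Qed.

Section SmallGraphs.
Variables (V E : finType) (s t : E -> V).
Notation F5 := 'Z_5.
Notation mlt := (mlt s t).
Notation reach := (reach s t).
Notation szrel := (szrel s t).

Lemma mlt_reach D x y a (w : F5) : mlt D x y a ->
  has (fun j => w == a%:R - (j.*2)%:R) (iota 0 a.+1) ->
  reach D (fun v => w * flow_to x y v).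
Proof.
move=> m /hasP[j]; rewrite mem_iota add0n ltnS => /andP[_ ja] /eqP->; exact: m.
Qed.

Lemma mlt4_reach D x y (w : F5) : mlt D x y 4 -> reach D (fun v => w * flow_to x y v).
Proof.
move=> m; apply: (mlt_reach m).
suff /allP/(_ w (mem_Z5_elts w)) : all (fun w : F5 =>
  has (fun j => w == 4%:R - (j.*2)%:R) (iota 0 5)) Z5_elts by [].
by vm_compute.
Qed.

(** A triple edge carries 3, 1, -1 or -3, that is, every nonzero residue. *)
Lemma mlt3_reach D x y (w : F5) : mlt D x y 3 -> w != 0 ->
  reach D (fun v => w * flow_to x y v).
Proof.
move=> m w0; apply: (mlt_reach m).
suff /allP/(_ w (mem_Z5_elts w)) : all (fun w : F5 => (w != 0) ==>
  has (fun j => w == 3%:R - (j.*2)%:R) (iota 0 4)) Z5_elts by rewrite w0.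
by vm_compute.
Qed.

Lemma mlt2_reach D x y (w : F5) : mlt D x y 2 -> w \in even2 ->
  reach D (fun v => w * flow_to x y v).
Proof.
move=> m we; apply: (mlt_reach m).
suff /allP/(_ w we) : all (fun w : F5 =>
  has (fun j => w == 2%:R - (j.*2)%:R) (iota 0 3)) even2 by [].
by vm_compute.
Qed.

Lemma szrel2 D x y : x != y -> mlt D x y 4 -> szrel [set x; y] D.
Proof.
move=> xy m b [b0 bs]; apply: eq_reach (mlt4_reach (b x) m) => v.
rewrite /flow_to; have [->|vx] := eqVneq v x.
  by rewrite (negbTE xy) subr0 mulr1.
have [->|vy] := eqVneq v y; last by rewrite subrr mulr0 b0 // !inE negb_or vx.
rewrite sub0r mulrN1; apply/eqP; rewrite eq_sym -addr_eq0 addrC.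
rewrite -[X in _ == X]bs (bigD1 x) // (bigD1 y) 1?eq_sym //= big1 ?addr0 // => w /andP[wx wy].
by rewrite b0 // !inE negb_or wx.
Qed.

(** The circulation [c] around the triangle is free. It is the value on the double side, and the
    triple sides then carry [c + b x] and [c + b x + b y], which only have to be nonzero. *)
Lemma szrel3 (D1 D2 D3 : {set E}) (x y z : V) : x != y -> y != z -> z != x ->
  [disjoint D1 & D2] -> [disjoint D1 :|: D2 & D3] ->
  mlt D1 x y 3 -> mlt D2 y z 3 -> mlt D3 z x 2 ->
  szrel [set x; y; z] (D1 :|: D2 :|: D3).
Proof.
move=> xy yz zx d12 d3 m1 m2 m3 b [b0 bs].
have [c [ce c1 c2]] := Z5_avoid2 (b x) (b x + b y).
apply: eq_reach (reachU d3 (reachU d12 (mlt3_reach m1 c1) (mlt3_reach m2 c2)) (mlt2_reach m3 ce)).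
have bz : b z = - b x - b y.
  have := bs; rewrite (bigD1 x) // (bigD1 y) 1?eq_sym //= (bigD1 z) /=; last by rewrite zx eq_sym.
  rewrite big1 ?addr0 => [h|w /andP[/andP[wx wy] wz]]; last by rewrite b0 // !inE !negb_or wx wy.
  by rewrite -[RHS]add0r -h; ring.
move=> v; rewrite /flow_to.
have [->|vx] := eqVneq v x; first by rewrite (negbTE xy) [x == z]eq_sym (negbTE zx) /=; ring.
have [->|vy] := eqVneq v y; first by rewrite (negbTE yz) /=; ring.
have [->|vz] := eqVneq v z; first by rewrite bz /=; ring.
by rewrite (b0 v) /=; [ring|rewrite !inE !negb_or vx vy].
Qed.

Lemma szrel4 (D1 D2 D3 D4 : {set E}) (x y p q : V) : uniq [:: x; y; p; q] ->
  [disjoint D1 & D2] -> [disjoint D1 :|: D2 & D3] -> [disjoint D1 :|: D2 :|: D3 & D4] ->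
  mlt D1 x y 3 -> mlt D2 y p 3 -> mlt D3 p q 3 -> mlt D4 q x 3 ->
  szrel [set x; y; p; q] (D1 :|: D2 :|: D3 :|: D4).
Proof.
move=> un d2 d3 d4 m1 m2 m3 m4 b [b0 bs].
move: un; rewrite /= !inE !negb_or !andbT => /and3P[/and3P[xy xp xq] /andP[yp yq] pq].
have [c [c0 c1 c2 c3]] := Z5_avoid4 (b x) (b x + b y) (b x + b y + b p).
apply: eq_reach (reachU d4 (reachU d3 (reachU d2 (mlt3_reach m1 c1) (mlt3_reach m2 c2))
  (mlt3_reach m3 c3)) (mlt3_reach m4 c0)).
have bz : b q = - b x - b y - b p.
  have := bs; rewrite (bigD1 x) // (bigD1 y) 1?eq_sym //= (bigD1 p) /=;
    last by rewrite eq_sym xp eq_sym.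
  rewrite (bigD1 q) /=; last by rewrite eq_sym xq eq_sym yq eq_sym.
  rewrite big1 ?addr0 => [h|w /andP[/andP[/andP[wx wy] wp] wq]]; last first.
    by rewrite b0 // !inE !negb_or wx wy wp.
  by rewrite -[RHS]add0r -h; ring.
move=> v; rewrite /flow_to.
have [->|vx] := eqVneq v x; first by rewrite (negbTE xy) (negbTE xp) (negbTE xq) /=; ring.
have [->|vy] := eqVneq v y; first by rewrite (negbTE yp) (negbTE yq) /=; ring.
have [->|vp] := eqVneq v p; first by rewrite (negbTE pq) /=; ring.
have [->|vz] := eqVneq v q; first by rewrite bz /=; ring.
by rewrite (b0 v) /=; [ring|rewrite !inE !negb_or vx vy vp].
Qed.

Lemma szrelK4 (D1 D2 D3 D4 D5 D6 : {set E}) (x y z w : V) : uniq [:: x; y; z; w] ->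
  [disjoint D1 & D2] -> [disjoint D1 :|: D2 & D3] -> [disjoint D1 :|: D2 :|: D3 & D4] ->
  [disjoint D1 :|: D2 :|: D3 :|: D4 & D5] ->
  [disjoint D1 :|: D2 :|: D3 :|: D4 :|: D5 & D6] ->
  mlt D1 x y 2 -> mlt D2 y z 2 -> mlt D3 z x 2 ->
  mlt D4 w x 2 -> mlt D5 w y 2 -> mlt D6 w z 2 ->
  szrel [set x; y; z; w] (D1 :|: D2 :|: D3 :|: D4 :|: D5 :|: D6).
Proof.
move=> un d2 d3 d4 d5 d6 m1 m2 m3 m4 m5 m6 b [b0 bs].
move: un; rewrite /= !inE !negb_or !andbT => /and3P[/and3P[xy xz xw] /andP[yz yw] zw].
have [a1 [a2 [a3 [b1 [b2 [b3 [sub e1 e2 e3]]]]]]] := Z5_K4 (b x) (b y) (b z).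
have ev c : c \in [:: a1; a2; a3; b1; b2; b3] -> c \in even2 by apply: sub.
apply: eq_reach (reachU d6 (reachU d5 (reachU d4 (reachU d3 (reachU d2
  (mlt2_reach m1 (ev a1 _)) (mlt2_reach m2 (ev a2 _))) (mlt2_reach m3 (ev a3 _)))
  (mlt2_reach m4 (ev b1 _))) (mlt2_reach m5 (ev b2 _))) (mlt2_reach m6 (ev b3 _)));
  rewrite ?inE ?eqxx ?orbT //.
have bz : b w = - b x - b y - b z.
  have := bs; rewrite (bigD1 x) // (bigD1 y) 1?eq_sym //= (bigD1 z) /=;
    last by rewrite eq_sym xz eq_sym.
  rewrite (bigD1 w) /=; last by rewrite eq_sym xw eq_sym yw eq_sym.
  rewrite big1 ?addr0 => [h|u /andP[/andP[/andP[ux uy] uz] uw]]; last first.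
    by rewrite b0 // !inE !negb_or ux uy uz.
  by rewrite -[RHS]add0r -h; ring.
move=> v; rewrite /flow_to.
have [->|vx] := eqVneq v x; first by rewrite (negbTE xy) (negbTE xz) (negbTE xw) e1 /=; ring.
have [->|vy] := eqVneq v y; first by rewrite (negbTE yz) (negbTE yw) e2 /=; ring.
have [->|vz] := eqVneq v z; first by rewrite (negbTE zw) e3 /=; ring.
have [->|vw] := eqVneq v w; first by rewrite bz e1 e2 e3 /=; ring.
by rewrite (b0 v) /=; [ring|rewrite !inE !negb_or vx vy vz].
Qed.

End SmallGraphs.

(** * Colourings of the vertices *)

Lemma sub_card (T : finType) (P : {set T}) a : (a <= #|P|)%N ->
  exists2 Q : {set T}, Q \subset P & #|Q| = a.
Proof.
elim: a => [|a IH] aP; first by exists set0; rewrite ?sub0set ?cards0.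
have [Q QP Qa] := IH (ltnW aP).
have /properP[_ [x xP xQ]] : Q \proper P.
  rewrite properEneq QP andbT; apply: contraTneq aP => <-; by rewrite Qa ltnn.
by exists (x |: Q); rewrite ?cardsU1 ?xQ ?Qa // subUset sub1set xP.
Qed.

Lemma inl_inj (A B : Type) : injective (@inl A B).
Proof. by move=> x y []. Qed.

Lemma inr_inj (A B : Type) : injective (@inr A B).
Proof. by move=> x y []. Qed.

Section Colorings.
Variables (V E : finType).
Implicit Types (U A : {set V}) (D DA L P Q : {set E}) (s t : E -> V).

Definition ncol U (T : finType) (c : V -> T) := #|c @: U|.

Definition cross s t D (T : finType) (c : V -> T) :=
  #|[set e in D | c (s e) != c (t e)]|.

(** For 2 and 3 classes the general inequality would give only 2 and 7 edges; 4 and 8 are the edge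
    numbers of the configurations in [szrel2] and [szrel3]. *)
Definition bnd (n e : nat) : Prop :=
  [/\ n = 2 -> 4 <= e, n = 3 -> 8 <= e & 4 <= n -> 11 * n <= 2 * e + 19]%N.

(* For [n >= 4] colour classes [P_1, ..., P_n], the last clause of [bnd] reads
   [\sum_i d(P_i) - 11 n + 19 >= 0]. *)
Definition good U s t D := forall c : V -> V, bnd (ncol U c) (cross s t D c).

Definition wf U s t D := forall e, e \in D -> [/\ s e \in U, t e \in U & s e != t e].

Lemma bnd_le1 n e : (n <= 1)%N -> bnd n e.
Proof. by move=> n1; split; lia. Qed.

Lemma bnd_mono n e e' : (e <= e')%N -> bnd n e -> bnd n e'.
Proof. by move=> ee [h1 h2 h3]; split; lia. Qed.

(** Refinements take colours in sum types, while [good] speaks of colours in [V]; each colour is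
    renamed to a vertex of [U] that bears it. *)
Lemma recolor U s t D (T : finType) (c : V -> T) : wf U s t D ->
  exists c0 : V -> V, ncol U c0 = ncol U c /\ cross s t D c0 = cross s t D c.
Proof.
move=> w; have [U0|[v0 v0U]] := set_0Vmem U.
  exists id; rewrite /ncol U0 !imset0 !cards0; split=> //.
  by apply: eq_card => e; rewrite !inE; case: (boolP (e \in D)) => // /w[]; rewrite U0 inE.
pose h (x : T) := odflt v0 [pick v in U | c v == x].
have hc v : v \in U -> c (h (c v)) = c v.
  by move=> vU; rewrite /h; case: pickP => [u /andP[_ /eqP]//|/(_ v)]; rewrite vU eqxx.
exists (h \o c); split.
  rewrite /ncol imset_comp card_in_imset // => _ _ /imsetP[u uU ->] /imsetP[v vU ->] e.
  by rewrite -(hc u) // e hc.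
apply: eq_card => e; rewrite !inE; case: (boolP (e \in D)) => //= eD.
have [sU tU _] := w e eD; congr negb; apply/eqP/eqP => [h'|->//].
by rewrite -(hc (s e)) // h' hc.
Qed.

Lemma good_gen U s t D (T : finType) (c : V -> T) : wf U s t D ->
  good U s t D -> bnd (ncol U c) (cross s t D c).
Proof. by move=> w g; have [c0 [<- <-]] := recolor c w. Qed.

Lemma ncol_inj U (T : finType) (c : V -> T) : {in U &, injective c} -> ncol U c = #|U|.
Proof. exact: card_in_imset. Qed.

Lemma ncol_lt U (T : finType) (c : V -> T) x y :
  x \in U -> y \in U -> x != y -> c x = c y -> (ncol U c < #|U|)%N.
Proof.
move=> xU yU xy cxy; rewrite ltn_neqAle leq_imset_card andbT.
by apply: contra xy => /imset_injP inj; apply/eqP; apply: inj.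
Qed.

Lemma ncol_ltP U (T : finType) (c : V -> T) : (ncol U c < #|U|)%N ->
  exists x y, [/\ x \in U, y \in U, x != y & c x = c y].
Proof.
move=> lt; have : ~~ [forall x in U, forall y in U, (c x == c y) ==> (x == y)].
  apply: contraTN lt => /forall_inP h; rewrite -leqNgt ncol_inj // => x y xU yU cxy.
  by move: (h x xU) => /forall_inP/(_ y yU); rewrite cxy eqxx => /eqP.
rewrite negb_forall_in => /exists_inP[x xU]; rewrite negb_forall_in => /exists_inP[y yU].
by rewrite negb_imply => /andP[/eqP cxy xy]; exists x, y.
Qed.

(** The class of [a] is subdivided along [q]: its one colour is lost, hence the successor, and the
    cut edges add up. *)
Lemma refine U s t D (T : finType) (c : V -> T) (q : V -> V) a
    (A := [set v in U | c v == c a]) :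
  wf U s t D -> a \in U ->
  exists c' : V -> T + V,
    (ncol U c').+1 = (ncol U c + ncol A q)%N /\
    cross s t D c' = (cross s t D c + cross s t (inside s t A D) q)%N.
Proof.
move=> w aU.
exists (fun v => if v \in A then inr (q v) else inl (c v)); split.
  rewrite {1}/ncol; have -> : [set (if v \in A then inr (q v) else inl (c v)) | v in U] =
      (inl @: ((c @: U) :\ c a) :|: inr @: (q @: A)) :> {set T + V}.
    apply/setP => x; apply/imsetP/setUP => [[v vU ->]|].
      case: (boolP (v \in A)) => vA; [right|left].
        by apply: imset_f; apply: imset_f.
      apply: imset_f; rewrite !inE imset_f // andbT.
      by move: vA; rewrite inE vU.
    case=> /imsetP[y + ->].
      rewrite inE => /andP[+ /imsetP[v vU yv]]; rewrite {}yv inE => ne.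
      by exists v; rewrite // inE vU (negbTE ne).
    by case/imsetP=> v vA ->; exists v; [move: vA; rewrite inE => /andP[]|rewrite vA].
  rewrite cardsU (_ : _ :&: _ = set0) ?cards0 ?subn0; last first.
    apply/setP => x; rewrite !inE; apply/negbTE/negP => /andP[/imsetP[y _ ->] /imsetP[z _]] //.
  rewrite (card_imset _ (@inl_inj _ _)) (card_imset _ (@inr_inj _ _)).
  by rewrite /ncol [in RHS](cardsD1 (c a)) (imset_f c aU).
rewrite /cross -cardsUI [X in (_ + X)%N](_ : _ = 0)%N ?addn0; last first.
  apply/eqP; rewrite cards_eq0; apply/eqP/setP => e; rewrite !inE.
  apply/negbTE/negP => /andP[/andP[_ ne] /andP[/and3P[_ /andP[_ /eqP h1] /andP[_ /eqP h2]] _]].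
  by rewrite h1 h2 eqxx in ne.
apply: eq_card => e; rewrite !inE; case: (boolP (e \in D)) => //= eD.
have [-> -> _] := w e eD; rewrite /=.
case: (eqVneq (c (s e)) (c a)) => [hs|ns]; case: (eqVneq (c (t e)) (c a)) => [ht|nt] //=.
- by rewrite hs ht eqxx.
- by rewrite hs eq_sym nt.
- by rewrite ht ns.
- by rewrite orbF.
Qed.

Lemma cross_rm s t D DA L (T : finType) (c : V -> T) :
  (forall e, e \in DA -> e \notin L -> c (s e) = c (t e)) ->
  (cross s t D c <= cross s t (D :\: DA) c + cross s t L c)%N.
Proof.
move=> h; apply: leq_trans (leq_card_setU _ _); apply: subset_leq_card.
apply/subsetP => e; rewrite !inE => /andP[-> ne]; rewrite ne !andbT.
case: (boolP (e \in L)); rewrite ?orbT // => eL; rewrite orbF.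
by apply: contra ne => eA; rewrite h.
Qed.

Lemma cross_card s t D (T : finType) (c : V -> T) : (cross s t D c <= #|D|)%N.
Proof. by apply: subset_leq_card; apply/subsetP => e; rewrite inE => /andP[]. Qed.

Lemma crossU s t D D' (T : finType) (c : V -> T) :
  (cross s t (D :|: D') c <= cross s t D c + cross s t D' c)%N.
Proof.
apply: leq_trans (leq_card_setU _ _); apply: subset_leq_card.
by apply/subsetP => e; rewrite !inE => /andP[/orP[]-> ->]; rewrite ?orbT.
Qed.

Lemma cross0 s t D (T : finType) (c : V -> T) :
  (forall e, e \in D -> c (s e) = c (t e)) -> cross s t D c = 0%N.
Proof.
move=> h; apply/eqP; rewrite cards_eq0; apply/eqP/setP => e; rewrite !inE.
by case: (boolP (e \in D)) => //= /h->; rewrite eqxx.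
Qed.

Definition par s t D x y := [set e in D | link s t e x y].
Definition mu s t D x y := #|par s t D x y|.

Lemma muC s t D x y : mu s t D x y = mu s t D y x.
Proof. by apply: eq_card => e; rewrite !inE linkC. Qed.

Lemma link_eq s t e x y u v : link s t e x y -> link s t e u v ->
  ((u == x) && (v == y)) || ((u == y) && (v == x)).
Proof.
by rewrite /link => /orP[]/andP[/eqP-> /eqP->] /orP[]/andP[/eqP-> /eqP->];
  rewrite !eqxx ?orbT.
Qed.

Lemma par_disjoint s t D D' x y u v P Q : P \subset par s t D x y -> Q \subset par s t D' u v ->
  ~~ (((u == x) && (v == y)) || ((u == y) && (v == x))) -> [disjoint P & Q].
Proof.
move=> /subsetP h1 /subsetP h2 ne; rewrite -setI_eq0; apply/eqP/setP => e; rewrite !inE.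
apply/negbTE; apply: contra ne => /andP[/h1 + /h2]; rewrite !inE => /andP[_ l] /andP[_].
exact: link_eq.
Qed.

Lemma mu_pick s t D x y a : (a <= mu s t D x y)%N ->
  exists2 P : {set E}, P \subset par s t D x y & mlt s t P x y a.
Proof.
move=> /sub_card[P PP Pa]; exists P => //; rewrite -Pa; apply: mlt_set => e.
by move/(subsetP PP); rewrite inE => /andP[].
Qed.

End Colorings.

(** * Reducible configurations *)

(** Numerical core of [gap_bnd4]: [n], [m] are the numbers of colours and of cut edges of a
    colouring, [k], [f] those of a violation inside one class of size [a], [n'], [m'] those of the
    refinement, and [e] counts the edges lost by lifting. *)
Lemma gap_arith (k f n' m' n m a UU e : nat) :
  (5 <= UU -> 1 < n -> e <= 4 -> (UU <= a.+1 -> e <= 2) -> (a = 3 -> f <= 6) ->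
  (k = 2 /\ f <= 3 \/ k = 3 /\ f <= 7 \/ 4 <= k /\ 2 * f + 20 <= 11 * k) ->
  n' <= UU -> k <= a -> n + a <= UU.+1 -> 3 <= a ->
  n'.+1 = n + k -> m' = m + f ->
  (n' < UU -> 11 * n' + 5 <= 2 * m' + 19) -> (n' = 3 -> 11 <= m') ->
  (4 <= n' -> 11 * n' <= 2 * m' + 19) -> bnd n (m - e))%N.
Proof.
move=> U5 n1 e4 sing E6 nb n'U kA tA A3 nE mE g5 g3 g4.
(* A refinement that is not yet injective has slack of its own; for an injective one, [n' = UU]
   forces [k = a]. *)
have [n'lt|n'ge] := ltnP n' UU.
  have {g5} g5 := g5 n'lt; clear sing E6 g4.
  case: nb => [[k2 f3]|[[k3 f7]|[k4 fk]]].
  - case: (eqVneq n 2%N) => [n2|n2]; first have {}g3 : (11 <= m')%N by apply: g3; lia.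
      by split; lia.
    by clear g3; split; lia.
  - by clear g3; split; lia.
  - by clear g3; split; lia.
have {g5 g3 n'ge n'U}n'E : n' = UU by lia.
have {}g4 : (11 * n' <= 2 * m' + 19)%N by apply: g4; lia.
case: nb => [[k2 f3]|[[k3 f7]|[k4 fk]]].
- by exfalso; lia.
- case: (eqVneq a 3%N) => [/E6|a3]; first by clear sing; split; lia.
  by clear E6 sing; split; lia.
- clear E6; case: (eqVneq n 2%N) => [n2|n2]; last by clear sing; split; lia.
  by have {}sing : (e <= 2)%N by [apply: sing; lia]; split; lia.
Qed.

Lemma two_le_nbnd k e : ~ bnd k e -> (2 <= k)%N.
Proof. by move=> nb; rewrite ltnNge; apply/negP => /bnd_le1. Qed.

Lemma nbndP k e : (2 <= k)%N -> ~ bnd k e ->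
  (k = 2 /\ e <= 3 \/ k = 3 /\ e <= 7 \/ 4 <= k /\ 2 * e + 20 <= 11 * k)%N.
Proof.
move=> k2 nb; have [k_2|k_3|k4] : [\/ k = 2, k = 3 | 4 <= k]%N.
- by case: k k2 {nb} => [|[|[|[|k]]]] //; [constructor 1|constructor 2|constructor 3].
- left; split=> //; rewrite leqNgt; apply/negP => e4; apply: nb; split; lia.
- right; left; split=> //; rewrite leqNgt; apply/negP => e4; apply: nb; split; lia.
- right; right; split=> //; rewrite leqNgt; apply/negP => e4; apply: nb; split; lia.
Qed.

Lemma disjointUl (T : finType) (A B C : {set T}) :
  [disjoint A :|: B & C] = [disjoint A & C] && [disjoint B & C].
Proof. by rewrite -!setI_eq0 setIUl setU_eq0. Qed.

Lemma setU_regroup (T : finType) (P1 P2 P3 L1 L2 : {set T}) :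
  P1 :|: P2 :|: P3 :|: (L1 :|: L2) = (P1 :|: L1) :|: (P2 :|: L2) :|: P3.
Proof.
apply/setP => e; rewrite !in_setU.
by case: (e \in P1); case: (e \in P2); case: (e \in P3); case: (e \in L1); case: (e \in L2).
Qed.

Section MinCounterexample.
Variables (V E : finType) (U : {set V}) (D : {set E}) (s t : E -> V).
Implicit Types (A : {set V}) (DA L P Q : {set E}).

Hypothesis IH : forall (U' : {set V}) (s' t' : E -> V) (D' : {set E}),
  (#|U'| < #|U|)%N -> maclane s' t' D' -> wf U' s' t' D' -> good U' s' t' D' ->
  szrel s' t' U' D'.
Hypothesis Dplanar : maclane s t D.
Hypothesis Dwf : wf U s t D.
Hypothesis Dgood : good U s t D.
Hypothesis Dnsz : ~ szrel s t U D.

Notation mu := (mu s t D).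
Notation par := (par s t D).

Lemma gbnd (T : finType) (c : V -> T) : bnd (ncol U c) (cross s t D c).
Proof. exact: good_gen. Qed.

(** Common core of all reductions: the contraction of [A] is smaller, so by minimality it realizes
    the induced boundary, and [DA] corrects the rest. Only colourings constant on [A] matter, since
    these are the colourings of the contraction. *)
Lemma contract_absurd A DA a : a \in A -> (1 < #|A|)%N -> A \subset U ->
  DA \subset D -> inside s t A D \subset DA -> conn s t A D -> szrel s t A DA ->
  (forall c : V -> V, {in A &, forall x y, c x = c y} ->
     bnd (ncol U c) (cross s t (D :\: DA) c)) -> False.
Proof.
move=> aA A1 AU DAD iDA cA szA cb; apply: Dnsz => b [b0 bs].
pose r := collapse A a.
have rU v : v \in U -> r v \in U.
  by rewrite /r /collapse; case: ifP => // _ _; exact: (subsetP AU).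
apply: (reach_contract aA DAD szA).
have /IH : (#|r @: U| < #|U|)%N.
  have [x [y [xA yA xy]]] : exists x y, [/\ x \in A, y \in A & x != y].
    by move/card_gt1P: A1 => [x [y [xA yA xy]]]; exists x, y.
  by apply: (ncol_lt (x := x) (y := y)); rewrite ?(subsetP AU) // /r /collapse xA yA.
apply.
- apply: (planar_sub (D := D :\: inside s t A D)); last exact: setDS.
  by apply: planar_collapse => // e /Dwf[].
- move=> e; rewrite inE => /andP[ne eD]; have [sU tU /eqP st] := Dwf eD.
  split; try by apply: imset_f.
  apply: contra ne => /eqP re; apply: (subsetP iDA); rewrite inE eD /=.
  exact: collapse_inj re st.
- move=> c; have := cb (c \o r).
  have -> : ncol U (c \o r) = ncol (r @: U) c by rewrite /ncol imset_comp.
  by apply=> x y xA yA; rewrite /= /r /collapse xA yA.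
split=> [v vU|].
  case: ifP => [/eqP va|_].
    by move: vU; rewrite va -[a in a \notin _](_ : r a = a) ?imset_f ?(subsetP AU) // /r /collapse aA.
  case: ifP => // vA; apply: b0; apply: contra vU => vU.
  by rewrite -[v](_ : r v = v) ?imset_f // /r /collapse vA.
rewrite -[RHS]bs [RHS](bigID (mem A)) /= (bigD1 a) //= eqxx; congr (_ + _).
rewrite [LHS](bigID (mem A)) /= big1 ?add0r => [|v /andP[/negbTE-> ->]//].
apply: eq_big => v; last by move=> /andP[/negbTE-> /negbTE->].
by rewrite andb_idl //; apply: contraNneq => ->.
Qed.

(** No cut edge of a colouring constant on [A] is lost, so the contraction inherits the density. *)
Lemma contract_inside A P : (1 < #|A|)%N -> A \subset U ->
  P \subset inside s t A D -> szrel s t A P -> False.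
Proof.
move=> A1 AU PA szP.
have szA : szrel s t A (inside s t A D).
  by apply: szrel_sub szP PA _ => e; rewrite !inE => /and3P[_ _].
have [a aA] : exists a, a \in A by apply/card_gt0P; apply: ltnW.
apply: (contract_absurd aA A1 AU _ (subxx _)) => //.
- by apply/subsetP => e; rewrite inE => /andP[].
- exact: szrel_conn.
move=> c cA; have := gbnd c; apply: bnd_mono.
have := @cross_rm _ _ s t D (inside s t A D) set0 _ c; rewrite (_ : cross s t set0 c = 0)%N ?addn0.
  apply=> e; rewrite inE => /and3P[_ sA tA] _; exact: cA.
by apply: cross0 => e; rewrite inE.
Qed.

(* Contraction of [A] after the edges of [L], which leave [A], have been lifted. *)
Lemma contract_lift A P L : (1 < #|A|)%N -> A \subset U ->
  P \subset inside s t A D -> L \subset D -> conn s t A D ->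
  szrel s t A (P :|: L) ->
  (forall c : V -> V, {in A &, forall x y, c x = c y} ->
     bnd (ncol U c) (cross s t D c - cross s t L c)) -> False.
Proof.
move=> A1 AU PA LD cA szA cb.
have [a aA] : exists a, a \in A by apply/card_gt0P; apply: ltnW.
have iD : inside s t A D \subset D by apply/subsetP => e; rewrite inE => /andP[].
apply: (contract_absurd (DA := inside s t A D :|: L) aA A1 AU) => //.
- by rewrite subUset iD.
- exact: subsetUl.
- apply: szrel_sub szA _ _; first exact: setSU.
  by move=> e; rewrite !inE negb_or => /andP[/andP[_ /negbTE->]]; rewrite orbF => /and3P[_ -> ->].
move=> c cc; have := cb c cc; apply: bnd_mono; rewrite leq_subLR addnC.
apply: cross_rm => e; rewrite inE => /orP[|->//].
by rewrite inE => /and3P[_ sA tA] _; apply: cc.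
Qed.

Lemma mu_edge x y : (0 < mu x y)%N -> exists2 e, e \in D & link s t e x y.
Proof. by move/card_gt0P=> [e]; rewrite inE => /andP[eD l]; exists e. Qed.

Lemma mu_wf x y : (0 < mu x y)%N -> [/\ x \in U, y \in U & x != y].
Proof.
move/mu_edge=> [e eD]; have [sU tU st] := Dwf eD.
by case/orP=> /andP[/eqP<- /eqP<-]; split=> //; rewrite eq_sym.
Qed.

Lemma par_inside A x y P : P \subset par x y -> x \in A -> y \in A ->
  P \subset inside s t A D.
Proof.
move=> /subsetP PP xA yA; apply/subsetP => e /PP; rewrite !inE => /andP[-> l].
by case/orP: l => /andP[/eqP-> /eqP->]; rewrite xA yA.
Qed.

Lemma mu_le3 x y : (mu x y <= 3)%N.
Proof.
rewrite leqNgt; apply/negP => m4.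
have [xU yU xy] := mu_wf (ltnW (ltnW (ltnW m4))).
have [P PP m] := mu_pick m4.
apply: (contract_inside (A := [set x; y]) _ _ _ (szrel2 xy m)).
- by rewrite cards2 xy.
- by rewrite subUset !sub1set xU yU.
- by apply: par_inside PP _ _; rewrite !inE eqxx ?orbT.
Qed.

Lemma no_T332 x y z : (3 <= mu x y -> 3 <= mu y z -> 2 <= mu z x -> False)%N.
Proof.
move=> h1 h2 h3.
have [xU yU xy] := mu_wf (ltnW (ltnW h1)); have [_ zU yz] := mu_wf (ltnW (ltnW h2)).
have [_ _ zx] := mu_wf (ltnW h3).
have [P1 PP1 m1] := mu_pick h1; have [P2 PP2 m2] := mu_pick h2; have [P3 PP3 m3] := mu_pick h3.
have [A1 A2 A3] : [/\ x \in [set x; y; z], y \in [set x; y; z] & z \in [set x; y; z]].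
  by rewrite !inE !eqxx ?orbT.
apply: (contract_inside (A := [set x; y; z]) _ _ _ (szrel3 xy yz zx _ _ m1 m2 m3)).
- by apply: leq_trans (subset_leq_card (_ : [set x; y] \subset _)); rewrite ?cards2 ?xy // subsetUl.
- by rewrite !subUset !sub1set xU yU zU.
- by rewrite !subUset (par_inside PP1) ?(par_inside PP2) ?(par_inside PP3).
- apply: par_disjoint PP1 PP2 _.
  by rewrite [y == x]eq_sym (negbTE xy) (negbTE zx) andbF.
- rewrite disjointUl; apply/andP; split.
    apply: par_disjoint PP1 PP3 _; by rewrite [z == y]eq_sym (negbTE zx) (negbTE yz).
  apply: par_disjoint PP2 PP3 _; by rewrite [z == y]eq_sym (negbTE xy) andbF (negbTE yz).
Qed.

Section Large.
Hypothesis U4 : (4 <= #|U|)%N.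

(** The class [A] is a proper subset of [U]. Were its induced subgraph good, it would realize all
    boundaries by minimality and could be contracted; hence some [q] violates the bounds on [A]. *)
Lemma gap (T : finType) (c : V -> T) a (A := [set v in U | c v == c a]) :
  a \in U -> (1 < #|A|)%N -> (1 < ncol U c)%N ->
  exists (T' : finType) (c' : V -> T') (q : V -> V),
  [/\ ~ bnd (ncol A q) (cross s t (inside s t A D) q),
      (ncol U c').+1 = (ncol U c + ncol A q)%N &
      cross s t D c' = (cross s t D c + cross s t (inside s t A D) q)%N].
Proof.
move=> aU A1 n1.
have AU : A \subset U by apply/subsetP => v; rewrite inE => /andP[].
have ltA : (#|A| < #|U|)%N.
  rewrite ltn_neqAle subset_leq_card // andbT; apply: contraTneq n1 => AUc.
  have /eqP AE : A == U by rewrite eqEcard AU AUc leqnn.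
  rewrite -leqNgt -(cards1 (c a)); apply: subset_leq_card.
  apply/subsetP => _ /imsetP[v vU ->]; rewrite inE.
  by move: vU; rewrite -AE inE => /andP[].
have /existsNP[q nq] : ~ good A s t (inside s t A D).
  move=> g; apply: (contract_inside A1 AU (subxx _)); apply: IH => //.
    by apply: planar_sub Dplanar _; apply/subsetP => e; rewrite inE => /andP[].
  by move=> e; rewrite !inE => /and3P[eD]; have [-> -> ->] := Dwf eD.
have [c' [h1 h2]] := refine c q Dwf aU.
by exists _, c', q.
Qed.

Lemma gap_exists (T : finType) (c : V -> T) : (1 < ncol U c < #|U|)%N ->
  exists (T' : finType) (c' : V -> T') k e,
  [/\ (2 <= k)%N, ~ bnd k e, (ncol U c').+1 = (ncol U c + k)%N &
      cross s t D c' = (cross s t D c + e)%N].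
Proof.
move=> /andP[n1 /ncol_ltP[x [y [xU yU xy cxy]]]].
have A1 : (1 < #|[set v in U | c v == c x]|)%N.
  by apply/card_gt1P; exists x, y; split; rewrite ?inE ?xU ?yU ?cxy ?eqxx.
have [T' [c' [q [h1 h2 h3]]]] := gap xU A1 n1.
exists T', c', (ncol [set v in U | c v == c x] q), (cross s t (inside s t [set v in U | c v == c x] D) q).
by split=> //; exact: two_le_nbnd h1.
Qed.

(** A violation with [k] classes and [e] cut edges has [11 * k - 2 * e] at least 16, attained at
    [k = 2], [e = 3]. Refinement adds only [k - 1] classes, so the bound on the refined colouring
    leaves a slack of [16 - 11 = 5]. *)
Lemma gap5 (T : finType) (c : V -> T) : (1 < ncol U c < #|U|)%N ->
  (11 * ncol U c + 5 <= 2 * cross s t D c + 19)%N.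
Proof.
move=> cn; have [T' [c' [k [e [k2 /(nbndP k2) nb h1 h2]]]]] := gap_exists cn.
have [b1 b2 b3] := gbnd c'; lia.
Qed.

(** The refined colouring is either subject to [gap5] itself or injective; in the latter case at
    least 4 vertices force a violation with [k >= 3]. *)
Lemma gap_two (T : finType) (c : V -> T) : ncol U c = 2%N -> (6 <= cross s t D c)%N.
Proof.
move=> n2; have cn : (1 < ncol U c < #|U|)%N by lia.
have [T' [c' [k [e [k2 /(nbndP k2) nb h1 h2]]]]] := gap_exists cn.
have [b1 b2 b3] := gbnd c'.
case: (ltnP (ncol U c') #|U|) => lt; last by lia.
by have := @gap5 _ c'; rewrite lt andbT; lia.
Qed.

Lemma gap_three (T : finType) (c : V -> T) : (5 <= #|U|)%N -> ncol U c = 3%N ->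
  (11 <= cross s t D c)%N.
Proof.
move=> U5 n2; have cn : (1 < ncol U c < #|U|)%N by lia.
have [T' [c' [k [e [k2 /(nbndP k2) nb h1 h2]]]]] := gap_exists cn.
have [b1 b2 b3] := gbnd c'.
case: (ltnP (ncol U c') #|U|) => lt; last by lia.
by have := @gap5 _ c'; rewrite lt andbT; lia.
Qed.

(** Two lost edges cost 4, within the slack 5 of [gap5]; the bound 6 of [gap_two] covers two
    classes. *)
Lemma gap_bnd2 (T : finType) (c : V -> T) e x y : x \in U -> y \in U -> x != y ->
  c x = c y -> (e <= 2)%N -> bnd (ncol U c) (cross s t D c - e).
Proof.
move=> xU yU xy cxy e2; have lt := ncol_lt xU yU xy cxy.
have := @gap5 _ c; rewrite lt andbT; have := @gap_two _ c; have [_ _ _] := gbnd c.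
by split; lia.
Qed.

Lemma cards2_le (e f : E) : (#|[set e; f]| <= 2)%N.
Proof. by rewrite cards2; case: (_ != _). Qed.

Lemma disjoint_outside A P L : P \subset inside s t A D ->
  (forall e, e \in L -> ~~ ((s e \in A) && (t e \in A))) -> [disjoint P & L].
Proof.
move=> /subsetP PA LA; rewrite -setI_eq0; apply/eqP/setP => e; rewrite !inE.
by apply/negbTE/negP => /andP[/PA + /LA]; rewrite inE => /andP[_ ->].
Qed.

Lemma link_outside A e x z : link s t e x z -> z \notin A -> ~~ ((s e \in A) && (t e \in A)).
Proof. by case/orP=> /andP[/eqP-> /eqP->] /negbTE->; rewrite ?andbF. Qed.

Lemma lift_outside A e f x z y : link s t e x z -> link s t f z y -> z \notin A ->
  forall g, g \in [set e; f] -> ~~ ((s g \in A) && (t g \in A)).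
Proof.
move=> le lf zA g; rewrite !inE => /orP[] /eqP->; first exact: link_outside le zA.
by rewrite linkC in lf; apply: link_outside lf zA.
Qed.

Lemma lift_neq e f x z y : link s t e x z -> link s t f z y -> x != y -> x != z -> e != f.
Proof.
move=> le lf xy xz; apply: contraTneq le => ->; apply/negP => l.
have := link_eq l lf; rewrite [z == x]eq_sym (negbTE xz) /= => /andP[_ h].
by rewrite eq_sym h in xy.
Qed.

(** Lifting a path [x z y] provides the fourth parallel edge needed by [szrel2]. *)
Lemma no_tri3 x y z : (3 <= mu x y -> 0 < mu x z -> 0 < mu z y -> False)%N.
Proof.
move=> h1 h2 h3.
have [xU yU xy] := mu_wf (ltnW (ltnW h1)); have [_ zU xz] := mu_wf h2; have [_ _ zy] := mu_wf h3.
have [P PP m] := mu_pick h1.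
have [e eD le] := mu_edge h2; have [f fD lf] := mu_edge h3.
have zA : z \notin [set x; y] by rewrite !inE negb_or eq_sym xz zy.
have PA : P \subset inside s t [set x; y] D by apply: par_inside PP _ _; rewrite !inE eqxx ?orbT.
have [g gD lg] := mu_edge (ltnW (ltnW h1)).
have dis := disjoint_outside PA (lift_outside le lf zA).
have ef := lift_neq le lf xy xz.
apply: (contract_lift (A := [set x; y]) (P := P) (L := [set e; f])) => //.
- by rewrite cards2 xy.
- by rewrite subUset !sub1set xU yU.
- by rewrite subUset !sub1set eD fD.
- by apply: connU1 gD lg; [exact: conn1|rewrite inE].
- by apply: szrel2 => //; apply: mltU dis m (mlt_lift ef le lf).
move=> c cc; apply: gap_bnd2 xU yU xy _ _; first by apply: cc; rewrite !inE eqxx ?orbT.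
by apply: leq_trans (cross_card _ _ _ _) (cards2_le _ _).
Qed.

(** Lifting a path [x z y] makes the double side [x y] triple, giving the four-cycle of [szrel4]. *)
Lemma no_T222_C4 x y z p q : uniq [:: x; y; p; q] -> z \notin [:: x; y; p; q] ->
  (2 <= mu x y -> 0 < mu x z -> 0 < mu z y ->
   3 <= mu y p -> 3 <= mu p q -> 3 <= mu q x -> False)%N.
Proof.
move=> un zA h1 h2 h3 h4 h5 h6.
have [xU yU xy] := mu_wf (ltnW h1); have [_ zU xz] := mu_wf h2; have [_ _ zy] := mu_wf h3.
have [_ pU yp] := mu_wf (ltnW (ltnW h4)); have [qU _ qx] := mu_wf (ltnW (ltnW h6)).
have [P1 PP1 m1] := mu_pick h1; have [P2 PP2 m2] := mu_pick h4.
have [P3 PP3 m3] := mu_pick h5; have [P4 PP4 m4] := mu_pick h6.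
have [e eD le] := mu_edge h2; have [f fD lf] := mu_edge h3.
set A := [set x; y; p; q].
have zA' : z \notin A by move: zA; rewrite !inE !orbA.
have [Ax Ay Ap Aq] : [/\ x \in A, y \in A, p \in A & q \in A].
  by rewrite !inE !eqxx ?orbT.
have I1 := par_inside PP1 Ax Ay; have I2 := par_inside PP2 Ay Ap.
have I3 := par_inside PP3 Ap Aq; have I4 := par_inside PP4 Aq Ax.
have out := lift_outside le lf zA'.
have ef := lift_neq le lf xy xz.
have dL P : P \subset inside s t A D -> [disjoint [set e; f] & P].
  by move=> PI; rewrite disjoint_sym; apply: disjoint_outside PI out.
have m1' := mltU (disjoint_outside I1 out) m1 (mlt_lift ef le lf).
have [g1 g1D lg1] := mu_edge (ltnW h1); have [g2 g2D lg2] := mu_edge (ltnW (ltnW h4)).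
have [g3 g3D lg3] := mu_edge (ltnW (ltnW h6)).
move: un; rewrite /= !inE !negb_or !andbT => /and3P[/and3P[_ xp xq] /andP[_ yq] pq].
have neqs := (negbTE xy, negbTE xp, negbTE xq, negbTE yp, negbTE yq, negbTE pq,
  eq_sym y x, eq_sym p x, eq_sym q x, eq_sym p y, eq_sym q y, eq_sym q p, andbF).
apply: (contract_lift (A := A) (P := P1 :|: P2 :|: P3 :|: P4) (L := [set e; f])) => //.
- by apply: leq_trans (subset_leq_card (_ : [set x; y] \subset _));
  rewrite ?cards2 ?xy // /A -setUA subsetUl.
- by rewrite !subUset !sub1set xU yU pU qU.
- by rewrite !subUset I1 I2 I3.
- by rewrite subUset !sub1set eD fD.
- rewrite (_ : A = q |: (p |: (y |: [set x]))); last first.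
    by apply/setP => v; rewrite !inE; do 4!case: (v == _).
  apply: (connU1 _ _ g3D lg3); last by rewrite !inE eqxx ?orbT.
  rewrite linkC in lg2; apply: (connU1 _ _ g2D lg2); last by rewrite !inE eqxx ?orbT.
  rewrite linkC in lg1; apply: (connU1 _ _ g1D lg1); last by rewrite !inE eqxx ?orbT.
  exact: conn1.
- rewrite (_ : _ :|: _ = (P1 :|: [set e; f]) :|: P2 :|: P3 :|: P4); last first.
    apply/setP => v; rewrite (in_setU v _ [set e;
      f]) !(in_setU v _ P3, in_setU v _ P4, in_setU v _ P2).
    rewrite (in_setU v P1); case: (v \in P1); case: (v \in P2); case: (v \in P3); case: (v \in P4);
    by rewrite ?orbT ?orbF.
  apply: (szrel4 _ _ _ _ m1' m2 m3 m4).
  + by rewrite /= !inE !negb_or xy xp xq yp yq pq.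
  + rewrite disjointUl dL // andbT; apply: par_disjoint PP1 PP2 _; by rewrite !neqs.
  + rewrite 2!disjointUl dL // andbT; apply/andP; split.
      apply: par_disjoint PP1 PP3 _; by rewrite !neqs.
    apply: par_disjoint PP2 PP3 _; by rewrite !neqs.
  + rewrite 3!disjointUl dL // andbT; apply/andP; split; first apply/andP; first split.
    * apply: par_disjoint PP1 PP4 _; by rewrite !neqs.
    * apply: par_disjoint PP2 PP4 _; by rewrite !neqs.
    * apply: par_disjoint PP3 PP4 _; by rewrite !neqs.
move=> c cc; apply: gap_bnd2 xU yU xy _ _; first exact: cc.
by apply: leq_trans (cross_card _ _ _ _) (cards2_le _ _).
Qed.

Lemma no_C4 x y p q : uniq [:: x; y; p; q] ->
  (3 <= mu x y -> 3 <= mu y p -> 3 <= mu p q -> 3 <= mu q x -> False)%N.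
Proof.
move=> un h1 h4 h5 h6.
have [xU yU xy] := mu_wf (ltnW (ltnW h1)).
have [_ pU yp] := mu_wf (ltnW (ltnW h4)); have [qU _ qx] := mu_wf (ltnW (ltnW h6)).
have [P1 PP1 m1] := mu_pick h1; have [P2 PP2 m2] := mu_pick h4.
have [P3 PP3 m3] := mu_pick h5; have [P4 PP4 m4] := mu_pick h6.
set A := [set x; y; p; q].
have [Ax Ay Ap Aq] : [/\ x \in A, y \in A, p \in A & q \in A].
  by rewrite !inE !eqxx ?orbT.
have I1 := par_inside PP1 Ax Ay; have I2 := par_inside PP2 Ay Ap.
have I3 := par_inside PP3 Ap Aq; have I4 := par_inside PP4 Aq Ax.
have un' := un; move: un; rewrite /= !inE !negb_or !andbT => /and3P[/and3P[_ xp xq] /andP[_ yq] pq].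
have neqs := (negbTE xy, negbTE xp, negbTE xq, negbTE yp, negbTE yq, negbTE pq,
  eq_sym y x, eq_sym p x, eq_sym q x, eq_sym p y, eq_sym q y, eq_sym q p, andbF).
apply: (contract_inside (A := A) _ _ _ (szrel4 un' _ _ _ m1 m2 m3 m4)) => //.
- by apply: leq_trans (subset_leq_card (_ : [set x; y] \subset _));
  rewrite ?cards2 ?xy // /A -setUA subsetUl.
- by rewrite !subUset !sub1set xU yU pU qU.
- by rewrite !subUset I1 I2 I3.
- apply: par_disjoint PP1 PP2 _; by rewrite !neqs.
- rewrite !disjointUl; apply/andP; split.
    apply: par_disjoint PP1 PP3 _; by rewrite !neqs.
  apply: par_disjoint PP2 PP3 _; by rewrite !neqs.
- rewrite !disjointUl; apply/andP; split; first apply/andP; first split.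
  + apply: par_disjoint PP1 PP4 _; by rewrite !neqs.
  + apply: par_disjoint PP2 PP4 _; by rewrite !neqs.
  + apply: par_disjoint PP3 PP4 _; by rewrite !neqs.
Qed.

Lemma no_K4 x y z w : uniq [:: x; y; z; w] ->
  (2 <= mu x y -> 2 <= mu y z -> 2 <= mu z x ->
   2 <= mu w x -> 2 <= mu w y -> 2 <= mu w z -> False)%N.
Proof.
move=> un h1 h2 h3 h4 h5 h6.
have [xU yU xy] := mu_wf (ltnW h1); have [wU zU wz] := mu_wf (ltnW h6).
have [P1 PP1 m1] := mu_pick h1; have [P2 PP2 m2] := mu_pick h2.
have [P3 PP3 m3] := mu_pick h3; have [P4 PP4 m4] := mu_pick h4.
have [P5 PP5 m5] := mu_pick h5; have [P6 PP6 m6] := mu_pick h6.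
set A := [set x; y; z; w].
have [Ax Ay Az Aw] : [/\ x \in A, y \in A, z \in A & w \in A].
  by rewrite !inE !eqxx ?orbT.
have un' := un; move: un;
  rewrite /= !inE !negb_or !andbT => /and3P[/and3P[_ xz xw] /andP[yz yw] zw].
have neqs := (negbTE xy, negbTE xz, negbTE xw, negbTE yz, negbTE yw, negbTE zw,
  eq_sym y x, eq_sym z x, eq_sym w x, eq_sym z y, eq_sym w y, eq_sym w z, andbF).
apply: (contract_inside (A := A) _ _ _ (szrelK4 un' _ _ _ _ _ m1 m2 m3 m4 m5 m6)) => //.
- by apply: leq_trans (subset_leq_card (_ : [set x; y] \subset _));
  rewrite ?cards2 ?xy // /A -setUA subsetUl.
- by rewrite !subUset !sub1set xU yU zU wU.
- by rewrite !subUset (par_inside PP1) ?(par_inside PP2) ?(par_inside PP3)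
    ?(par_inside PP4) ?(par_inside PP5) ?(par_inside PP6).
- by apply: par_disjoint PP1 PP2 _; rewrite !neqs.
- by rewrite !disjointUl (par_disjoint PP1 PP3) ?(par_disjoint PP2 PP3) // !neqs.
- by rewrite !disjointUl (par_disjoint PP1 PP4) ?(par_disjoint PP2 PP4) ?(par_disjoint PP3 PP4) // !neqs.
- by rewrite !disjointUl (par_disjoint PP1 PP5) ?(par_disjoint PP2 PP5) ?(par_disjoint PP3 PP5)
    ?(par_disjoint PP4 PP5) // !neqs.
- by rewrite !disjointUl (par_disjoint PP1 PP6) ?(par_disjoint PP2 PP6) ?(par_disjoint PP3 PP6)
    ?(par_disjoint PP4 PP6) ?(par_disjoint PP5 PP6) // !neqs.
Qed.

(** Four lost edges cost 8, more than one application of [gap5] allows. If the refinement is not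
    injective, [gap5] applies to it as well and the slack is 10. Otherwise the violation separates
    all vertices of a class containing [x], [y], [z]. It then has [k >= 4], with slack 9, or it is
    the doubled triangle with at most 6 edges, with slack [33 - 12 - 11 = 10]. *)
Lemma gap_bnd4 (c : V -> V) x y z w u e : (5 <= #|U|)%N ->
  mu x y = 2%N -> mu y z = 2%N -> mu z x = 2%N -> c x = c y -> c y = c z ->
  (e <= 4)%N -> ((c w == c y) || (c u == c y) -> (e <= 2)%N) -> w \in U -> u \in U -> w != u ->
  bnd (ncol U c) (cross s t D c - e).
Proof.
move=> U5 h1 h2 h3 cxy cyz e4 e2 wU uU wu.
have [xU yU xy] : [/\ x \in U, y \in U & x != y] by apply: mu_wf; rewrite h1.
have [_ zU yz] : [/\ y \in U, z \in U & y != z] by apply: mu_wf; rewrite h2.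
have [_ _ zx] : [/\ z \in U, x \in U & z != x] by apply: mu_wf; rewrite h3.
case: (leqP (ncol U c) 1) => [|n1]; first exact: bnd_le1.
have A1 : (1 < #|[set v in U | c v == c y]|)%N.
  by apply/card_gt1P; exists x, y; split; rewrite ?inE ?xU ?yU ?cxy ?eqxx.
have [T' [c' [q [nb n' e']]]] := gap yU A1 n1.
set A := [set v in U | c v == c y] in A1 nb n' e'.
have A3 : [set x; y; z] \subset A.
  by rewrite !subUset !sub1set !inE xU yU zU cxy cyz !eqxx.
have c3 : #|[set x; y;
  z]| = 3%N by rewrite -setUA cardsU1 !inE negb_or xy [x == z]eq_sym zx cards2 yz.
have A3c : (3 <= #|A|)%N by rewrite -c3 subset_leq_card.
have AU : A \subset U by apply/subsetP => v; rewrite inE => /andP[].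
have AUc := subset_leq_card AU.
have tA : (ncol U c + #|A| <= #|U|.+1)%N.
  have sub : c @: U \subset c y |: (c @: (U :\: A)).
    apply/subsetP => _ /imsetP[v vU ->]; rewrite !inE.
    by case: (eqVneq (c v) (c y)) => //= vy; apply: imset_f; rewrite !inE vU (negbTE vy).
  rewrite -(cardsID A U) (setIidPr AU) -addnS addnC leq_add2l.
  apply: leq_trans (subset_leq_card sub) _; rewrite cardsU1 -add1n.
  by apply: leq_add; [case: (_ \notin _)|exact: leq_imset_card].
have E6 : #|A| = 3%N -> (cross s t (inside s t A D) q <= 6)%N.
  move=> Ac; have AE : A = [set x; y; z] by apply/esym/eqP; rewrite eqEcard A3 c3 Ac.
  apply: leq_trans (cross_card _ _ _ _) _.
  have : inside s t A D \subset par x y :|: par y z :|: par z x.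
    apply/subsetP => f; rewrite AE !inE => /and3P[fD sA tA']; have [_ _ st] := Dwf fD.
    move: sA tA' st; rewrite fD /link /= => /orP[/orP[]|] /eqP-> /orP[/orP[]|] /eqP->;
    by rewrite !eqxx ?orbT.
  move/subset_leq_card/leq_trans; apply; apply: leq_trans (leq_card_setU _ _) _.
  rewrite -[(#|par z x|)%N]/(mu z x) h3 -[6%N]/(4 + 2)%N leq_add2r.
  by apply: leq_trans (leq_card_setU _ _) _; rewrite -/(mu x y) -/(mu y z) h1 h2.
(* A class missing at most one vertex contains [w] or [u]. This settles the case of two classes,
   where slack 9 is not enough. *)
have sing : (#|U| <= #|A|.+1)%N -> (e <= 2)%N.
  move=> UA; apply: e2; apply/negPn/negP; rewrite negb_or => /andP[wA uA].
  have : [set w; u] \subset U :\: A.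
    by rewrite subUset !sub1set !inE wU uU wA uA.
  move/subset_leq_card; rewrite cards2 wu cardsD (setIidPr AU) leqNgt ltnS leq_subLR addn1.
  by rewrite UA.
have k2 := two_le_nbnd nb.
have kA : (ncol A q <= #|A|)%N by apply: leq_imset_card.
have nb' := nbndP k2 nb.
have n'U : (ncol U c' <= #|U|)%N by apply: leq_imset_card.
have [_ _ b3] := gbnd c'.
have n'2 : (1 < ncol U c')%N.
  by rewrite -ltnS n' -[3%N]/(2 + 1)%N; apply: leq_add => //; apply: ltnW.
apply: (gap_arith U5 n1 e4 sing E6 nb' n'U kA tA A3c n' e' _ _ b3).
  by move=> lt; apply: gap5; rewrite lt n'2.
exact: gap_three.
Qed.

(** Lifting paths [x w y] and [y u z] turns the doubled triangle [x y z] into the triangle with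
    multiplicities 3, 3, 2 of [szrel3]. *)
Lemma no_three_T222 x y z w u :
  mu x y = 2%N -> mu y z = 2%N -> mu z x = 2%N ->
  (2 <= mu x w -> 2 <= mu w y -> 2 <= mu y u -> 2 <= mu u z ->
   w != z -> u != x -> w != u -> False)%N.
Proof.
move=> h1 h2 h3 h4 h5 h6 h7 wz ux wu.
have [xU yU xy] : [/\ x \in U, y \in U & x != y] by apply: mu_wf; rewrite h1.
have [_ zU yz] : [/\ y \in U, z \in U & y != z] by apply: mu_wf; rewrite h2.
have [_ _ zx] : [/\ z \in U, x \in U & z != x] by apply: mu_wf; rewrite h3.
have [_ wU xw] := mu_wf (ltnW h4); have [_ _ wy] := mu_wf (ltnW h5).
have [_ uU yu] := mu_wf (ltnW h6); have [_ _ uz] := mu_wf (ltnW h7).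
have neqs := (negbTE xy, negbTE yz, negbTE zx, negbTE xw, negbTE wy, negbTE yu, negbTE uz,
  negbTE wz, negbTE ux, negbTE wu, eq_sym y x, eq_sym z y, eq_sym x z, eq_sym w x, eq_sym y w,
  eq_sym u y, eq_sym z u, eq_sym z w, eq_sym x u, eq_sym u w, andbF).
have U5 : (5 <= #|U|)%N.
  have : [set x; y; z; w; u] \subset U by rewrite !subUset !sub1set xU yU zU wU uU.
  move/subset_leq_card; rewrite -setUA [[set w] :|: _]setUC.
  rewrite -[[set x; y; z] :|: _]setUA -setUA !cardsU1 cards1 !inE !neqs //.
have H1 : (2 <= mu x y)%N by rewrite h1.
have H2 : (2 <= mu y z)%N by rewrite h2.
have H3 : (2 <= mu z x)%N by rewrite h3.
have [P1 PP1 m1] := mu_pick H1; have [P2 PP2 m2] := mu_pick H2; have [P3 PP3 m3] := mu_pick H3.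
have [e1 e1D le1] := mu_edge (ltnW h4); have [f1 f1D lf1] := mu_edge (ltnW h5).
have [e2 e2D le2] := mu_edge (ltnW h6); have [f2 f2D lf2] := mu_edge (ltnW h7).
set A := [set x; y; z].
have [Ax Ay Az] : [/\ x \in A, y \in A & z \in A] by rewrite !inE !eqxx ?orbT.
have wA : w \notin A by rewrite !inE !neqs.
have uA : u \notin A by rewrite !inE !neqs.
have I1 := par_inside PP1 Ax Ay; have I2 := par_inside PP2 Ay Az; have I3 := par_inside PP3 Az Ax.
have out1 := lift_outside le1 lf1 wA; have out2 := lift_outside le2 lf2 uA.
have ef1 := lift_neq le1 lf1 xy xw; have ef2 := lift_neq le2 lf2 yz yu.
set L1 := [set e1; f1] in out1; set L2 := [set e2; f2] in out2.
have d12 : [disjoint L1 & L2].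
  have notw e : link s t e w x || link s t e w y -> ~~ (link s t e y u || link s t e u z).
    by case/orP=> l; rewrite negb_or; apply/andP; split; apply/negP => /(link_eq l); rewrite !neqs.
  rewrite -setI_eq0; apply/eqP/setP => e; rewrite !inE; apply/negbTE/negP => /andP[a b].
  have : link s t e w x || link s t e w y.
    by case/orP: a => /eqP->; rewrite ?lf1 ?orbT // linkC le1.
  by move/notw; case/orP: b => /eqP->; rewrite ?le2 ?lf2 ?orbT.
have m1' := mltU (disjoint_outside I1 out1) m1 (mlt_lift ef1 le1 lf1).
have m2' := mltU (disjoint_outside I2 out2) m2 (mlt_lift ef2 le2 lf2).
have [g gD lg] := mu_edge (ltnW H1); have [g' g'D lg'] := mu_edge (ltnW H2).
apply: (contract_lift (A := A) (P := P1 :|: P2 :|: P3) (L := L1 :|: L2)) => //.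
- by apply: leq_trans (subset_leq_card (_ : [set x; y] \subset _));
  rewrite ?cards2 ?xy // /A subsetUl.
- by rewrite !subUset !sub1set xU yU zU.
- by rewrite !subUset I1 I2 I3.
- by rewrite !subUset !sub1set e1D f1D e2D f2D.
- rewrite (_ : A = z |: (y |: [set x])); last first.
    by apply/setP => v; rewrite !inE; do 3!case: (v == _).
  rewrite linkC in lg'; apply: (connU1 _ _ g'D lg'); last by rewrite !inE eqxx ?orbT.
  rewrite linkC in lg; apply: (connU1 _ _ gD lg); last by rewrite !inE eqxx ?orbT.
  exact: conn1.
- rewrite setU_regroup.
  apply: (szrel3 xy yz zx _ _ m1' m2' m3).
  + rewrite disjointUl; apply/andP; split; rewrite disjoint_sym disjointUl; apply/andP; split.
    * by apply: par_disjoint PP2 PP1 _; rewrite !neqs.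
    * by rewrite disjoint_sym; apply: disjoint_outside I1 out2.
    * exact: disjoint_outside I2 out1.
    * by rewrite disjoint_sym.
  + rewrite 3!disjointUl ![[disjoint _ & P3]]disjoint_sym.
    rewrite (disjoint_outside I3 out1) (disjoint_outside I3 out2) !andbT.
    by rewrite (par_disjoint PP3 PP1) ?(par_disjoint PP3 PP2) // !neqs.
move=> c cc.
have [cxy cyz] : c x = c y /\ c y = c z by split; apply: cc.
apply: (gap_bnd4 (w := w) (u := u) U5 h1 h2 h3) => //.
  apply: leq_trans (crossU _ _ _ _ _) _; rewrite -[4%N]/(2 + 2)%N.
  by apply: leq_add; apply: leq_trans (cross_card _ _ _ _) (cards2_le _ _).
(* A lifted pair whose middle vertex has the colour of the contracted set crosses no colour classes,
   so its removal costs nothing. *)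
have nc e f (a b d : V) : link s t e a d -> link s t f d b -> c a = c d -> c d = c b ->
    cross s t [set e; f] c = 0%N.
  move=> le lf ad db; apply: cross0 => h; rewrite !inE => /orP[] /eqP->.
    by case/orP: le => /andP[/eqP-> /eqP->].
  by case/orP: lf => /andP[/eqP-> /eqP->].
case/orP=> /eqP h; apply: leq_trans (crossU _ _ _ _ _) _.
  rewrite (nc _ _ _ _ _ le1 lf1) ?add0n ?h ?cxy //.
  by apply: leq_trans (cross_card _ _ _ _) (cards2_le _ _).
rewrite (nc _ _ _ _ _ le2 lf2) ?addn0 ?h //.
by apply: leq_trans (cross_card _ _ _ _) (cards2_le _ _).
Qed.

End Large.

End MinCounterexample.

(** * Faces of the underlying simple graph *)

Section SmallCycles.
Variables (V E : finType) (s t : E -> V) (R : {set E}).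
Hypothesis Rloopless : forall e, e \in R -> s e != t e.
Hypothesis Rsimple : forall e f x y, e \in R -> f \in R ->
  link s t e x y -> link s t f x y -> e = f.
Implicit Types (Z : {set E}).

Lemma link_neq e x y : e \in R -> link s t e x y -> x != y.
Proof. by move/Rloopless => + /orP[] /andP[/eqP<- /eqP<-]; rewrite // eq_sym. Qed.

Lemma inc_link e v : e \in R -> inc s t e v -> exists w, link s t e v w.
Proof.
move=> eR; rewrite /inc; case: eqVneq => [<-|_]; case: eqVneq => [<-|_] // _.
  by exists (t e); exact: link_ends.
by exists (s e); rewrite linkC; exact: link_ends.
Qed.

Lemma link_incl e v w : e \in R -> link s t e v w -> inc s t e v.
Proof.
move=> eR l; rewrite (link_inc l) eqxx.
by have := link_neq eR l; rewrite -[v == w]/(v == w) => /negbTE->.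
Qed.

Definition cycle Z := forall v, bd s t (fun e => e \in Z) v = 0.

(** The degree of [y] in [Z] is even, so [Z] has a second edge at [y]; by simplicity it does not
    return to [x]. *)
Lemma next_edge Z e x y : Z \subset R -> cycle Z -> e \in Z -> link s t e x y ->
  exists f w, [/\ f \in Z, f != e, link s t f y w & w != x].
Proof.
move=> /subsetP ZR cZ eZ l.
have ly : link s t e y x by rewrite linkC.
have /existsP[f /and3P[fe fZ fy]] : [exists f, [&& f != e, f \in Z & inc s t f y]].
  apply: contraT => /existsPn h; have := cZ y; rewrite /bd (bigD1 e) //= eZ mul1r.
  rewrite (link_incl (ZR _ eZ) ly) big1 // => f fe; have := h f; rewrite fe /=.
  by case: (f \in Z); rewrite ?mul0r //= mul1r => /negbTE.
have [w lw] := inc_link (ZR _ fZ) fy.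
exists f, w; split=> //; apply: contra fe => /eqP wx.
by apply/eqP; apply: (Rsimple (ZR _ fZ) (ZR _ eZ) _ ly); rewrite -wx.
Qed.

Definition triangle Z x y w e1 e2 e3 :=
  [/\ Z = [set e1; e2; e3], link s t e1 x y, link s t e2 y w & link s t e3 w x].

Lemma triangle_rot Z x y w e1 e2 e3 :
  triangle Z x y w e1 e2 e3 -> triangle Z y w x e2 e3 e1.
Proof.
by case=> -> l1 l2 l3; split=> //; apply/setP => e; rewrite !inE; do 3!case: (e == _).
Qed.

Lemma triangle_flip Z x y w e1 e2 e3 :
  triangle Z x y w e1 e2 e3 -> triangle Z y x w e1 e3 e2.
Proof.
case=> -> l1 l2 l3; split; try by rewrite linkC.
by apply/setP => e; rewrite !inE; do 3!case: (e == _).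
Qed.

Lemma triangle_edge Z x y w e1 e2 e3 e a b :
  triangle Z x y w e1 e2 e3 -> e \in Z -> link s t e a b ->
  exists u f g, triangle Z a b u e f g.
Proof.
have flip1 x' y' w' e1' e2' e3' : triangle Z x' y' w' e1' e2' e3' ->
    link s t e1' a b -> exists u f g, triangle Z a b u e1' f g.
  move=> T; have [_ l _ _] := T; move=> /(link_eq l) /orP[] /andP[/eqP-> /eqP->].
    by exists w', e2', e3'.
  by exists w', e3', e2'; apply: triangle_flip.
move=> T; have [ZE _ _ _] := T; rewrite {1}ZE !inE => /orP[/orP[]|] /eqP->.
- exact: flip1 T.
- exact: flip1 (triangle_rot T).
- exact: flip1 (triangle_rot (triangle_rot T)).
Qed.

Definition square Z x y p q e1 e2 e3 e4 :=
  [/\ Z = [set e1; e2; e3; e4], uniq [:: e1; e2; e3; e4], uniq [:: x; y; p; q] &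
    [/\ link s t e1 x y, link s t e2 y p, link s t e3 p q & link s t e4 q x]].

Lemma square_rot Z x y p q e1 e2 e3 e4 :
  square Z x y p q e1 e2 e3 e4 -> square Z y p q x e2 e3 e4 e1.
Proof.
case=> -> un un' [l1 l2 l3 l4]; split=> //.
- by apply/setP => e; rewrite !inE; do 4!case: (e == _).
- by rewrite -(rot_uniq 1) in un.
- by rewrite -(rot_uniq 1) in un'.
Qed.

Lemma subset_card_eq Z (Y : {set E}) : Y \subset Z -> (#|Z| <= #|Y|)%N -> Z = Y.
Proof. by move=> sub le; apply/esym/eqP; rewrite eqEcard sub. Qed.

Lemma uniq_card (r : seq E) : uniq r -> #|[set x in r]| = size r.
Proof. by move=> u; rewrite cardsE; apply/card_uniqP. Qed.

(** An element of the cycle space need not be a single circuit, but four edges of a loopless simple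
    graph leave no room for anything except a triangle or a square. *)
Lemma small_cycle Z : Z \subset R -> cycle Z -> Z != set0 -> (#|Z| <= 4)%N ->
  (exists x y w e1 e2 e3, triangle Z x y w e1 e2 e3 /\ uniq [:: e1; e2; e3]) \/
  (exists x y p q e1 e2 e3 e4, square Z x y p q e1 e2 e3 e4).
Proof.
move=> ZR cZ /set0Pn[e1 e1Z] Z4; have sR := subsetP ZR.
set x := s e1; set y := t e1.
have l1 : link s t e1 x y by exact: link_ends.
have [e2 [w [e2Z e21 l2 wx]]] := next_edge ZR cZ e1Z l1.
have [e3 [u [e3Z e32 l3 uy]]] := next_edge ZR cZ e2Z l2.
have xy := link_neq (sR _ e1Z) l1; have yw := link_neq (sR _ e2Z) l2.
have wu := link_neq (sR _ e3Z) l3.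
have e31 : e3 != e1.
  apply: contraTneq l3 => ->; apply/negP => /(link_eq l1).
  by rewrite (negbTE wx) [w == y]eq_sym (negbTE yw).
have [ux|ux] := eqVneq u x.
  rewrite ux in l3; left; exists x, y, w, e1, e2, e3; split; last first.
    by rewrite /= !inE negb_or eq_sym e21 eq_sym e31 eq_sym e32.
  split=> //; apply/eqP; rewrite eqEsubset; apply/andP; split; last first.
    by rewrite !subUset !sub1set e1Z e2Z e3Z.
  apply/subsetP => e4 e4Z; apply/negPn/negP => e4n.
  (* Both [Z] and the triangle are cycles, so a fourth edge alone would be one, that is, a loop. *)
  have ZE : Z = [set f in [:: e4; e1; e2; e3]].
    apply: subset_card_eq.
      by apply/subsetP => f; rewrite !inE => /or4P[] /eqP->.
    rewrite uniq_card //= !inE !negb_or; move: e4n; rewrite !inE !negb_or => /andP[/andP[-> ->] ->].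
    by rewrite /= ![e1 == _]eq_sym e21 e31 [e2 == _]eq_sym e32.
  have e4x : inc s t e4 (s e4) by apply: (link_incl (sR _ e4Z)); exact: link_ends.
  have := cZ (s e4); rewrite /bd (bigD1 e4) // e4Z mul1r e4x.
  suff -> : \sum_(i | i != e4) (i \in Z) * inc s t i (s e4) = 0 :> bool by [].
  rewrite (bigD1 e1) /=; last by apply: contraNneq e4n => <-; rewrite !inE eqxx.
  rewrite (bigD1 e2) /=; last by rewrite e21 andbT; apply: contraNneq e4n => <-;
    rewrite !inE eqxx orbT.
  rewrite (bigD1 e3) /=; last first.
    by rewrite e31 e32 !andbT; apply: contraNneq e4n => <-; rewrite !inE eqxx orbT.
  rewrite big1 => [|f /andP[/andP[/andP[f4 f1] f2] f3]]; last first.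
    by rewrite ZE !inE (negbTE f1) (negbTE f2) (negbTE f3) (negbTE f4) mul0r.
  rewrite e1Z e2Z e3Z !mul1r (link_inc l1) (link_inc l2) (link_inc l3).
  by case: (s e4 == x); case: (s e4 == y); case: (s e4 == w).
have [e4 [v [e4Z e43 l4 vw]]] := next_edge ZR cZ e3Z l3.
have uv := link_neq (sR _ e4Z) l4.
have e41 : e4 != e1.
  apply: contraTneq l4 => ->; apply/negP => /(link_eq l1).
  by rewrite (negbTE ux) (negbTE uy).
have e42 : e4 != e2.
  apply: contraTneq l4 => ->; apply/negP => /(link_eq l2).
  by rewrite (negbTE uy) [u == w]eq_sym (negbTE wu).
have un : uniq [:: e1; e2; e3; e4].
  rewrite /= !inE !negb_or ![e1 == _]eq_sym e21 e31 e41 ![e2 == _]eq_sym e32 e42.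
  by rewrite eq_sym e43.
have ZE : Z = [set f in [:: e1; e2; e3; e4]].
  apply: subset_card_eq; last by rewrite uniq_card.
  by apply/subsetP => f; rewrite !inE => /or4P[] /eqP->.
(* The second edge of [Z] at [x] can only be [e4], which closes the square. *)
have [f [a [fZ fe1 lf ay]]] : exists f w, [/\ f \in Z, f != e1, link s t f x w & w != y].
  by apply: next_edge => //; rewrite linkC.
have fE : f = e4.
  move: fZ; rewrite ZE !inE (negbTE fe1) /= => /or3P[] /eqP // h; rewrite h in lf.
    by have := link_eq l2 lf; rewrite (negbTE xy) [x == w]eq_sym (negbTE wx).
  by have := link_eq l3 lf; rewrite [x == w]eq_sym (negbTE wx) [x == u]eq_sym (negbTE ux).
have vx : v = x.
  rewrite fE in lf; have := link_eq lf l4; rewrite (negbTE ux) /=.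
  by case/andP=> _ /eqP.
right; exists x, y, w, u, e1, e2, e3, e4; split=> //; last by split=> //; rewrite vx in l4.
  by rewrite ZE; apply/setP => g; rewrite !inE -!orbA.
by rewrite /= !inE !negb_or xy [x == w]eq_sym wx [x == u]eq_sym ux yw [y == u]eq_sym uy wu.
Qed.

End SmallCycles.

(** The four values must sum to at most -44; the only combinations above it are four times -10 and
    one -13 with three times -10. *)
Lemma square_arith (a b c d : int) :
  a = -10 \/ a = -13 \/ a <= -14 -> b = -10 \/ b = -13 \/ b <= -14 ->
  c = -10 \/ c = -13 \/ c <= -14 -> d = -10 \/ d = -13 \/ d <= -14 ->
  ~ (a = -10 /\ b = -10 /\ c = -10 /\ d = -10) ->
  ~ (a = -13 /\ b = -10 /\ c = -10 /\ d = -10) ->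
  ~ (b = -13 /\ c = -10 /\ d = -10 /\ a = -10) ->
  ~ (c = -13 /\ d = -10 /\ a = -10 /\ b = -10) ->
  ~ (d = -13 /\ a = -10 /\ b = -10 /\ c = -10) ->
  44 + (a + (b + (c + d))) <= 0.
Proof.
move=> A B C D n0 n1 n2 n3 n4.
case: A => [a1|[a1|a1]]; case: B => [b1|[b1|b1]]; case: C => [c1|[c1|c1]];
case: D => [d1|[d1|d1]];
solve [by clear n0 n1 n2 n3 n4; lia | by exfalso; auto 10].
Qed.

Lemma sum_seq_set (E : finType) (Z : {set E}) (r : seq E) (f : E -> int) :
  uniq r -> Z =i r -> \sum_(e in Z) f e = \sum_(e <- r) f e.
Proof.
move=> un ZE; rewrite big_uniq //=; apply: eq_bigl => e; exact: ZE.
Qed.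

Section FaceArgument.
Variables (V E : finType) (U : {set V}) (D : {set E}) (s t : E -> V).
Hypothesis Dplanar : maclane s t D.
Hypothesis Dwf : wf U s t D.
Hypothesis U4 : (4 <= #|U|)%N.
Hypothesis Dmany : (11 * #|U| <= 2 * #|D| + 19)%N.
Notation mu := (mu s t D).
Hypothesis mu3 : forall x y, (mu x y <= 3)%N.
Hypothesis no_tri3 : forall x y z,
  (3 <= mu x y -> 0 < mu x z -> 0 < mu z y -> False)%N.
Hypothesis no_T222_C4 : forall x y z p q,
  uniq [:: x; y; p; q] -> z \notin [:: x; y; p; q] ->
  (2 <= mu x y -> 0 < mu x z -> 0 < mu z y ->
   3 <= mu y p -> 3 <= mu p q -> 3 <= mu q x -> False)%N.
Hypothesis no_C4 : forall x y p q, uniq [:: x; y; p; q] ->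
  (3 <= mu x y -> 3 <= mu y p -> 3 <= mu p q -> 3 <= mu q x -> False)%N.
Hypothesis no_K4 : forall x y z w, uniq [:: x; y; z; w] ->
  (2 <= mu x y -> 2 <= mu y z -> 2 <= mu z x ->
   2 <= mu w x -> 2 <= mu w y -> 2 <= mu w z -> False)%N.
Hypothesis no_three_T222 : forall x y z w u,
  mu x y = 2%N -> mu y z = 2%N -> mu z x = 2%N ->
  (2 <= mu x w -> 2 <= mu w y -> 2 <= mu y u -> 2 <= mu u z ->
   w != z -> u != x -> w != u -> False)%N.
Hypothesis gap_two : forall c : V -> bool, ncol U c = 2%N -> (6 <= cross s t D c)%N.

(** The choice depends only on the parallel class of [e], so the fixed points of [rep] form the
    underlying simple graph. *)
Let rep e := odflt e [pick f in D | link s t f (s e) (t e)].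

Let R : {set E} := [set e in D | rep e == e].

Lemma rep_link e : e \in D -> rep e \in D /\ link s t (rep e) (s e) (t e).
Proof.
move=> eD; rewrite /rep; case: pickP => [f /andP[]//|/(_ e)].
by rewrite eD link_ends.
Qed.

Lemma link_same e f x y g : link s t e x y -> link s t f x y ->
  link s t g (s e) (t e) = link s t g (s f) (t f).
Proof.
have h e' : link s t e' x y -> link s t g (s e') (t e') = link s t g x y.
  by case/orP=> /andP[/eqP-> /eqP->]; rewrite // linkC.
by move=> le lf; rewrite !h.
Qed.

Lemma rep_eq e f x y : e \in D -> f \in D -> link s t e x y -> link s t f x y -> rep e = rep f.
Proof.
move=> eD fD le lf; rewrite /rep.
have h g : (g \in D) && link s t g (s e) (t e) = (g \in D) && link s t g (s f) (t f).
  by rewrite (link_same g le lf).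
by rewrite (eq_pick h); case: pickP => // /(_ f); rewrite fD link_ends.
Qed.

Lemma rep_R e : e \in D -> rep e \in R.
Proof.
move=> eD; have [rD rl] := rep_link eD; rewrite inE rD /=; apply/eqP.
by apply: rep_eq rD eD rl (link_ends _ _ _).
Qed.

Lemma R_D e : e \in R -> e \in D. Proof. by rewrite inE => /andP[]. Qed.

Lemma R_loopless e : e \in R -> s e != t e.
Proof. by move/R_D/Dwf => []. Qed.

Lemma R_simple e f x y : e \in R -> f \in R -> link s t e x y -> link s t f x y -> e = f.
Proof.
rewrite !inE => /andP[eD /eqP re] /andP[fD /eqP rf] le lf.
by rewrite -re -rf; apply: rep_eq lf.
Qed.

Let m e := mu (s e) (t e).

Lemma m_link e x y : link s t e x y -> m e = mu x y.
Proof. by case/orP=> /andP[/eqP e1 /eqP e2]; rewrite /m e1 e2 // muC. Qed.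

Lemma m_gt0 e : e \in D -> (0 < m e)%N.
Proof. by move=> eD; apply/card_gt0P; exists e; rewrite inE eD link_ends. Qed.

Lemma sum_m : (\sum_(e in R) m e)%N = #|D|.
Proof.
rewrite -[RHS]sum1_card [RHS](partition_big rep (mem R)) /=; last by move=> e; exact: rep_R.
apply: eq_bigr => e eR; rewrite sum1dep_card; apply: eq_card => f; rewrite !inE.
case: (boolP (f \in D)) => //= fD; have [rD rl] := rep_link fD.
apply/idP/eqP => [l|<-].
  have /eqP <- : rep e == e by move: eR; rewrite inE => /andP[].
  by apply: rep_eq fD (R_D eR) l (link_ends _ _ _).
case/orP: rl => /andP[/eqP-> /eqP->]; first exact: link_ends.
by rewrite linkC; exact: link_ends.
Qed.

Section Faces.
Variables (I : finType) (F : I -> E -> bool).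
Hypothesis RF : faces s t R F.

Let Z i := [set e | F i e].
(** Such a face has charge [3 * (4 * 2 - 22) = -42], which exceeds by 2 the bound -44 of [face_le];
    hence the transfers. *)
Let T i := (#|Z i| == 3)%N && [forall e in Z i, m e == 2%N].
Let nT e : nat := (\sum_i (F i e && T i))%N.

Lemma Z_R i : Z i \subset R.
Proof. by have [FR _ _ _] := RF; apply/subsetP => e; rewrite inE => /FR. Qed.

Lemma Z_cycle i : cycle s t (Z i).
Proof.
have [_ Fb _ _] := RF; move=> v; rewrite -[RHS](Fb i v); apply: eq_bd => e.
by rewrite inE.
Qed.

Lemma T_m i e : T i -> F i e -> m e = 2%N.
Proof. by case/andP=> _ /forall_inP h Fe; apply/eqP/h; rewrite inE. Qed.

Lemma nT_pair e i : F i e -> exists j, [/\ j != i, F j e,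
  forall k, F k e = (k == i) || (k == j) & nT e = (T i + T j)%N].
Proof.
have [_ _ Fc _] := RF; case: (Fc e) => [h|[j [k [jk h]]]]; first by rewrite h.
have nTE i' j' : i' != j' -> (forall k', F k' e = (k' == i') || (k' == j')) -> nT e = (T i' + T j')%N.
  move=> ij hij; rewrite /nT (bigD1 i') //= (bigD1 j') 1?eq_sym //= big1 => [|x /andP[xi xj]].
    by rewrite !hij !eqxx orbT addn0.
  by rewrite hij (negbTE xi) (negbTE xj).
rewrite h => /orP[/eqP->|/eqP->].
  by exists k; rewrite eq_sym jk h eqxx orbT; split=> //; apply: nTE.
exists j; rewrite jk h eqxx; split=> //; first by move=> x; rewrite h orbC.
by apply: nTE; rewrite 1?eq_sym // => x; rewrite h orbC.
Qed.

Lemma T_triangle i : T i -> exists x y w e1 e2 e3, triangle s t (Z i) x y w e1 e2 e3.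
Proof.
move=> /andP[/eqP Z3 _]; have [||h|h] := small_cycle R_loopless R_simple (Z_R i) (@Z_cycle i).
- by rewrite -card_gt0 Z3.
- by rewrite Z3.
- by case: h => x [y [w [e1 [e2 [e3 [h _]]]]]]; exists x, y, w, e1, e2, e3.
case: h => x [y [p [q [e1 [e2 [e3 [e4 [ZE un _ _]]]]]]]].
move: Z3; rewrite ZE (_ : [set _; _; _; _] = [set f in [:: e1; e2; e3; e4]]) ?uniq_card //.
by apply/setP => g; rewrite !inE -!orbA.
Qed.

Lemma T_through e x y : link s t e x y -> forall j, T j -> F j e ->
  exists u f g, triangle s t (Z j) x y u e f g.
Proof.
move=> l j Tj je; have [x' [y' [w' [e1 [e2 [e3 tr]]]]]] := T_triangle Tj.
by apply: triangle_edge tr _ l; rewrite inE.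
Qed.

Lemma triangle_in i x y w e1 e2 e3 : triangle s t (Z i) x y w e1 e2 e3 ->
  [/\ F i e1, F i e2 & F i e3].
Proof.
case=> ZE _ _ _; have h e : e \in [set e1; e2; e3] -> F i e by rewrite -ZE inE.
by rewrite !h // !inE eqxx ?orbT.
Qed.

Lemma ZR i e : F i e -> e \in R.
Proof. by move=> ie; apply: (subsetP (Z_R i)); rewrite inE. Qed.

Lemma triangle_mu i x y w e1 e2 e3 : T i -> triangle s t (Z i) x y w e1 e2 e3 ->
  [/\ mu x y = 2%N, mu y w = 2%N & mu w x = 2%N].
Proof.
move=> Ti tr; have [F1 F2 F3] := triangle_in tr; have [_ l1 l2 l3] := tr.
by rewrite -(m_link l1) -(m_link l2) -(m_link l3) !(T_m Ti).
Qed.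

(* Two faces with the same boundary triangle would make two of its edges a cut
   of the simple graph, hence give a cut of size 4 of the multigraph. *)
Lemma no_twins i j x y w e1 e2 e3 : T i -> triangle s t (Z i) x y w e1 e2 e3 ->
  i != j -> Z i = Z j -> False.
Proof.
move=> Ti tr ij ZE; have [F1 F2 F3] := triangle_in tr; have [h1 h2 h3] := triangle_mu Ti tr.
have [_ l1 l2 l3] := tr; have [R1 R2] := (ZR F1, ZR F2).
have FE e : F i e = F j e by have := congr1 (fun A : {set E} => e \in A) ZE; rewrite !inE.
have xy := link_neq R_loopless R1 l1; have yw := link_neq R_loopless R2 l2.
have wx := link_neq R_loopless (ZR F3) l3.
have e12 : e1 != e2.
  apply: contraTneq l1 => ->; apply/negP => /(link_eq l2).
  by rewrite (negbTE xy) [x == w]eq_sym (negbTE wx).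
have only k e : F i e -> F k e = (k == i) || (k == j).
  move=> ie; have [j' [ji je hk _]] := nT_pair ie.
  by move: (hk j); rewrite -FE ie eq_sym (negbTE ij) /= => /esym/eqP->.
(* The only faces through [e1] or [e2] are [i] and [j], and both contain both edges, so every cycle
   contains both edges or neither. *)
have cut : cut_cond s t R [set e1; e2].
  have [_ _ _ Fs] := RF; move=> z zR zb; have [a az] := Fs z zR zb.
  rewrite big_setU1 ?inE //= big_set1 !az -big_split big1 //= => k _.
  by rewrite !(only k) // addrr_bool.
have SR : [set e1; e2] \subset R by rewrite subUset !sub1set R1.
have Sy e : e \in [set e1; e2] -> inc s t e y.
  rewrite !inE => /orP[] /eqP->; last exact: (link_incl R_loopless) l2.
  by rewrite linkC in l1; apply: (link_incl R_loopless) l1.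
have [X [yX XE]] := star_cut SR Sy cut.
pose c v := v \in X.
have c2 : ncol U c = 2%N.
  have [sU tU _] := Dwf (R_D R1).
  have := XE _ R1; rewrite !inE eqxx /= => h.
  apply/eqP; rewrite eqn_leq; apply/andP; split.
    by rewrite -card_bool; apply: max_card.
  rewrite -(cards2 true false).
  apply: subset_leq_card; apply/subsetP => b _; apply/imsetP.
  case: (boolP (s e1 \in X)) h => sX h.
    case: b; [by exists (s e1)|exists (t e1); rewrite // /c; by case: (t e1 \in X) h].
  case: b; [exists (t e1); rewrite // /c; by case: (t e1 \in X) h|exists (s e1) => //].
  by rewrite /c (negbTE sX).
(* Only the parallels of [e1] and of [e2] cross the cut: four edges at most, against the six
   required. *)
have := gap_two c2; rewrite leqNgt; apply/negP; rewrite negbK.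
have : [set e in D | c (s e) != c (t e)] \subset par s t D x y :|: par s t D y w.
  apply/subsetP => e; rewrite inE => /andP[eD ce]; have [rD rl] := rep_link eD.
  have : rep e \in [set e1; e2].
    rewrite XE ?rep_R //; move: ce; rewrite /c; case/orP: rl => /andP[/eqP-> /eqP->].
      by case: (s e \in X); case: (t e \in X).
    by case: (s e \in X); case: (t e \in X).
  rewrite !inE eD /= => /orP[] /eqP re; rewrite re in rl.
    have := link_eq rl l1; by case/orP => /andP[/eqP-> /eqP->];
      rewrite ?link_ends // linkC link_ends.
  have := link_eq rl l2; by case/orP => /andP[/eqP-> /eqP->];
    rewrite ?link_ends ?orbT // [link s t e (t e) _]linkC link_ends orbT.
move/subset_leq_card => le; apply: leq_ltn_trans le _; apply: leq_ltn_trans (leq_card_setU _ _) _.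
by rewrite -/(mu x y) -/(mu y w) h1 h2.
Qed.

(** The face across [e1] is again a doubled triangle; if its apex were [w], the two faces would be
    twins. *)
Lemma T_neighbour i x y w e1 e2 e3 : T i -> triangle s t (Z i) x y w e1 e2 e3 ->
  nT e1 = 2%N -> exists u, [/\ u != w, mu x u = 2%N & mu u y = 2%N].
Proof.
move=> Ti tr n2; have [F1 F2 F3] := triangle_in tr; have [_ l1 l2 l3] := tr.
have [j [ji Fj _]] := nT_pair F1; rewrite n2 Ti; case: (boolP (T j)) => // Tj _.
have [u [f [g tr']]] := T_through l1 Tj Fj.
have [_ F2' F3'] := triangle_in tr'; have [_ h1 h2] := triangle_mu Tj tr'.
exists u; split; [|by rewrite muC|by rewrite muC].
apply/eqP => uw; apply: (no_twins Ti tr (_ : i != j)); first by rewrite eq_sym.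
have [Zi _ _ _] := tr; have [Zj _ l2' l3'] := tr'; rewrite uw in l2' l3'.
by rewrite Zi Zj (R_simple (ZR F2') (ZR F2) l2' l2) (R_simple (ZR F3') (ZR F3) l3' l3).
Qed.

(** Distinct apices of the two neighbours contradict [no_three_T222]; a common apex gives a doubled
    [K4]. *)
Lemma no_two_neighbours i x y w e1 e2 e3 : T i -> triangle s t (Z i) x y w e1 e2 e3 ->
  nT e1 = 2%N -> nT e2 = 2%N -> False.
Proof.
move=> Ti tr n1 n2; have [h1 h2 h3] := triangle_mu Ti tr.
have [u [uw u1 u2]] := T_neighbour Ti tr n1.
have [v [vx v1 v2]] := T_neighbour Ti (triangle_rot tr) n2.
have [uv|uv] := eqVneq u v; last first.
  by apply: (no_three_T222 h1 h2 h3 _ _ _ _ uw vx uv); rewrite ?u1 ?u2 ?v1 ?v2.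
rewrite -uv in v1 v2 vx.
have [F1 F2 F3] := triangle_in tr; have [_ l1 l2 l3] := tr.
have neq a b : mu a b = 2%N -> a != b.
  move=> ab; have /card_gt0P[e] : (0 < mu a b)%N by rewrite ab.
  rewrite inE => /andP[eD l]; have [_ _] := Dwf eD.
  by case/orP: l => /andP[/eqP-> /eqP->] //; rewrite eq_sym.
apply: (@no_K4 x y w u); rewrite ?h1 ?h2 ?h3 ?u2 ?v2 // ?[mu u x]muC ?u1 //.
by rewrite /= !inE !negb_or neq // [x == w]eq_sym neq // neq // neq // neq // eq_sym uw.
Qed.

(* Four times the charge [m e - 11 / 2] that the edge [e] gives to the face [i],
   plus a transfer: a triangle of double edges ([T]) takes 1 from each other face
   that it meets. *)
Let term i e : int := 4 * (m e)%:Z - 22 + (nT e)%:Z - 2 * (T i : nat)%:Z.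

Lemma term_T i e : T i -> F i e -> term i e = (nT e)%:Z - 16.
Proof. by move=> Ti ie; rewrite /term Ti (T_m Ti ie); lia. Qed.

Lemma term_nT i e : ~~ T i -> F i e ->
  [\/ term i e = -10 /\ m e = 3%N,
      [/\ term i e = -13, m e = 2%N & exists2 j, T j & F j e] |
      term i e <= -14 /\ m e = 2%N] \/ term i e <= -18.
Proof.
move=> Ti ie; have [j [ji je _ nE]] := nT_pair ie; rewrite /term nE (negbTE Ti).
have m0 := m_gt0 (R_D (ZR ie)); have m3 : (m e <= 3)%N := mu3 _ _.
case: (boolP (T j)) => Tj; rewrite ?(T_m Tj je) /=.
  by left; constructor 2; split; [lia| |exists j].
have : [\/ m e = 1, m e = 2 | m e = 3]%N.
  by case: (m e) m0 m3 => [|[|[|[|?]]]] // _ _; [constructor 1|constructor 2|constructor 3].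
by case=> mE; rewrite mE; [right|left; constructor 3|left; constructor 1]; split=> //; lia.
Qed.

Lemma term_trichotomy i e : ~~ T i -> F i e ->
  term i e = -10 \/ term i e = -13 \/ term i e <= -14.
Proof.
by move=> Ti ie; have [[[-> _]|[-> _ _]|[h _]]|h] := term_nT Ti ie;
  [left|right; left|right; right|right; right; lia].
Qed.

Lemma term_m3 i e : ~~ T i -> F i e -> term i e = -10 -> m e = 3%N.
Proof.
by move=> Ti ie; have [[[_ ->]|[-> _ _]|[h _]]|h] := term_nT Ti ie => //; lia.
Qed.

Lemma term_T2 i e : ~~ T i -> F i e -> term i e = -13 -> m e = 2%N /\ exists2 j, T j & F j e.
Proof.
by move=> Ti ie; have [[[-> _]|[_ -> ?]|[h _]]|h] := term_nT Ti ie => //; lia.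
Qed.

(** The apex of the doubled triangle across [e1] is not a corner of the square, since its edges have
    multiplicity 2 and the other sides of the square 3; so [no_T222_C4] applies. *)
Lemma no_square_T i x y p q e1 e2 e3 e4 : square s t (Z i) x y p q e1 e2 e3 e4 ->
  m e1 = 2%N -> (exists2 j, T j & F j e1) -> m e2 = 3%N -> m e3 = 3%N -> m e4 = 3%N -> False.
Proof.
case=> ZE _ un [l1 l2 l3 l4] m1 [j Tj je] m2 m3 m4.
have [u [f [g tr]]] := T_through l1 Tj je.
have [h1 h2 h3] := triangle_mu Tj tr; have [_ f1 f2] := triangle_in tr; have [_ _ k1 k2] := tr.
rewrite (m_link l2) in m2; rewrite (m_link l3) in m3; rewrite (m_link l4) in m4.
apply: (@no_T222_C4 x y u p q un); rewrite ?h1 ?m2 ?m3 ?m4 // 1?muC ?h2 ?h3 //.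
rewrite !inE !negb_or (link_neq R_loopless (ZR f2) k2) [u == y]eq_sym.
rewrite (link_neq R_loopless (ZR f1) k1) /=.
apply/andP; split; apply/eqP => uE.
  by move: h2; rewrite uE m2.
by move: h3; rewrite uE m4.
Qed.

(** Outside the doubled triangles every edge gives at most -10, enough for five edges. A doubled
    triangle gives -15 per edge, or -14 towards another one, which happens at most once. Any other
    triangle has no triple edge and some single edge: at most [-18 - 13 - 13 = -44]. *)
Lemma face_le i : i \in nonzero F -> 44 + \sum_(e in Z i) term i e <= 0.
Proof.
rewrite inE => /existsP[e0 ie0].
have Z0 : Z i != set0 by apply/set0Pn; exists e0; rewrite inE.
case: (leqP #|Z i| 4) => [Z4|Z5]; last first.
  have Ti : ~~ T i by rewrite /T gtn_eqF // ltnW.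
  have : \sum_(e in Z i) term i e <= \sum_(e in Z i) (-10).
    apply: ler_sum => e; rewrite inE => ie; have := term_trichotomy Ti ie;
      move: (term i e) => k; clear; lia.
  rewrite sumr_const; move: Z5; move: (\sum_(e in Z i) _) #|Z i| => x k; clear; lia.
have [[x [y [w [e1 [e2 [e3 [tr un]]]]]]]|] :=
    small_cycle R_loopless R_simple (Z_R i) (@Z_cycle i) Z0 Z4.
  have [F1 F2 F3] := triangle_in tr; have [ZE l1 l2 l3] := tr.
  have Zr : Z i =i [:: e1; e2; e3] by move=> e; rewrite ZE !inE -!orbA.
  rewrite (sum_seq_set _ un Zr) !big_cons big_nil addr0.
  case: (boolP (T i)) => Ti.
    rewrite !term_T //.
    have n12 := no_two_neighbours Ti tr; have n23 := no_two_neighbours Ti (triangle_rot tr).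
    have n31 := no_two_neighbours Ti (triangle_rot (triangle_rot tr)).
    have nle e : F i e -> (nT e <= 2)%N.
      by move=> ie; have [j [_ _ _ ->]] := nT_pair ie; case: (T i); case: (T j).
    move: n12 n23 n31 (nle _ F1) (nle _ F2) (nle _ F3).
    move: (nT e1) (nT e2) (nT e3) => a b c; clear; lia.
  have mu0 e x' y' : F i e -> link s t e x' y' -> (0 < mu x' y')%N.
    by move=> ie l; rewrite -(m_link l); apply: m_gt0; apply: R_D; apply: ZR ie.
  have no3 e x' y' w' e' e'' : triangle s t (Z i) x' y' w' e e' e'' ->
      term i e <= -13 /\ m e = 2%N \/ term i e <= -18.
    move=> tr'; have [F1' F2' F3'] := triangle_in tr'; have [_ l1' l2' l3'] := tr'.
    have [[[_ m3]|[-> -> _]|[h ->]]|h] := term_nT Ti F1'; [|by left|by left; split=> //;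
      apply: le_trans h _|by right].
    exfalso; apply: (@no_tri3 x' y' w'); first by rewrite -(m_link l1') m3.
      by rewrite muC; apply: mu0 F3' l3'.
    by rewrite muC; apply: mu0 F2' l2'.
  have := no3 _ _ _ _ _ _ tr; have := no3 _ _ _ _ _ _ (triangle_rot tr).
  have := no3 _ _ _ _ _ _ (triangle_rot (triangle_rot tr)).
  have nT3 : ~ [/\ m e1 = 2%N, m e2 = 2%N & m e3 = 2%N].
    case=> m1 m2 m3; case/negP: Ti; rewrite /T; apply/andP; split.
      have -> : Z i = [set f in [:: e1; e2; e3]] by apply/setP => e; rewrite Zr inE.
      by rewrite uniq_card.
    apply/forall_inP => e; rewrite Zr !inE => /or3P[] /eqP->; exact/eqP.
  case=> [[h3 m3]|h3]; case=> [[h2 m2]|h2]; case=> [[h1 m1]|h1]; try by (move: h1 h2 h3;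
    move: (term i e1) (term i e2) (term i e3) => ? ? ?; clear; lia).
  by case: nT3.
case=> x [y [p [q [e1 [e2 [e3 [e4 sq]]]]]]]; have [ZE un un' [l1 l2 l3 l4]] := sq.
have Zr : Z i =i [:: e1; e2; e3; e4] by move=> e; rewrite ZE !inE -!orbA.
have Ti : ~~ T i.
  rewrite /T (_ : Z i = [set f in [:: e1; e2; e3; e4]]) ?uniq_card //.
  by apply/setP => e; rewrite Zr inE.
have inF e : e \in [:: e1; e2; e3; e4] -> F i e by rewrite -Zr inE.
have [F1 F2 F3 F4] : [/\ F i e1, F i e2, F i e3 & F i e4].
  by split; apply: inF; rewrite !inE eqxx ?orbT.
rewrite (sum_seq_set _ un Zr) !big_cons big_nil addr0.
have noB a b c d x' y' p' q' : square s t (Z i) x' y' p' q' a b c d ->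
    F i a -> F i b -> F i c -> F i d ->
    ~ (term i a = -13 /\ term i b = -10 /\ term i c = -10 /\ term i d = -10).
  move=> sq' Fa Fb Fc Fd [ha [hb [hc hd]]].
  have [ma Ta] := term_T2 Ti Fa ha.
  exact: no_square_T sq' ma Ta (term_m3 Ti Fb hb) (term_m3 Ti Fc hc) (term_m3 Ti Fd hd).
apply: square_arith; try exact: term_trichotomy.
- case=> h1 [h2 [h3 h4]]; apply: (no_C4 un').
  + by rewrite -(m_link l1) (term_m3 Ti F1 h1).
  + by rewrite -(m_link l2) (term_m3 Ti F2 h2).
  + by rewrite -(m_link l3) (term_m3 Ti F3 h3).
  + by rewrite -(m_link l4) (term_m3 Ti F4 h4).
- exact: noB sq F1 F2 F3 F4.
- exact: noB (square_rot sq) F2 F3 F4 F1.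
- exact: noB (square_rot (square_rot sq)) F3 F4 F1 F2.
- exact: noB (square_rot (square_rot (square_rot sq))) F4 F1 F2 F3.
Qed.

(** The transfers cancel between the two faces of an edge, giving equality there. An edge on no face
    contributes [8 * m e - 44 < 0] on the left and nothing on the right. *)
Lemma term_sum : \sum_(e in R) (8 * (m e)%:Z - 44) <= \sum_(i in nonzero F) \sum_(e in Z i) term i e.
Proof.
have -> : \sum_(i in nonzero F) \sum_(e in Z i) term i e = \sum_i \sum_(e in Z i) term i e.
  rewrite [RHS](bigID (mem (nonzero F))) /= [X in _ + X]big1 ?addr0 // => i.
  rewrite inE => /existsPn h; rewrite big1 // => e; rewrite inE => ie.
  by have := h e; rewrite ie.
have -> : \sum_i \sum_(e in Z i) term i e = \sum_e \sum_(i | F i e) term i e.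
  rewrite (exchange_big_dep xpredT) //=; apply: eq_bigr => e _.
  by apply: eq_bigl => i; rewrite inE.
rewrite [leLHS]big_mkcond; apply: ler_sum => e _.
case: (boolP (e \in R)) => eR; last first.
  rewrite big1 // => i ie; by rewrite (ZR ie) in eR.
have m3 : (m e <= 3)%N := mu3 _ _.
have [_ _ Fc _] := RF; case: (Fc e) => [h|[i [j [ij h]]]].
  by rewrite big1 => [|i]; [move: m3; move: (m e) => k; clear; lia|rewrite h].
have ie : F i e by rewrite h eqxx.
have [j' [ji je hk nE]] := nT_pair ie.
rewrite (bigD1 i) //= (bigD1 j') /=; last by rewrite je ji.
rewrite big1 ?addr0; last first.
  by move=> k /andP[/andP[+ ki] kj]; rewrite hk (negbTE ki) (negbTE kj).
by rewrite /term nE; move: (m e) => k; case: (T i); case: (T j'); rewrite /=; clear; lia.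
Qed.

(** With faces present, [face_count] gives at least [#|R| + 2 - #|U|] of them, each worth at most
    -44; hence [8 * #|D| <= 44 * #|U| - 88], against [Dmany]. Without faces, [#|R| < #|U|] and
    multiplicity at most 3 leave too few edges. *)
Lemma faces_absurd : False.
Proof.
have RU e : e \in R -> (s e \in U) && (t e \in U).
  by move/R_D/Dwf=> [-> ->].
have U0 : U != set0 by rewrite -card_gt0; apply: leq_trans U4.
have cnt := face_count RU U0 RF.
have sD := sum_m.
have le3 : (#|D| <= 3 * #|R|)%N.
  rewrite -sD mulnC -sum_nat_const; apply: leq_sum => e _; exact: mu3.
case: (posnP #|nonzero F|) => k0.
  by rewrite k0 in cnt; move: cnt le3 Dmany U4; clear; lia.
have h := term_sum.
have h' : \sum_(i in nonzero F) (44 + \sum_(e in Z i) term i e) <= 0.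
  by apply: sumr_le0 => i; exact: face_le.
rewrite big_split /= sumr_const in h'.
have hS : \sum_(e in R) (8 * (m e)%:Z - 44) = 8 * #|D|%:Z - 44 * #|R|%:Z.
  rewrite sumrB sumr_const -mulr_sumr -sD [in RHS](big_morph Posz PoszD (erefl _)).
  by rewrite -[X in _ - X]mulr_natr !natz.
rewrite hS in h; rewrite k0 in cnt.
move: h h' cnt Dmany; move: (\sum_(i in nonzero F) _) => x.
by rewrite -[44 *+ _]mulr_natr !natz; clear; lia.
Qed.

End Faces.

Lemma face_argument : False.
Proof.
have /planar_sub : maclane s t D := Dplanar; move/(_ R) => [].
  by apply/subsetP => e; exact: R_D.
by move=> I [F RF]; exact: faces_absurd RF.
Qed.

End FaceArgument.

(** From four vertices on, the face argument refutes a minimal counterexample. Below that, the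
    bounds on the identity colouring directly force four parallel edges or a triangle with
    multiplicities 3, 3 and at least 2. *)
Theorem planar_good_sz (V E : finType) (U : {set V}) (s t : E -> V) (D : {set E}) :
  maclane s t D -> wf U s t D -> good U s t D -> szrel s t U D.
Proof.
elim: {U}_.+1 {-2}U (ltnSn #|U|) s t D => // n IHn U ltn s t D Dp Dw Dg.
apply: contrapT => nsz.
have IH (U' : {set V}) (s' t' : E -> V) (D' : {set E}) :
    (#|U'| < #|U|)%N -> maclane s' t' D' -> wf U' s' t' D' -> good U' s' t' D' ->
    szrel s' t' U' D'.
  by move=> lt; apply: IHn; apply: leq_trans lt _; rewrite -ltnS.
have m3 := mu_le3 IH Dp Dw Dg nsz.
have id_bnd := Dg id.
have idn : ncol U id = #|U| by apply: ncol_inj => x y.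
have idc : cross s t D id = #|D|.
  apply: eq_card => e; rewrite !inE; case: (boolP (e \in D)) => //= /Dw[_ _ ->] //.
rewrite idn idc in id_bnd; have [b2 b3 b4] := id_bnd.
case: (leqP 4 #|U|) => U4.
  apply: (face_argument Dp Dw U4 (b4 U4) m3).
  - exact: (no_tri3 IH Dp Dw Dg nsz U4).
  - exact: (no_T222_C4 IH Dp Dw Dg nsz U4).
  - exact: (no_C4 IH Dp Dw Dg nsz).
  - exact: (no_K4 IH Dp Dw Dg nsz).
  - exact: (no_three_T222 IH Dp Dw Dg nsz U4).
  - exact: (gap_two IH Dp Dw Dg nsz U4).
have Dsub x y z : U = [set x; y; z] ->
    D \subset par s t D x y :|: par s t D y z :|: par s t D z x.
  move=> UE; apply/subsetP => f fD; have [sU tU st] := Dw f fD.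
  rewrite UE in sU tU; move: sU tU st; rewrite !inE fD /link /=.
  move=> /orP[/orP[]|] /eqP-> /orP[/orP[]|] /eqP->;
  by rewrite !eqxx ?orbT.
have Dle x y z : U = [set x; y; z] ->
    (#|D| <= mu s t D x y + mu s t D y z + mu s t D z x)%N.
  move=> /Dsub/subset_leq_card/leq_trans; apply.
  apply: leq_trans (leq_card_setU _ _) _; rewrite leq_add2r; exact: leq_card_setU.
have mu_xx x : mu s t D x x = 0%N.
  apply/eqP; rewrite cards_eq0; apply/eqP/setP => e; rewrite !inE; apply/negbTE/negP.
  by case/andP=> /Dw[_ _ st] /orP[] /andP[/eqP ex /eqP ey]; rewrite ex ey eqxx in st.
case: (ltnP 2 #|U|) => U3.
  have U3E : #|U| = 3%N by apply/eqP; rewrite eqn_leq U3 -ltnS U4.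
  have /card_gt2P[x [y [z [[xU yU zU] [xy yz zx]]]]] := U3.
  have UE : U = [set x; y; z].
    apply/esym/eqP; rewrite eqEcard !subUset !sub1set xU yU zU U3E -setUA.
    by rewrite cardsU1 !inE negb_or xy eq_sym zx cards2 yz.
  have T332 := no_T332 IH Dp Dw Dg nsz.
  have := Dle _ _ _ UE; have := b3 U3E.
  have := m3 x y; have := m3 y z; have := m3 z x.
  have := T332 x y z; have := T332 y z x; have := T332 z x y.
  rewrite ?[mu s t D y x]muC; clear; lia.
case: (ltnP 1 #|U|) => U2.
  have U2E : #|U| = 2%N by apply/eqP; rewrite eqn_leq U3 U2.
  have /card_gt1P[x [y [xU yU xy]]] := U2.
  have UE : U = [set x; y].
    by apply/esym/eqP; rewrite eqEcard subUset !sub1set xU yU U2E cards2 xy.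
  have : D \subset par s t D x y.
    apply/subsetP => f fD; have [sU tU st] := Dw f fD.
    rewrite UE in sU tU; move: sU tU st; rewrite !inE fD /link /=.
    by move=> /orP[] /eqP-> /orP[] /eqP->; rewrite !eqxx ?orbT.
  by move/subset_leq_card/(leq_trans (b2 U2E)); rewrite leqNgt ltnS m3.
have D0 : D = set0.
  apply/setP => e; rewrite inE; apply/negbTE/negP => /Dw[sU tU st].
  by move: U2; rewrite leqNgt => /negP; apply; apply/card_gt1P; exists (s e), (t e).
apply: nsz => b b0; exists (fun=> true) => v; rewrite /net D0 big_set0.
case: (boolP (v \in U)) => vU; last by rewrite b0.1.
have UE : U = [set v].
  by apply/esym/eqP; rewrite eqEcard sub1set vU cards1.
by have := supported_in b0; rewrite UE big_set1.
Qed.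

(** * Odd cuts and splitting *)

Section Cuts.
Variables (V E : finType).
Implicit Types (X Y : {set V}) (D : {set E}) (s t : E -> V).

Definition dcut s t D X : nat :=
  (\sum_(e in D) ((s e \in X) (+) (t e \in X)))%N.

Definition between s t D X Y : nat :=
  (\sum_(e in D) ((s e \in X) && (t e \in Y) || (s e \in Y) && (t e \in X)))%N.

(** Splitting preserves the parity of each cut, and cuts of a contraction are cuts of the graph, so
    this condition can be carried through the induction. *)
Definition odd11 s t D := forall X, odd (dcut s t D X) -> (11 <= dcut s t D X)%N.

Lemma dcutC s t D X : dcut s t D (~: X) = dcut s t D X.
Proof. by apply: eq_bigr => e _; rewrite !inE; case: (s e \in X); case: (t e \in X). Qed.

Lemma odd11_off v s t D :
  (forall X, v \notin X -> odd (dcut s t D X) -> (11 <= dcut s t D X)%N) -> odd11 s t D.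
Proof.
move=> h X; case: (boolP (v \in X)) => vX; last exact: h.
by rewrite -dcutC; apply: h; rewrite inE vX.
Qed.

Lemma odd11_reduce v s t D s' t' (D' : {set E}) :
  (forall X, v \notin X -> exists Y, dcut s' t' D' X = dcut s t D Y) ->
  odd11 s t D -> odd11 s' t' D'.
Proof. by move=> h o; apply: (@odd11_off v) => X /h[Y ->]; apply: o. Qed.

Lemma dcut_uncross s t D X Y :
  (dcut s t D (X :&: Y) + dcut s t D (X :|: Y) + 2 * between s t D (X :\: Y) (Y :\: X) =
    dcut s t D X + dcut s t D Y)%N.
Proof.
rewrite big_distrr -!big_split; apply: eq_bigr => e _; rewrite !inE.
by case: (s e \in X); case: (t e \in X); case: (s e \in Y); case: (t e \in Y).
Qed.

Lemma dcut_uncrossD s t D X Y :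
  (dcut s t D (X :\: Y) + dcut s t D (Y :\: X) + 2 * between s t D (X :&: Y) (~: (X :|: Y)) =
    dcut s t D X + dcut s t D Y)%N.
Proof.
rewrite big_distrr -!big_split; apply: eq_bigr => e _; rewrite !inE.
by case: (s e \in X); case: (t e \in X); case: (s e \in Y); case: (t e \in Y).
Qed.

Lemma dcut_split s t D X Y :
  (dcut s t D (X :\: Y) + dcut s t D (X :&: Y) =
    dcut s t D X + 2 * between s t D (X :\: Y) (X :&: Y))%N.
Proof.
rewrite big_distrr -!big_split; apply: eq_bigr => e _; rewrite !inE.
by case: (s e \in X); case: (t e \in X); case: (s e \in Y); case: (t e \in Y).
Qed.

Lemma between_gt0 s t D X Y e : e \in D ->
  (s e \in X) && (t e \in Y) || (s e \in Y) && (t e \in X) -> (0 < between s t D X Y)%N.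
Proof. by move=> eD h; rewrite /between (bigD1 e) //= h. Qed.

(** Of [X :\: Y] and [X :&: Y] exactly one has an odd cut, and likewise with [X], [Y] exchanged. The
    cuts of the two differences sum to at most 20, so they are not both odd and thus are even. Then
    the intersection and the union have odd cuts, each at least 11 with sum at most 22. *)
Lemma tight_union s t D X Y : odd11 s t D ->
  dcut s t D X = 11%N -> dcut s t D Y = 11%N ->
  (0 < between s t D (X :&: Y) (~: (X :|: Y)))%N -> dcut s t D (X :|: Y) = 11%N.
Proof.
move=> o hX hY b0.
have := dcut_uncross s t D X Y; have := dcut_uncrossD s t D X Y.
have := dcut_split s t D X Y; have := dcut_split s t D Y X; rewrite [Y :&: X]setIC hX hY.
have := o (X :&: Y); have := o (X :|: Y); have := o (X :\: Y); have := o (Y :\: X).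
move: b0 (dcut s t D _) (dcut s t D _) (dcut s t D _) (dcut s t D _) => + a b c d.
move: (between _ _ _ _ _) (between _ _ _ _ _) (between _ _ _ _ _) (between _ _ _ _ _) => p q r x.
clear; lia.
Qed.

End Cuts.

Section Lift.
Variables (V E : finType) (s t : E -> V).
Implicit Types (D : {set E}).

(** The orientation of the lifted edge is carried over to the path from [x] to [y] through [v],
    which adds nothing at [v]. *)
Lemma link_lift_reach (D : {set E}) e1 e2 v x y b
    (s1 := fun e => if e == e1 then x else s e)
    (t1 := fun e => if e == e1 then y else t e) :
  link s t e1 v x -> link s t e2 v y -> e1 \in D -> e2 \in D -> e1 != e2 ->
  reach s1 t1 (D :\ e2) b -> reach s t D b.
Proof.
move=> l1 l2 e1D e2D e12 [z zE].
have e21 : e2 != e1 by rewrite eq_sym.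
rewrite linkC in l1.
have r12 : reach s t [set e1; e2] (fun w => sgn (z e1) * flow_to x y w).
  case: (z e1).
    by apply: eq_reach (mlt_lift e12 l1 l2 (leq0n 1)) => w; rewrite subr0.
  apply: eq_reach (mlt_lift e12 l1 l2 (leqnn 1)) => w; congr (_ * _); exact: val_inj.
have rest : reach s t (D :\: [set e1; e2]) (fun w => net s t z (D :\: [set e1; e2]) w).
  by exists z.
have dis : [disjoint [set e1; e2] & D :\: [set e1; e2]].
  by rewrite -setI_eq0; apply/eqP/setP => e; rewrite !inE; case: (_ || _).
have -> : D = [set e1; e2] :|: (D :\: [set e1; e2]).
  apply/setP => e; rewrite !inE; case: (eqVneq e e1) => [->|] //=.
  by case: (eqVneq e e2) => [->|].
apply: eq_reach (reachU dis r12 rest) => w; rewrite -zE /net.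
rewrite [RHS](bigD1 e1) /=; last by rewrite !inE e12.
rewrite /s1 /t1 eqxx; congr (_ + _).
  by rewrite /flow_to ![w == _]eq_sym.
apply: eq_big => e; first by rewrite !inE; case: (e == e1); case: (e == e2); rewrite ?andbF ?andbT.
by rewrite !inE negb_or => /andP[/andP[/negbTE-> _] _].
Qed.

Lemma dcut_lift (D : {set E}) e1 e2 v x y (X : {set V})
    (s1 := fun e => if e == e1 then x else s e)
    (t1 := fun e => if e == e1 then y else t e) :
  link s t e1 v x -> link s t e2 v y -> e1 \in D -> e2 \in D -> e1 != e2 ->
  v \notin X ->
  dcut s t D X = (dcut s1 t1 (D :\ e2) X + 2 * ((x \in X) && (y \in X)))%N.
Proof.
move=> l1 l2 e1D e2D e12 vX.
rewrite /dcut (big_setD1 e2) //= [in LHS](big_setD1 e1) /=; last by rewrite !inE e12.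
rewrite [in RHS](big_setD1 e1) /=; last by rewrite !inE e12.
have -> : (\sum_(e in D :\ e2 :\ e1) ((s1 e \in X) (+) (t1 e \in X)) =
   \sum_(e in D :\ e2 :\ e1) ((s e \in X) (+) (t e \in X)))%N.
  by apply: eq_bigr => e; rewrite !inE /s1 /t1 => /andP[/negbTE-> _].
have lE e z : link s t e v z -> (s e \in X) (+) (t e \in X) = (z \in X).
  by case/orP=> /andP[/eqP-> /eqP->]; rewrite (negbTE vX) ?addbF.
rewrite (lE _ _ l1) (lE _ _ l2) /s1 /t1 eqxx.
by move: (\sum_(e in _) _)%N => k; case: (x \in X); case: (y \in X) => /=; lia.
Qed.

End Lift.

Section Split.
Variables (V E : finType) (s t : E -> V) (D : {set E}) (v : V).
Hypothesis Dloopless : forall e, e \in D -> s e != t e.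
Hypothesis Dodd : odd11 s t D.

Let delta := [set e in D | inc s t e v].

Lemma delta_link e : e \in delta -> exists2 x, link s t e v x & x != v.
Proof.
rewrite inE /inc => /andP[eD]; have := Dloopless eD; move: (link_ends s t e).
case: (eqVneq (s e) v) => [->|sv]; case: (eqVneq (t e) v) => [->|tv] // l _ _.
  by exists (t e).
by exists (s e); rewrite // linkC.
Qed.

Lemma dcut_vertex : dcut s t D [set v] = #|delta|.
Proof.
rewrite /delta -sum1dep_card big_mkcondr; apply: eq_bigr => e _; rewrite !inE /inc.
by case: (s e == v); case: (t e == v).
Qed.

(** Every edge leaving [X] ends at [v], so the two parts share only [v]. For [Y] avoiding [v], the
    cuts of the parts are the cuts of [D] given by [Y :&: X] and [Y :\: X]. *)
Lemma star_split (S : {set E}) (X : {set V}) : S \subset delta -> v \notin X ->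
  (forall e, e \in D -> (e \in S) = (s e \in X) (+) (t e \in X)) ->
  let D1 := [set e in D | (s e \in X) || (t e \in X)] in
  odd11 s t D1 /\ odd11 s t (D :\: D1).
Proof.
move=> SD vX SE D1.
have Sv e : e \in D -> (s e \in X) (+) (t e \in X) -> inc s t e v.
  by move=> eD; rewrite -SE // => /(subsetP SD); rewrite inE => /andP[].
split; apply: (odd11_reduce (v := v) _ Dodd) => Y vY.
  exists (Y :&: X); rewrite /dcut [RHS](big_setID D1) /=.
  rewrite [X in (_ + X)%N]big1 ?addn0 => [|e]; last first.
    by rewrite !inE => /andP[+ eD]; rewrite eD negb_or => /andP[/negbTE-> /negbTE->];
      rewrite !andbF.
  rewrite (_ : D :&: D1 = D1); last by apply/setP => e; rewrite !inE andbA andbb.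
  apply: eq_bigr => e; rewrite !inE => /andP[eD].
  have := Sv e eD; rewrite /inc.
  case sX: (s e \in X); case tX: (t e \in X); rewrite ?andbT ?andbF ?addbF //= => /(_ isT).
    by case: eqVneq => [sv|_]; [rewrite sv (negbTE vX) in sX|rewrite add0r => /eqP->;
      rewrite (negbTE vY) addbF].
  by case: (eqVneq (t e)) => [tv|_]; [rewrite tv (negbTE vX) in tX|rewrite addr0 => /eqP->;
    rewrite (negbTE vY)].
exists (Y :\: X); rewrite /dcut [RHS](big_setID D1) /=.
rewrite [X in _ = (X + _)%N]big1 ?add0n => [|e]; last first.
  rewrite !inE => /andP[eD /andP[_]]; have := Sv e eD; rewrite /inc.
  case sX: (s e \in X); case tX: (t e \in X); rewrite //= => /(_ isT).
    by case: eqVneq => [sv|_]; [rewrite sv (negbTE vX) in sX|rewrite add0r => /eqP->;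
      rewrite (negbTE vY)].
  by case: (eqVneq (t e)) => [tv|_]; [rewrite tv (negbTE vX) in tX|rewrite addr0 => /eqP->;
    rewrite (negbTE vY)].
apply: eq_bigr => e; rewrite !inE => /andP[+ eD]; rewrite eD negb_or.
by move=> /andP[/negbTE-> /negbTE->].
Qed.

Variables (I : finType) (F : I -> E -> bool).
Hypothesis DF : faces s t D F.

Let share e f := [exists i, F i e && F i f].

Let tight (X : {set V}) := (v \notin X) && (dcut s t D X == 11%N).

Let ends (X : {set V}) := [set e in delta | (s e \in X) (+) (t e \in X)].

Lemma ends_link (X : {set V}) e x : v \notin X -> e \in delta -> link s t e v x -> (e \in ends X) = (x \in X).
Proof.
move=> vX eD l; rewrite inE eD /=; case/orP: l => /andP[/eqP-> /eqP->].
  by rewrite (negbTE vX).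
by rewrite (negbTE vX) addbF.
Qed.

Hypothesis delta_ne : #|delta| != 0%N.
Hypothesis delta_n11 : #|delta| != 11%N.

Hypothesis closed_trivial : forall S : {set E}, S \subset delta -> S != set0 ->
  (forall e f, e \in S -> f \in delta -> share e f -> f \in S) -> S = delta.

(** If every pair on a common face is blocked, it is blocked by a set with cut 11 containing both
    far ends. Such sets are closed under union when they share a neighbour of [v], so a maximal one
    contains all neighbours of [v]. This is impossible for a degree other than 0 and 11. *)
Lemma splitting : exists e1 e2 x y,
  [/\ e1 \in delta, e2 \in delta, e1 != e2, link s t e1 v x /\ link s t e2 v y &
   share e1 e2 /\ odd11 (fun e => if e == e1 then x else s e)
     (fun e => if e == e1 then y else t e) (D :\ e2)].
Proof.
apply: contrapT => none.
have dD e : e \in delta -> e \in D by rewrite inE => /andP[].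
(* A lift lowers a cut by 2 only when both far ends lie on the side away from [v]; an odd cut below
   11 afterwards was then exactly 11. *)
have tightP e f : e \in delta -> f \in delta -> e != f -> share e f ->
    exists X, tight X && ((e \in ends X) && (f \in ends X)).
  move=> eD fD ef sh.
  have [x lx xv] := delta_link eD; have [y ly yv] := delta_link fD.
  apply: contrapT => noX; apply: none; exists e, f, x, y; split=> //; split=> //.
  apply: (@odd11_off _ _ v) => X vX oX; rewrite leqNgt; apply/negP => lt.
  have := dcut_lift lx ly (dD _ eD) (dD _ fD) ef vX.
  case: (boolP ((x \in X) && (y \in X))) => xyX /= dE.
    apply: noX; exists X; rewrite (ends_link vX eD lx) (ends_link vX fD ly) xyX /tight vX /= andbT.
    have := Dodd (X := X); rewrite dE oddD oX /= => /(_ isT).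
    move: oX lt; move: (dcut _ _ _ _) => k; clear; lia.
  rewrite muln0 addn0 in dE; rewrite -dE in oX lt.
  by have := Dodd oX; rewrite leqNgt lt.
have [e0 e0D] : exists e, e \in delta by apply/set0Pn; rewrite -cards_eq0.
(* Otherwise [e0] shares a face with no other edge at [v], so it is the whole star, and [v] has the
   odd degree 1. *)
have [X0 tX0 e0X] : exists2 X, tight X & e0 \in ends X.
  apply: contrapT => noX.
  have S1 : [set e0] = delta.
    apply: closed_trivial; rewrite ?sub1set //.
      by apply/set0Pn; exists e0; rewrite inE.
    move=> e f; rewrite inE => /eqP-> fD sh; rewrite inE; apply: contraT => fe.
    have ef : e0 != f by rewrite eq_sym.
    have [X /and3P[tX eX fX]] := tightP _ _ e0D fD ef sh.
    by case: noX; exists X.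
  have := Dodd (X := [set v]); rewrite dcut_vertex -S1 cards1 => /(_ isT) //.
have [X tX maxX] := @arg_maxnP _ X0 tight (fun X => #|ends X|) tX0.
have /andP[vX /eqP dX] := tX.
have X_sub : ends X \subset delta by apply/subsetP => e; rewrite inE => /andP[].
have EX : ends X = delta.
  apply: closed_trivial => //.
    rewrite -card_gt0; apply: leq_trans (maxX _ tX0); apply/card_gt0P; by exists e0.
  move=> e f eX fD sh; apply: contraT => fX.
  have ef : e != f by apply: contraNneq fX => <-.
  have [Y /and3P[/andP[vY /eqP dY] eY fY]] := tightP _ _ (subsetP X_sub _ eX) fD ef sh.
  have eD := subsetP X_sub _ eX; have [x lx xv] := delta_link eD.
  have [xX xY] : x \in X /\ x \in Y by rewrite -(ends_link vX eD lx) -(ends_link vY eD lx).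
  have vXY : v \notin X :|: Y by rewrite inE negb_or vX.
  have bt : (0 < between s t D (X :&: Y) (~: (X :|: Y)))%N.
    apply: (between_gt0 (dD _ eD)); rewrite !inE.
    by case/orP: lx => /andP[/eqP-> /eqP->]; rewrite xX xY (negbTE vX) (negbTE vY) ?orbT.
  have tXY : tight (X :|: Y) by rewrite /tight vXY (tight_union Dodd dX dY bt).
  have le : (#|ends (X :|: Y)| <= #|ends X|)%N := maxX _ tXY; move: le;
    rewrite leqNgt => /negP[]; apply: proper_card; apply/properP; split.
    apply/subsetP => g gX; have gD := subsetP X_sub _ gX.
    have [z lz zv] := delta_link gD.
    by move: gX; rewrite (ends_link vX gD lz) (ends_link vXY gD lz) inE => ->.
  exists f => //; have [z lz zv] := delta_link fD.
  by move: fY; rewrite (ends_link vY fD lz) (ends_link vXY fD lz) inE => ->; rewrite orbT.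
(* Since 11 is odd, one of the two summands is odd, hence 11, and the other is 0. *)
have dW : dcut s t D X = (#|delta| + dcut s t D (~: (v |: X)))%N.
  rewrite -dcut_vertex /dcut -big_split /=; apply: eq_bigr => e eD.
  have : e \in delta -> e \in ends X by rewrite EX.
  rewrite !inE eD /inc /=.
  case: (eqVneq (s e) v) => [->|sv]; case: (eqVneq (t e) v) => [->|tv] /=;
    rewrite ?(negbTE vX) //=.
  - by move/(_ isT) ->.
  - by rewrite addbF => /(_ isT) ->.
  - by case: (s e \in X); case: (t e \in X).
have := Dodd (X := ~: (v |: X)); have := Dodd (X := [set v]); rewrite dcut_vertex.
move: dW delta_ne delta_n11; rewrite dX; move: (dcut _ _ _ _) #|delta| => a b; clear; lia.
Qed.

End Split.

(** * The 11-regular case *)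

Section Regular.
Variables (V E : finType) (s t : E -> V) (D : {set E}).
Hypothesis Dloopless : forall e, e \in D -> s e != t e.
Hypothesis Dplanar : maclane s t D.
Hypothesis D0 : D != set0.

Let U := [set v | [exists e in D, inc s t e v]].
Hypothesis Dregular : forall v, v \in U -> dcut s t D [set v] = 11%N.

Lemma regular_wf : wf U s t D.
Proof.
move=> e eD; have st := Dloopless eD; split=> //; rewrite inE; apply/existsP; exists e;
  by rewrite eD /inc eqxx ?(negbTE st) // eq_sym (negbTE st).
Qed.

Lemma handshake : (2 * #|D| = 11 * #|U|)%N.
Proof.
rewrite [RHS]mulnC -sum_nat_const -(eq_bigr _ Dregular) exchange_big /= mulnC -sum_nat_const.
apply: eq_bigr => e eD; have [sU tU st] := regular_wf eD.
rewrite (bigD1 (s e)) //= (bigD1 (t e)) /=; last by rewrite tU eq_sym.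
rewrite big1 => [|v /andP[/andP[_ vs] vt]]; rewrite !inE.
  by rewrite !eqxx eq_sym (negbTE st).
by rewrite eq_sym (negbTE vs) eq_sym (negbTE vt).
Qed.

(* The colouring minimizing [2 * cross - 11 * ncol] is not injective, and by
   minimality each of its classes induces a good subgraph. *)
Lemma regular_sz : exists A : {set V}, (1 < #|A|)%N /\ szrel s t A (inside s t A D).
Proof.
apply: contrapT => none.
have nsz (A : {set V}) : (1 < #|A|)%N -> A \subset U -> exists q : V -> V,
    ~ bnd (ncol A q) (cross s t (inside s t A D) q).
  move=> A1 AU; apply: contrapT => nq; apply: none; exists A; split=> //.
  apply: planar_good_sz.
  - by apply: planar_sub Dplanar _; apply/subsetP => e; rewrite inE => /andP[].
  - by move=> e; rewrite inE => /and3P[eD -> ->]; split=> //; exact: Dloopless.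
  - by move=> c; apply: contrapT => nb; apply: nq; exists c.
have w_le k e : ~ bnd k e -> (2 * e + 16 <= 11 * k)%N.
  move=> nb; have := nbndP (two_le_nbnd nb) nb; clear; lia.
have iU : inside s t U D = D.
  by apply/setP => e; rewrite inE; case: (boolP (e \in D)) => //= /regular_wf[-> ->].
have U1 : (1 < #|U|)%N.
  case/set0Pn: D0 => e /regular_wf[sU tU st]; apply/card_gt1P; by exists (s e), (t e).
have [q0 /w_le] := nsz U U1 (subxx _); rewrite iU => w0.
(* Shifted by [11 * #|U|] to stay in the natural numbers; the subtraction never truncates. *)
pose wt (c : {ffun V -> V}) := (2 * cross s t D c + 11 * (#|U| - ncol U c))%N.
have [c _ cmin] := @arg_minnP _ [ffun v => v] xpredT wt isT.
have ncolU (T : finType) (c' : V -> T) : (ncol U c' <= #|U|)%N by apply: leq_imset_card.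
have cmin' (T : finType) (c' : V -> T) :
    (2 * cross s t D c + 11 * ncol U c' <= 2 * cross s t D c' + 11 * ncol U c)%N.
  have [c0 [n0 e0]] := recolor c' regular_wf.
  have := cmin [ffun v => c0 v] isT; rewrite /wt.
  have -> : ncol U [ffun v => c0 v] = ncol U c'.
    by rewrite -n0 /ncol; congr #|pred_of_set _|; apply: eq_imset => v; rewrite ffunE.
  have -> : cross s t D [ffun v => c0 v] = cross s t D c'.
    by rewrite -e0 /cross; apply: eq_card => e; rewrite !inE !ffunE.
  have := ncolU _ c; have := ncolU _ c'.
  move: (cross _ _ _ _) (cross _ _ _ _) (ncol _ _) (ncol _ _) #|U| => a b d f g; clear; lia.
(* An injective colouring has [2 * cross - 11 * ncol = 0] by the handshake identity, while [q0] has
   at most -16. *)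
have nlt : (ncol U c < #|U|)%N.
  rewrite ltn_neqAle ncolU andbT; apply/negP => /eqP nE.
  have inj : {in U &, injective c} by apply/imset_injP; rewrite -/(ncol U c) nE.
  have cE : cross s t D c = #|D|.
    apply: eq_card => e; rewrite !inE; case: (boolP (e \in D)) => //= eD.
    have [sU tU st] := regular_wf eD; apply: contra st => /eqP h; apply/eqP; exact: inj.
  have := cmin' _ q0; rewrite nE cE handshake; move: w0; move: (cross _ _ _ _) (ncol _ _) => a b.
  clear; lia.
have [x [y [xU yU xy cxy]]] := ncol_ltP nlt.
set A := [set v in U | c v == c x].
have [q nb] : exists q : V -> V, ~ bnd (ncol A q) (cross s t (inside s t A D) q).
  apply: nsz; last by apply/subsetP => v; rewrite in_set => /andP[].
  by apply/card_gt1P; exists x, y; split=> //; rewrite in_set ?xU ?yU ?cxy eqxx.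
have [c' [n' e']] := refine c q regular_wf xU.
have := cmin' _ c'; have := w_le _ _ nb; rewrite e'.
move: n'; rewrite -/A; move: (cross _ _ _ _) (cross _ _ _ _) (ncol _ _) (ncol _ _) (ncol _ _).
move=> a b f g h; clear; lia.
Qed.

End Regular.

(** Induction on the number of edges: a loop is removed, an 11-regular graph is contracted, and at a
    vertex of another positive degree the graph is divided at that vertex or a pair is split off. *)
Theorem odd11_planar_reach (V E : finType) (s t : E -> V) (D : {set E}) :
  maclane s t D -> odd11 s t D -> reach s t D (fun=> 0).
Proof.
elim: {D}_.+1 {-2}D (ltnSn #|D|) s t => // n IHn D ltn s t Dp Do.
have IH (D' : {set E}) (s' t' : E -> V) : (#|D'| < #|D|)%N -> maclane s' t' D' ->
    odd11 s' t' D' -> reach s' t' D' (fun=> 0).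
  by move=> lt; apply: IHn; apply: leq_trans lt _; rewrite -ltnS.
have [D0|D0] := eqVneq D set0.
  by exists (fun=> true) => v; rewrite /net D0 big_set0.
(* Loops arise when a split pair is parallel; they affect neither cuts nor boundaries. *)
case: (boolP [exists e in D, s e == t e]) => [/existsP[e /andP[eD /eqP st]]|/existsPn noloop].
  have De : D = [set e] :|: (D :\ e) by rewrite setD1K.
  have r1 : reach s t [set e] (fun=> 0).
    by exists (fun=> true) => v; rewrite /net big_set1 st subrr mulr0.
  have r2 : reach s t (D :\ e) (fun=> 0).
    apply: IH; [by rewrite (cardsD1 e D) eD|exact: planar_del1|].
    apply: (odd11_reduce (v := s e) _ Do) => X _; exists X.
    by rewrite /dcut [RHS](big_setD1 e) //= st addbb.
  rewrite De; apply: eq_reach (reachU _ r1 r2); first by move=> v; rewrite addr0.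
  by rewrite disjoints1 !inE eqxx.
have loopless e : e \in D -> s e != t e by move=> eD; have := noloop e; rewrite eD.
case: (boolP [forall v, (dcut s t D [set v] == 0) || (dcut s t D [set v] == 11)]%N) => reg.
  have [|A [A1 szA]] := regular_sz loopless Dp D0.
    move=> v; rewrite inE => /existsP[e /andP[eD ie]].
    move/forallP/(_ v): reg; rewrite dcut_vertex => /orP[|/eqP//].
    rewrite cards_eq0 => /eqP/setP/(_ e); by rewrite !inE eD ie.
  have cA := szrel_conn szA.
  have [a aA] : exists a, a \in A by apply/card_gt0P; apply: ltnW.
  have iD : inside s t A D \subset D by apply/subsetP => e; rewrite inE => /andP[].
  apply: (reach_contract aA iD szA).
  set r := collapse A a.
  suff : reach (r \o s) (r \o t) (D :\: inside s t A D) (fun=> 0).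
    by apply: eq_reach => v; rewrite big1 //; do 2?case: ifP.
  apply: IH.
  - apply: proper_card; apply/properP; split; first exact: subsetDl.
    case/card_gt1P: A1 => x [y [xA yA xy]].
    have := cA x y xA yA; move/connectP=> [[|z p]] /=; first by move=> _ h; rewrite h eqxx in xy.
    case/andP=> /existsP[e /andP[ei _]] _ _; exists e; first exact: (subsetP iD).
    by rewrite inE ei.
  - exact: planar_collapse.
  apply: (odd11_reduce (v := a) _ Do) => X _; exists [set v | r v \in X].
  rewrite /dcut [RHS](big_setID (inside s t A D)) /= [X in _ = (X + _)%N]big1 ?add0n.
    by apply: eq_bigr => e _; rewrite !inE.
  by move=> e; rewrite !inE => /and4P[_ _ sA tA]; rewrite /r /collapse sA tA addbb.
move: reg; rewrite negb_forall => /existsP[v]; rewrite negb_or dcut_vertex => /andP[d0 d11].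
set delta := [set e in D | inc s t e v] in d0 d11.
have [I [F DF]] := Dp.
(* A proper part of the star closed under sharing faces makes [v] a cut vertex, and both sides are
   solved separately. *)
case: (pselect (exists S : {set E}, [/\ S \subset delta, S != set0, S != delta &
   forall e f, e \in S -> f \in delta -> [exists i, F i e && F i f] -> f \in S])) => [[S [Sd S0 Sn Scl]]|nS].
  have dD : delta \subset D by apply/subsetP => e; rewrite inE => /andP[].
  have SD : S \subset D := subset_trans Sd dD.
  have Sv e : e \in S -> inc s t e v by move/(subsetP Sd); rewrite inE => /andP[].
  have cut : cut_cond s t D S.
    apply: (face_closed_cut DF SD Sv) => i e e' ie ie' eS e'v.
    apply: Scl eS _ _; last by apply/existsP; exists i; rewrite ie ie'.
    by have [FD _ _ _] := DF; rewrite inE (FD _ _ ie').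
  have [X [vX XE]] := star_cut SD Sv cut.
  have [o1 o2] := star_split Do Sd vX XE.
  set D1 := [set e in D | (s e \in X) || (t e \in X)] in o1 o2.
  have D1D : D1 \subset D by apply/subsetP => e; rewrite inE => /andP[].
  have [e eS] := set0Pn _ S0.
  have /subsetPn[f fd fS] : ~~ (delta \subset S).
    by apply: contra Sn => dS; rewrite eqEsubset Sd.
  have eD := subsetP SD _ eS; have fD := subsetP dD _ fd.
  have e1 : e \in D1.
    by rewrite inE eD; have := XE _ eD; rewrite eS; case: (s e \in X); case: (t e \in X).
  have f1 : f \notin D1.
    have := XE _ fD; rewrite (negbTE fS); move: fd; rewrite inE inE fD /inc /=.
    case: (eqVneq (s f) v) => [->|_].
      by rewrite (negbTE vX); case: (t f \in X).
    case: (eqVneq (t f) v) => [->|_] //.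
    by rewrite (negbTE vX); case: (s f \in X).
  have DE : D1 :|: (D :\: D1) = D by rewrite -{2}(setID D D1) (setIidPr D1D).
  have r1 : reach s t D1 (fun=> 0).
    apply: IH => //; last exact: planar_sub Dp D1D.
    by apply: proper_card; apply/properP; split=> //; exists f.
  have r2 : reach s t (D :\: D1) (fun=> 0).
    apply: IH => //; last exact: planar_sub Dp (subsetDl _ _).
    apply: proper_card; apply/properP; split; first exact: subsetDl.
    by exists e; rewrite // inE e1.
  rewrite -DE; apply: eq_reach (reachU _ r1 r2); first by move=> w; rewrite addr0.
  by rewrite -setI_eq0; apply/eqP/setP => g; rewrite in_setI in_setD in_set0; case: (g \in D1).
have [|e1 [e2 [x [y [d1 d2 e12 [l1 l2] [sh o']]]]]] := @splitting _ _ s t D v loopless Do I F d0 d11.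
  move=> S Sd S0 Scl; apply/eqP; apply: contraT => Sn; case: nS; exists S; split=> //.
have [e1D e2D] : e1 \in D /\ e2 \in D by move: d1 d2; rewrite !inE => /andP[-> _] /andP[-> _].
apply: (link_lift_reach l1 l2 e1D e2D e12); apply: IH o'.
  by rewrite (cardsD1 e2 D) e2D.
have /existsP[i /andP[i1 i2]] := sh.
exact: planar_lift l1 l2 e1D e2D e12 DF i1 i2.
Qed.

(** * From flows modulo 5 to integer flows *)

Section IntegerFlow.
Variables (V E : finType) (s t : E -> V).
Implicit Types (g : E -> int).

Definition excess g v : int := \sum_e g e * ((s e == v)%:R - (t e == v)%:R).

(** Closed under [flip], which exchanges 2 with -3 and 3 with -2. *)
Definition small_values g := forall e, [|| g e == 2, g e == 3, g e == -2 | g e == -3].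

(* Replacing the value [g e] by [g e - 5] or [g e + 5] moves 5 units of excess
   along a residual arc. *)
Definition flip g e f := if f == e then (if 0 < g e then g e - 5 else g e + 5) else g f.

Definition residual g : rel V := fun u w =>
  [exists e, (0 < g e) && (s e == u) && (t e == w) || (g e < 0) && (t e == u) && (s e == w)].

Lemma small_flip g e : small_values g -> small_values (flip g e).
Proof.
move=> h f; rewrite /flip; case: (eqVneq f e) => _; last exact: h.
by case/or4P: (h e) => /eqP->; vm_compute.
Qed.

Lemma excess_flip g e u w : 
  (0 < g e) && (s e == u) && (t e == w) || (g e < 0) && (t e == u) && (s e == w) ->
  forall v, excess (flip g e) v = excess g v - 5 * (v == u)%:R + 5 * (v == w)%:R.
Proof.
move=> h v; rewrite /excess (bigD1 e) //= [in RHS](bigD1 e) //= /flip eqxx.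
rewrite (eq_bigr (fun f => g f * ((s f == v)%:R - (t f == v)%:R))); last first.
  by move=> f /negbTE->.
move: (\sum_(i | _) _) => S.
case/orP: h => /andP[/andP[ge /eqP<-] /eqP<-].
  rewrite ge ![v == _]eq_sym; move: ((s e == v)%:R : int) ((t e == v)%:R : int) => a b; ring.
rewrite ltNge (ltW ge) /= ![v == _]eq_sym.
move: ((s e == v)%:R : int) ((t e == v)%:R : int) => a b; ring.
Qed.

Lemma push_path p : forall g u, small_values g -> path (residual g) u p -> uniq (u :: p) ->
  exists2 g', small_values g' &
    forall v, excess g' v = excess g v - 5 * (v == u)%:R + 5 * (v == last u p)%:R.
Proof.
elim: p => [|w p IH] g u sg.
  by move=> _ _; exists g => // v /=; rewrite subrK.
move=> /= /andP[/existsP[e eE] pw] /andP[uw un].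
have pw' : path (residual (flip g e)) w p.
  (* The flipped edge is incident with [u], which the rest of the path avoids, so the arcs of the
     rest remain residual. *)
  have := pw; apply: (@sub_in_path _ (fun x => x != u)); last first.
    apply/allP => x xp; apply: contraNneq uw => <-; exact: xp.
  move=> a b; rewrite !unfold_in => au bu /existsP[f fE]; apply/existsP; exists f.
  rewrite /flip; case: (eqVneq f e) => // fe; rewrite fe in fE.
  by case/orP: eE => /andP[/andP[_ /eqP h1] /eqP h2];
    case/orP: fE => /andP[/andP[_ /eqP h3] /eqP h4]; move: au bu; rewrite -?h3 -?h4 ?h1 ?h2 ?eqxx.
have [g' sg' E'] := IH _ _ (small_flip e sg) pw' un.
exists g' => // v; rewrite E' (excess_flip eE).
move: ((v == u)%:R : int) ((v == w)%:R : int) ((v == last w p)%:R : int) => a b c; ring.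
Qed.

Lemma sum_excess g (A : {set V}) :
  \sum_(v in A) excess g v = \sum_e g e * ((s e \in A)%:R - (t e \in A)%:R).
Proof.
have h w : \sum_(v in A) (w == v)%:R = (w \in A)%:R :> int.
  case: (boolP (w \in A)) => wA.
    rewrite (bigD1 w) //= eqxx big1 ?addr0 // => v /andP[_ ne].
    by rewrite eq_sym (negbTE ne).
  rewrite big1 // => v vA; case: eqVneq => // wv; by rewrite -wv (negbTE wA) in vA.
rewrite exchange_big; apply: eq_bigr => e _.
by rewrite -mulr_sumr sumrB !h.
Qed.

Definition defect g : nat := (\sum_v `|excess g v|)%N.

(** No residual arc leaves the set reachable from a vertex of positive excess, so its total excess
    is at most 0 and it contains a vertex of negative excess. Excesses are multiples of 5, so
    pushing 5 units does not overshoot. *)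
Lemma reduce_defect g : small_values g -> (forall v, (5 %| excess g v)%Z) ->
  (0 < defect g)%N -> exists g', [/\ small_values g', (forall v, (5 %| excess g' v)%Z) &
    (defect g' < defect g)%N].
Proof.
move=> sg g5 dg.
have tot : \sum_v excess g v = 0.
  rewrite (eq_bigl (mem [set: V])); last by move=> v; rewrite !inE.
  by rewrite sum_excess big1 // => e _; rewrite !inE subrr mulr0.
have [v0 v0p] : exists v, 0 < excess g v.
  apply: contrapT => none.
  have le0 v : excess g v <= 0 by rewrite leNgt; apply/negP => h; apply: none; exists v.
  have : \sum_v (- excess g v) == 0 by rewrite sumrN tot oppr0.
  rewrite psumr_eq0; last by move=> v _; rewrite oppr_ge0.
  move=> /allP h; move: dg; rewrite /defect big1 // => v _.
  by have := h v (mem_index_enum v); rewrite /= oppr_eq0 => /eqP->.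
pose A := [set v | connect (residual g) v0 v].
have [w wA wn] : exists2 w, w \in A & excess g w < 0.
  apply: contrapT => none.
  have ge0 v : v \in A -> 0 <= excess g v.
    by move=> vA; rewrite leNgt; apply/negP => h; apply: none; exists v.
  have : 0 < \sum_(v in A) excess g v.
    rewrite (bigD1 v0) ?inE ?connect0 //=; apply: ltr_pwDl => //.
    by apply: sumr_ge0 => v /andP[/ge0].
  rewrite sum_excess ltNge => /negP[]; apply: sumr_le0 => e _.
  case: (boolP (s e \in A)) => sA; case: (boolP (t e \in A)) => tA;
    rewrite ?subrr ?mulr0 // ?subr0 ?sub0r ?mulr1 ?mulrN1.
    rewrite leNgt; apply/negP => ge; case/negP: tA; rewrite inE in sA; rewrite inE.
    apply: connect_trans sA (connect1 _); apply/existsP; exists e; by rewrite ge !eqxx.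
  rewrite oppr_le0 leNgt; apply/negP => ge; case/negP: sA; rewrite inE in tA; rewrite inE.
  by apply: connect_trans tA (connect1 _); apply/existsP; exists e; rewrite ge !eqxx orbT.
move: wA; rewrite inE => /connectP[p0 /shortenP[p pp up _] wE].
have [g' sg' E'] := push_path sg pp up; rewrite -wE in E'.
exists g'; split=> //.
  move=> v; rewrite E' rpredD ?rpredB ?dvdz_mulr //; exact: g5.
have v0w : v0 != w by apply: contraTneq wn => <-; rewrite -leNgt ltW.
have h0 : excess g' v0 = excess g v0 - 5 by rewrite E' eqxx (negbTE v0w) mulr1 mulr0 addr0.
have hw : excess g' w = excess g w + 5.
  by rewrite E' eqxx eq_sym (negbTE v0w) mulr1 mulr0 subr0.
rewrite /defect (bigD1 v0) // (bigD1 w) 1?eq_sym //= [in ltnRHS](bigD1 v0) //.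
rewrite [in ltnRHS](bigD1 w) 1?eq_sym //= h0 hw.
rewrite (eq_bigr (fun v => `|excess g v|%N)); last first.
  by move=> v /andP[/negbTE v0n /negbTE wn']; rewrite E' v0n wn' !mulr0 addr0 subr0.
have := g5 v0; have := g5 w; move: v0p wn.
move: (excess g v0) (excess g w) (\sum_(v | _) _)%N => a b S; clear; lia.
Qed.

Lemma small_flow g : small_values g -> (forall v, (5 %| excess g v)%Z) ->
  exists2 g', small_values g' & forall v, excess g' v = 0.
Proof.
elim: {g}_.+1 {-2}g (ltnSn (defect g)) => // n IH g lt sg g5.
have [d0|dp] := posnP (defect g).
  exists g => // v; apply/eqP; rewrite -absz_eq0.
  by move/eqP: d0; rewrite /defect sum_nat_eq0 => /forallP/(_ v).
have [g' [sg' g5' lt']] := reduce_defect sg g5 dp.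
by apply: (IH g') => //; apply: leq_trans lt' _; rewrite -ltnS.
Qed.

Lemma reach_small_flow : reach s t [set: E] (fun=> 0) ->
  exists2 g, small_values g & forall v, excess g v = 0.
Proof.
case=> x xE; apply: (@small_flow (fun e => if x e then 2 else -2)).
  by move=> e; case: (x e).
move=> v; pose S : int := \sum_e (if x e then 1 else -1) * ((s e == v)%:R - (t e == v)%:R).
have SE : (S%:~R : 'Z_5) = 0.
  rewrite -(xE v) /net rmorph_sum /=; apply: eq_big => e; first by rewrite inE.
  move=> _; rewrite rmorphM rmorphB /= !rmorph_nat; congr (_ * _).
  by rewrite /sgn; case: (x e); rewrite ?rmorphN rmorph1.
have -> : excess (fun e => if x e then 2 else -2) v = 2 * S.
  rewrite /S mulr_sumr; apply: eq_bigr => e _; rewrite mulrA; congr (_ * _).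
  by case: (x e).
apply: dvdz_mull.
have dvd5 n : (n%:R : 'Z_5) = 0 -> (5 %| n)%N.
  by move/(congr1 (@nat_of_ord _)); rewrite val_Zp_nat //= => /eqP.
move: SE; case: S => n; first by move/dvd5.
by rewrite NegzE mulrNz => /eqP; rewrite oppr_eq0 => /eqP/dvd5.
Qed.

End IntegerFlow.

(** * The triangular lattice *)

Section Transfer.
Variables (V W E K : finType) (s t : E -> V) (s' t' : K -> W).
Variables (i : E -> K) (j : V -> W).

Lemma planar_embed (D : {set K}) : injective i -> injective j ->
  (forall e, i e \in D) ->
  (forall e, link s' t' (i e) (j (s e)) (j (t e))) ->
  maclane s' t' D -> maclane s t [set: E].
Proof.
move=> inji injj iD il pl.
have : maclane s' t' (i @: [set: E]).
  by apply: planar_sub pl _; apply/subsetP => _ /imsetP[e _ ->].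
case=> I [F [FD Fb Fc Fs]].
have sum_i (G : K -> bool) : (forall k, k \notin i @: [set: E] -> G k = false) ->
    \sum_k G k = \sum_e G (i e).
  move=> G0; rewrite (bigID (mem (i @: [set: E]))) /= [X in _ + X]big1 //.
  rewrite addr0 big_imset; last by move=> x y _ _; exact: inji.
  by apply: eq_bigl => e; rewrite inE.
have incE e v : inc s' t' (i e) (j v) = inc s t e v.
  rewrite (link_inc (il e)) !(inj_eq injj) /inc.
  by rewrite [s e == v]eq_sym [t e == v]eq_sym.
have bdE (z : K -> bool) v : (forall k, z k -> k \in i @: [set: E]) ->
    bd s' t' z (j v) = bd s t (z \o i) v.
  move=> zi; rewrite /bd sum_i; first by apply: eq_bigr => e _; rewrite incE.
  by move=> k; case: (boolP (z k)) => [/zi->//|]; rewrite mul0r.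
exists I, (fun k => F k \o i); split=> //.
- by move=> k v; rewrite -bdE ?Fb //; exact: FD.
- by move=> e; exact: Fc.
move=> z _ zb; pose y k := [exists e, (i e == k) && z e].
have yi e : y (i e) = z e.
  apply/existsP/idP => [[f /andP[/eqP/inji->]]//|ze]; by exists e; rewrite eqxx.
have yD k : y k -> k \in i @: [set: E].
  by case/existsP=> e /andP[/eqP<- _]; apply: imset_f; rewrite inE.
have [w|a az] := Fs y yD; last by exists a => e; rewrite /= -az yi.
case: (boolP (w \in codom j)) => [/codomP[v ->]|wj].
  by rewrite bdE // -[RHS](zb v); apply: eq_bd => e; rewrite /= yi.
rewrite /bd big1 // => k _; case: (boolP (y k)) => [/yD/imsetP[e _ ->]|]; last by rewrite mul0r.
rewrite (link_inc (il e)).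
have ne v : (w == j v) = false by apply: contraNF wj => /eqP->; apply: codom_f.
by rewrite !ne mulr0.
Qed.

End Transfer.

Lemma big_option (R : Type) (idx : R) (op : Monoid.com_law idx) (I : finType)
    (F : option I -> R) :
  \big[op/idx]_o F o = op (F None) (\big[op/idx]_i F (Some i)).
Proof.
rewrite (bigD1 None) //=; congr (op _ _).
rewrite (reindex_omap Some id) /=; first by apply: eq_bigl => i; rewrite eqxx.
by case.
Qed.

(* If every edge lies on at most two faces, adding their sum as an outer face
   yields Mac Lane's criterion. *)
Lemma planar_bounded (V E I : finType) (s t : E -> V) (D : {set E}) (F : I -> E -> bool) :
  (forall i e, F i e -> e \in D) -> (forall i v, bd s t (F i) v = 0) ->
  (forall e, #|[set i | F i e]| <= 2)%N ->
  (forall z : E -> bool, (forall e, z e -> e \in D) ->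
        (forall v, bd s t z v = 0) ->
        exists a : I -> bool, forall e, z e = \sum_i a i * F i e) ->
  maclane s t D.
Proof.
move=> FD Fb F2 Fs.
pose F' (o : option I) e := if o is Some i then F i e else \sum_i F i e.
exists (option I : finType), F'; split.
- move=> [i|] e; first exact: FD.
  rewrite /F'; case: (boolP [exists i, F i e]) => [/existsP[i] /FD//|/existsPn h].
  by rewrite big1 // => i _; apply/negbTE.
- move=> [i|] v; first exact: Fb.
  rewrite /F' -(@eq_bd _ _ s t (fun e => \sum_i true * F i e)); last first.
    by move=> e; apply: eq_bigr => i _; rewrite mul1r.
  by rewrite bd_sum big1 // => i _; rewrite Fb mulr0.
- move=> e; apply/two_or_noneP.
  have cE : (\sum_i (F i e : nat) = #|[set i | F i e]|)%N.
    by rewrite -sum1dep_card [RHS]big_mkcond; apply: eq_bigr => k _; case: (F k e).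
  have oE : \sum_i F i e = odd (\sum_i (F i e : nat))%N :> bool.
    by elim/big_rec2: _ => // k y1 y2 _ ->; rewrite oddD; case: (F k e).
  have -> : (\sum_k (F' k e : nat) = (odd (\sum_i (F i e : nat)) : nat) + \sum_i (F i e : nat))%N.
    by rewrite big_option /= oE.
  rewrite cE; move: (F2 e); move: #|_| => [|[|[|k]]] //= _; by [left|right].
move=> z zD zb; have [a az] := Fs z zD zb.
by exists (fun o => if o is Some i then a i else false) => e; rewrite az big_option /= mul0r add0r.
Qed.

Section Lattice.
Variable n : nat.

(** [inord] returns 0 out of range; [lat_D] discards the edges that would leave the grid. *)
Let pt (i j : nat) : 'I_n.+1 * 'I_n.+1 := (inord i, inord j).

Local Notation lat_edge := ('I_n.+1 * 'I_n.+1 * option bool)%type.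

(* [Some false] is a horizontal edge, [Some true] a vertical one, [None] the
   antidiagonal of the unit square with lower left corner [(i, j)]. *)
Definition lat_s (e : lat_edge) :=
  let: (i, j, d) := e in if d is None then pt i.+1 j else pt i j.

Definition lat_t (e : lat_edge) :=
  let: (i, j, d) := e in if d is Some false then pt i.+1 j else pt i j.+1.

Definition lat_D : {set lat_edge} := [set e : lat_edge |
  let: (i, j, d) := e in
  match d with Some false => i < n | Some true => j < n | None => (i < n) && (j < n) end]%N.

(** The two triangles of the unit square [(a, b)]: the lower left one, and the upper right one if
    [up]. *)
Let T (k : 'I_n * 'I_n * bool) (e : lat_edge) : bool :=
  let: (a, b, up) := k in let: (i, j, d) := e in
  match d with
  | None => (i == a :> nat) && (j == b :> nat)
  | Some false => (i == a :> nat) && (j == (b + up)%N :> nat)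
  | Some true => (i == (a + up)%N :> nat) && (j == b :> nat)
  end.

Lemma ord_eq_inord (i : 'I_n.+1) (a : nat) : (a <= n)%N -> (i == inord a) = (i == a :> nat).
Proof. by move=> an; rewrite -val_eqE /= inordK. Qed.

Lemma inord_ord (i : 'I_n.+1) : inord i = i.
Proof. exact: inord_val. Qed.

Lemma T_three (k : 'I_n * 'I_n * bool) : let: (a, b, up) := k in
  forall e, T k e = (e == (inord a, inord (b + up), Some false)) +
    ((e == (inord (a + up), inord b, Some true)) + (e == (inord a, inord b, None))).
Proof.
case: k => [[a b] up] [[i j] d].
have [an bn] := (ltn_ord a, ltn_ord b).
rewrite /T; case: d => [[]|]; rewrite !xpair_eqE ?andbF ?andbT ?add0r ?addr0 /=;
  rewrite !ord_eq_inord ?andbT ?andbF ?addr0 //; case: (up); lia.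
Qed.

Lemma T_cycle k v : bd lat_s lat_t (T k) v = 0.
Proof.
have := T_three k; case: k => [[a b] up] E; rewrite (eq_bd _ _ E) !bdD !bd1 /inc.
have [an bn] := (ltn_ord a, ltn_ord b).
rewrite /lat_s /lat_t !inordK; try by case: (up); lia.
case: up {E}; rewrite ?addn1 ?addn0.
  by case: (pt _ _ == v); case: (pt _ _ == v); case: (pt _ _ == v).
by case: (pt _ _ == v); case: (pt _ _ == v); case: (pt _ _ == v).
Qed.

Lemma T_D k e : T k e -> e \in lat_D.
Proof.
case: k => [[a b] up]; case: e => [[i j] d]; rewrite inE.
have [an bn] := (ltn_ord a, ltn_ord b).
by case: d => [[]|] /andP[/eqP hi /eqP hj]; rewrite ?hi ?hj ?an ?bn.
Qed.

Lemma T_uniq a b a' b' up e : T (a, b, up) e -> T (a', b', up) e -> (a, b) = (a', b').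
Proof.
case: e => [[i j] [[]|]] /andP[/eqP h1 /eqP h2] /andP[/eqP h3 /eqP h4];
  congr (_, _); apply: val_inj => /=; move: h1 h2 h3 h4;
    move: (i : nat) (j : nat) => i' j'; clear; lia.
Qed.

Lemma T_card e : (#|[set k | T k e]| <= 2)%N.
Proof.
rewrite -card_bool -(card_in_imset (f := fun k : 'I_n * 'I_n * bool => k.2)) ?max_card //.
move=> [[a b] up] [[a' b'] up']; rewrite !inE => h h' /= uE; rewrite -uE in h' *.
by rewrite (T_uniq h h').
Qed.

Section Span.
Variable z : lat_edge -> bool.
Hypothesis zD : forall e, z e -> e \in lat_D.
Hypothesis zb : forall v, bd lat_s lat_t z v = 0.

Let zh i j := z (inord i, inord j, Some false).
Let zd i j := z (inord i, inord j, None).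

(** Coefficient of the lower triangle of square [(i, j)], found by climbing column [i]: each
    horizontal edge determines it from the upper triangle below, whose coefficient differs from that
    of its own lower triangle by the diagonal. *)
Fixpoint lat_u (i j : nat) : bool :=
  if j is j'.+1 then zh i j + (lat_u i j' + zd i j') else zh i 0.

Let a (k : 'I_n * 'I_n * bool) :=
  let: (i, j, up) := k in lat_u i j + (if up then zd i j else false).

Let y e := z e + \sum_k a k * T k e.

Lemma sum_T1 k1 e : (forall k, T k e = (k == k1)) -> \sum_k a k * T k e = a k1.
Proof.
move=> h; rewrite -(sum_indicator_bool k1 a); apply: eq_bigr => k _.
by rewrite h mulrC.
Qed.

Lemma sum_T2 k1 k2 e : k1 != k2 -> (forall k, T k e = (k == k1) || (k == k2)) ->
  \sum_k a k * T k e = a k1 + a k2.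
Proof.
move=> ne h; rewrite -(sum_indicator_bool k1 a) -(sum_indicator_bool k2 a) -big_split.
apply: eq_bigr => k _; rewrite h /= -mulrDl mulrC; congr (_ * _).
by case: (eqVneq k k1) => [->|_]; rewrite ?(negbTE ne).
Qed.

Lemma y_cycle v : bd lat_s lat_t y v = 0.
Proof. by rewrite bdD bd_sum zb add0r big1 // => k _; rewrite T_cycle mulr0. Qed.

Lemma y_D e : y e -> e \in lat_D.
Proof.
rewrite /y; case: (boolP (z e)) => [/zD//|_]; rewrite add0r => h.
apply: contraTT h => eD; rewrite big1 // => k _.
by case: (boolP (T k e)) => [/T_D|_]; [rewrite (negbTE eD)|rewrite mulr0].
Qed.

Lemma y_diag i j : y (i, j, None) = false.
Proof.
case: (boolP ((i, j, None) \in lat_D)) => [|nD]; last by apply: contraNF nD => /y_D.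
rewrite inE => /andP[ilt jlt].
rewrite /y (@sum_T2 (Ordinal ilt, Ordinal jlt, false) (Ordinal ilt, Ordinal jlt, true)).
- rewrite /a /= addr0 /zd !inord_ord.
  by case: (z _); case: (lat_u i j).
- by rewrite xpair_eqE andbF.
move=> [[p q] up]; rewrite !xpair_eqE -!val_eqE /= ![val p == _]eq_sym ![val q == _]eq_sym.
by case: up; rewrite ?andbF ?andbT ?orbF.
Qed.

Lemma y_hor (i j : 'I_n.+1) : (j < n)%N -> y (i, j, Some false) = false.
Proof.
move=> jlt; case: (boolP ((i, j, Some false) \in lat_D)) => [|nD];
  last by apply: contraNF nD => /y_D.
rewrite inE => ilt.
rewrite /y; case: (posnP j) => j0.
  rewrite (@sum_T1 (Ordinal ilt, Ordinal jlt, false)).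
    rewrite /a /= j0 addr0 /= /zh inord_ord.
    have -> : inord 0 = j by apply: val_inj; rewrite /= inordK.
    exact: addrr_bool.
  move=> [[p q] up]; rewrite !xpair_eqE -!val_eqE /=; move: (val p) (val q) (val i) (val j) j0.
  by move=> p' q' i' j' j0; clear -j0; case: up; lia.
have j1lt : (j.-1 < n)%N by apply: leq_ltn_trans (leq_pred _) jlt.
rewrite (@sum_T2 (Ordinal ilt, Ordinal jlt, false) (Ordinal ilt, Ordinal j1lt, true)).
- have uE : lat_u i j = zh i j + (lat_u i j.-1 + zd i j.-1).
    by move: (nat_of_ord j) j0 => [].
  rewrite /a /= addr0 uE /zh !inord_ord.
  by case: (z _); case: (lat_u _ _); case: (zd _ _).
- by rewrite xpair_eqE andbF.
move=> [[p q] up]; rewrite !xpair_eqE -!val_eqE /=; move: (val p) (val q) (val i) (val j) j0.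
by move=> p' q' i' j' j0; clear -j0; case: up; lia.
Qed.

Lemma pt_eq (i j k l : nat) : (i <= n -> j <= n -> k <= n -> l <= n ->
  (pt i j == pt k l) = (i == k) && (j == l))%N.
Proof. by move=> *; rewrite xpair_eqE -!val_eqE /= !inordK. Qed.

(** With diagonals gone and horizontals left only in the top row, a lowest vertical edge would be
    the only edge of [y] at its lower end. As [m] is arbitrary, no vertical edge remains; [y_top]
    treats the top row in the same way. *)
Lemma y_ver m (i j : 'I_n.+1) : y (i, j, Some true) -> (m <= j)%N.
Proof.
elim: m i j => // m IH i j yij; rewrite ltn_neqAle (IH i) // andbT; apply/eqP => mj.
have jn : (j < n)%N by have := y_D yij; rewrite inE.
have := y_cycle (pt i j); rewrite /bd (bigD1 (i, j, Some true)) //= yij mul1r.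
have := ltn_ord i; rewrite ltnS => i_n.
rewrite {1}/inc /= eqxx pt_eq ?(ltnW jn) // eqxx [j.+1 == j]gtn_eqF ?andbF //.
rewrite big1 // => -[[i' j'] d] ne; case: (boolP (y _)) => ye; last by rewrite mul0r.
rewrite mul1r; have := y_D ye; rewrite inE.
have := ltn_ord i'; rewrite ltnS => i'n; have := ltn_ord j'; rewrite ltnS => j'n.
case: d ye ne => [[]|] ye ne eD; last by rewrite y_diag in ye.
  have j'm := IH _ _ ye; rewrite /inc /= !pt_eq ?(ltnW jn) //.
  have -> : (j'.+1 == j) = false by rewrite -mj gtn_eqF // ltnS.
  rewrite andbF addr0; apply: contraNF ne => /andP[/eqP/val_inj-> /eqP/val_inj->]; exact: eqxx.
have nj' : (n <= j')%N by rewrite leqNgt; apply/negP => lt; rewrite y_hor in ye.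
rewrite /inc /= !pt_eq ?(ltnW jn) //.
have -> : (j' == j :> nat) = false by rewrite gtn_eqF // (leq_trans jn).
by rewrite !andbF.
Qed.

Lemma y_top m (i j : 'I_n.+1) : y (i, j, Some false) -> (m <= i)%N.
Proof.
elim: m i j => // m IH i j yij; rewrite ltn_neqAle (IH i j) // andbT; apply/eqP => mi.
have i_n : (i < n)%N by have := y_D yij; rewrite inE.
have := y_cycle (pt i j); rewrite /bd (bigD1 (i, j, Some false)) //= yij mul1r.
have := ltn_ord j; rewrite ltnS => jn.
rewrite {1}/inc /= eqxx pt_eq ?(ltnW i_n) // [i.+1 == i]gtn_eqF //.
rewrite big1 // => -[[i' j'] d] ne; case: (boolP (y _)) => ye; last by rewrite mul0r.
rewrite mul1r; have := y_D ye; rewrite inE.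
have := ltn_ord i'; rewrite ltnS => i'n; have := ltn_ord j'; rewrite ltnS => j'n.
case: d ye ne => [[]|] ye ne eD; last by rewrite y_diag in ye.
  by have := y_ver n ye; rewrite leqNgt eD.
have i'm := IH _ _ ye; rewrite /inc /= !pt_eq ?(ltnW i_n) //.
have -> : (i'.+1 == i) = false by rewrite -mi gtn_eqF // ltnS.
rewrite addr0; apply: contraNF ne => /andP[/eqP/val_inj-> /eqP/val_inj->]; exact: eqxx.
Qed.

Lemma lat_span : exists b, forall e, z e = \sum_k b k * T k e.
Proof.
exists a => e; apply/bool_add_eq0; rewrite -/(y e); apply/negbTE/negP => ye.
case: e ye => [[i j] [[]|]] ye; have := y_D ye; rewrite inE.
- by move=> jn; have := y_ver n ye; rewrite leqNgt jn.
- by move=> i_n; have := y_top n ye; rewrite leqNgt i_n.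
- by rewrite y_diag in ye.
Qed.

End Span.

Lemma lattice_planar : maclane lat_s lat_t lat_D.
Proof. exact: planar_bounded T_D T_cycle T_card lat_span. Qed.

End Lattice.

(** * From drawings to lattice minors *)

Section Discretization.
Variables (V E W K : finType) (s t : E -> V) (s' t' : K -> W) (D : {set K}).
Hypothesis st : forall e, s e != t e.
Hypothesis Dplanar : maclane s' t' D.
(* [a e] is the sequence of cells met by the edge [e], cut into three thirds. *)
Variables (m : nat) (a : E -> nat -> W) (cv : V -> W).
Hypothesis a_start : forall e, a e 0 = cv (s e).
Hypothesis a_end : forall e, a e (3 * m) = cv (t e).
Hypothesis a_step : forall e i, (i < 3 * m)%N ->
  a e i = a e i.+1 \/ exists2 k, k \in D & link s' t' k (a e i) (a e i.+1).

Definition near_vertex v x := [\/ x = cv v,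
  exists e i, [/\ s e = v, (i <= m)%N & x = a e i] |
  exists e i, [/\ t e = v, (2 * m <= i <= 3 * m)%N & x = a e i]].

Definition mid_edge e x := exists2 i, (m <= i <= 2 * m)%N & x = a e i.

Hypothesis near_disjoint : forall u v x, near_vertex u x -> near_vertex v x -> u = v.
Hypothesis mid_disjoint : forall e e' x, mid_edge e x -> mid_edge e' x -> e = e'.
Hypothesis near_mid : forall e v x, near_vertex v x -> mid_edge e x -> v = s e \/ v = t e.

Let cut_exists e : exists i, (m <= i <= 2 * m)%N && `[< near_vertex (t e) (a e i) >].
Proof.
exists (2 * m)%N; apply/andP; split; first by lia.
by apply/asboolP; constructor 3; exists e, (2 * m)%N; split=> //; lia.
Qed.

(* The edge [e] is contracted into its source up to its first cell of the
   middle third that is near its target. *)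
Let cut e := ex_minn (cut_exists e).

Lemma cutP e : [/\ (m < cut e <= 2 * m)%N, near_vertex (t e) (a e (cut e)) &
  forall i, (m <= i < cut e)%N -> ~ near_vertex (t e) (a e i)].
Proof.
rewrite /cut; case: ex_minnP => i /andP[/andP[mi i2] /asboolP ni] imin.
have mi' : (m < i)%N.
  rewrite ltn_neqAle mi andbT; apply/eqP => im.
  have : near_vertex (s e) (a e i) by constructor 2; exists e, i; rewrite im.
  by move=> /near_disjoint/(_ ni) /eqP; rewrite (negbTE (st e)).
split=> //; first by rewrite mi'.
move=> k /andP[mk ki] nk; have : (i <= k)%N.
  by apply: imin; rewrite mk (leq_trans (ltnW ki)) //=; apply/asboolP.
by rewrite leqNgt ki.
Qed.

(** Branch set of [v] in the minor. A middle third may still touch cells near both of its ends, so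
    each edge is divided at [cut] and only the part before it is added. *)
Definition branch v x := [\/ x = cv v,
  exists e i, [/\ s e = v, (i < cut e)%N & x = a e i] |
  exists e i, [/\ t e = v, (2 * m <= i <= 3 * m)%N & x = a e i]].

Lemma near_branch v x : near_vertex v x -> branch v x.
Proof.
case=> [->|[e [i [se im ->]]]|h]; [by constructor 1| |by constructor 3].
constructor 2; exists e, i; split=> //; have [/andP[mc _] _ _] := cutP e.
exact: leq_ltn_trans mc.
Qed.

Lemma branchE v x : branch v x -> near_vertex v x \/
  exists e i, [/\ s e = v, (m <= i < cut e)%N & x = a e i].
Proof.
case=> [->|[e [i [se ic ->]]]|h]; [by left; constructor 1| |by left; constructor 3].
case: (leqP m i) => mi; first by right; exists e, i; rewrite mi.
by left; constructor 2; exists e, i; rewrite ltnW.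
Qed.

Lemma cut_mid e i : (m <= i < cut e)%N -> mid_edge e (a e i).
Proof.
move=> /andP[mi ic]; exists i => //; rewrite mi /=; have [/andP[_ c2] _ _] := cutP e.
exact: leq_trans (ltnW ic) c2.
Qed.

Lemma branch_disjoint u v x : branch u x -> branch v x -> u = v.
Proof.
have mixed e i w : (m <= i < cut e)%N -> near_vertex w (a e i) -> s e = w.
  move=> ic nw; have [//|wt] := near_mid nw (cut_mid ic).
  by have [_ _ /(_ i ic)] := cutP e; rewrite -wt.
move=> /branchE[nu|[e [i [<- ic xE]]]] /branchE[nv|[f [j [<- jc xE']]]].
- exact: near_disjoint nu nv.
- by rewrite xE' in nu; rewrite (mixed _ _ _ jc nu).
- by rewrite xE in nv; rewrite (mixed _ _ _ ic nv).
- by congr s; apply: (mid_disjoint (x := x)); [rewrite xE|rewrite xE']; exact: cut_mid.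
Qed.

Let c (x : W) : V + W := if [pick v | `[< branch v x >]] is Some v then inl v else inr x.

Lemma c_branch v x : branch v x -> c x = inl v.
Proof.
move=> bx; rewrite /c; case: pickP => [u /asboolP bu|/(_ v) /asboolP//].
by rewrite (branch_disjoint bu bx).
Qed.

Lemma c_inl v x : c x = inl v -> branch v x.
Proof. by rewrite /c; case: pickP => [u /asboolP bu [<-]|]. Qed.

Lemma step_connect e i v : (i < 3 * m)%N -> branch v (a e i) -> branch v (a e i.+1) ->
  connect (adj s' t' (inner s' t' c D)) (a e i) (a e i.+1).
Proof.
move=> im b1 b2; have [->|[k kD l]] := a_step e im; first exact: connect0.
apply: connect1; apply/existsP; exists k; rewrite l andbT inE kD /=.
by case/orP: l => /andP[/eqP-> /eqP->]; rewrite (c_branch b1) (c_branch b2).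
Qed.

Lemma branch_connect v x : branch v x -> connect (adj s' t' (inner s' t' c D)) (cv v) x.
Proof.
case=> [->|[e [i [<- ic ->]]]|[e [i [<- /andP[i2 i3] ->]]]]; first exact: connect0.
  have [/andP[_ c2] _ _] := cutP e.
  elim: i ic => [|i IH] ic; first by rewrite a_start connect0.
  apply: connect_trans (IH (ltnW ic)) _; apply: (@step_connect e i (s e)); first by lia.
    by constructor 2; exists e, i; rewrite ltnW.
  by constructor 2; exists e, i.+1.
have [d dE] : exists d, (i + d = 3 * m)%N by exists (3 * m - i)%N; lia.
elim: d i i2 i3 dE => [|d IH] i i2 i3 dE; first by rewrite -[i]addn0 dE a_end connect0.
apply: connect_trans (IH i.+1 _ _ _) _; try lia.
rewrite (@adj_connect_sym _ _ s' t'); apply: (@step_connect e i (t e)); first by lia.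
  by constructor 3; exists e, i; split=> //; rewrite i2.
by constructor 3; exists e, i.+1; split=> //; lia.
Qed.

(** After contraction of the branch sets, [e] is represented by the lattice edge of the step that
    reaches [cut e]. *)
Lemma discretization_planar : maclane s t [set: E].
Proof.
have conn x y : c x = c y -> connect (adj s' t' (inner s' t' c D)) x y.
  case cx: (c x) => [v|z] /esym cy; last first.
    have inr_id w z' : c w = inr z' -> w = z' by rewrite /c; case: pickP => // _ [].
    by rewrite (inr_id _ _ cx) (inr_id _ _ cy) connect0.
  apply: connect_trans (branch_connect (c_inl cy)).
  by rewrite (@adj_connect_sym _ _ s' t'); apply: branch_connect; exact: c_inl.
have pl := planar_contract conn Dplanar.
have /fin_all_exists2[i iD il] e : exists2 k, k \in D :\: inner s' t' c D &
    link s' t' k (a e (cut e).-1) (a e (cut e)).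
  have [/andP[mc c2] nc _] := cutP e.
  have cE : (cut e).-1.+1 = cut e by rewrite prednK // (leq_ltn_trans _ mc).
  have b1 : branch (s e) (a e (cut e).-1) by constructor 2; exists e, (cut e).-1; rewrite cE.
  have b2 := near_branch nc.
  have lt : ((cut e).-1 < 3 * m)%N by lia.
  have ne : c (a e (cut e).-1) != c (a e (cut e)).
    by rewrite (c_branch b1) (c_branch b2); apply: contra (st e) => /eqP[->].
  have [h|[k kD l]] := a_step e lt; rewrite cE in h || rewrite cE in l.
    by rewrite h eqxx in ne.
  exists k => //; rewrite !inE kD andbT /=; apply: contra ne.
  by case/orP: l => /andP[/eqP-> /eqP->] // /eqP->.
apply: (planar_embed (i := i) (j := inl) _ _ iD _ pl).
(* Both ends of the representing lattice edge are cells of the middle third, and middle thirds of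
   different edges share no cell. *)
- move=> e f ef; have [/andP[mc c2] _ _] := cutP e; have [/andP[mc' c2'] _ _] := cutP f.
  have mid g : (m < cut g <= 2 * m)%N -> mid_edge g (a g (cut g)).
    by move=> /andP[h1 h2]; exists (cut g) => //; rewrite ltnW.
  have mid' g : (m < cut g <= 2 * m)%N -> mid_edge g (a g (cut g).-1).
    by move=> /andP[h1 h2]; exists (cut g).-1 => //; lia.
  have le := il e; have lf := il f; rewrite ef in le.
  apply: (mid_disjoint (x := a e (cut e))); first by apply: mid; rewrite mc.
  have : (a e (cut e) == a f (cut f)) || (a e (cut e) == a f (cut f).-1).
    by have := link_eq le lf => /orP[]/andP[/eqP h1 /eqP h2]; rewrite -?h1 -?h2 eqxx ?orbT.
  by case/orP=> /eqP->; [apply: mid|apply: mid']; rewrite mc'.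
- by move=> x y [].
move=> e; have [/andP[mc c2] nc _] := cutP e.
have cE : (cut e).-1.+1 = cut e by rewrite prednK // (leq_ltn_trans _ mc).
have b1 : branch (s e) (a e (cut e).-1) by constructor 2; exists e, (cut e).-1; rewrite cE.
have b2 := near_branch nc.
have := il e; rewrite /link /=.
by case/orP=> /andP[/eqP-> /eqP->]; rewrite (c_branch b1) (c_branch b2) !eqxx ?orbT.
Qed.

End Discretization.

From mathcomp Require Import all_classical all_reals all_analysis.
Import numFieldNormedType.Exports.

(** * Uniform continuity and separation of arcs *)

Section Compactness.
Local Open Scope classical_set_scope.
Local Open Scope ring_scope.
Variable R : realType.

Definition close (e : R) (P Q : R * R) := `|P.1 - Q.1| < e /\ `|P.2 - Q.2| < e.

Lemma closeC e P Q : close e P Q -> close e Q P.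
Proof. by case=> h1 h2; split; rewrite distrC. Qed.

Lemma close_le e e' P Q : e <= e' -> close e P Q -> close e' P Q.
Proof. by move=> le [h1 h2]; split; apply: lt_le_trans le. Qed.

Lemma close_half e P Q S : close (e / 2) P Q -> close (e / 2) Q S -> close e P S.
Proof.
case=> h1 h2 [h3 h4]; split; rewrite [e](splitr e).
  by apply: le_lt_trans (ler_distD Q.1 _ _) _; exact: ltrD.
by apply: le_lt_trans (ler_distD Q.2 _ _) _; exact: ltrD.
Qed.

Lemma neq_not_close P Q : P <> Q -> exists2 e, 0 < e & ~ close e P Q.
Proof.
move=> ne; have [e1|n1] := eqVneq P.1 Q.1; have [e2|n2] := eqVneq P.2 Q.2.
- by case: ne; case: P Q e1 e2 => [? ?] [? ?] /= -> ->.
- by exists `|P.2 - Q.2|; rewrite ?normr_gt0 ?subr_eq0 // => -[_]; rewrite ltxx.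
- by exists `|P.1 - Q.1|; rewrite ?normr_gt0 ?subr_eq0 // => -[]; rewrite ltxx.
- by exists `|P.1 - Q.1|; rewrite ?normr_gt0 ?subr_eq0 // => -[]; rewrite ltxx.
Qed.

(** Compactness of the segment in Lebesgue number form: a scale valid locally around each point can
    be chosen uniformly. *)
Lemma cover_interval (a b : R) (P : R -> R -> Prop) :
  (forall d d' x, 0 < d' -> d' <= d -> P d x -> P d' x) ->
  (forall x, a <= x <= b -> exists2 d, 0 < d &
     forall y, a <= y <= b -> `|x - y| < d -> P d y) ->
  exists2 d, 0 < d & forall x, a <= x <= b -> P d x.
Proof.
move=> mono loc.
have := @segment_compact R a b; rewrite compact_near_coveringP -near_covering_withinP.
move=> /(_ R (0 : R)^'+ P _) h.
have hn : \forall i \near (0 : R)^'+, forall x, (`[a, b]%classic : set R) x -> P i x.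
  apply: h => x /=; rewrite in_itv /= => /loc[d d0 hd].
  exists (ball x d, [set i | 0 < i /\ i < d]).
    split; first exact: nbhsx_ballx.
    by apply: filterI; [exact: nbhs_right_gt|exact: nbhs_right_lt].
  move=> [y i] /= [xy [i0 id]]; rewrite in_itv /= => yab.
  by apply: (mono d) => //; [exact: ltW|apply: hd].
have [d [hd d0]] := @filter_ex _ ((0 : R)^'+) _ _ (filterI hn (nbhs_right_gt (0 : R))).
by exists d => // x xab; apply: hd; rewrite /= in_itv.
Qed.

Definition cont01 (f : R -> R * R) := forall e x, 0 < e -> 0 <= x <= 1 ->
  exists2 d, 0 < d & forall y, 0 <= y <= 1 -> `|x - y| < d -> close e (f x) (f y).

Lemma within_cont01 (f : R -> R * R) :
  {within `[0, 1]%classic, continuous f} -> cont01 f.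
Proof.
move=> /subspace_continuousP fc e x e0 x01.
have /fc /cvg_ballP/(_ e e0) : (`[0, 1]%classic : set R) x by rewrite /= in_itv.
rewrite /= near_withinE => /nbhs_ballP[d d0 hd].
exists d => // y y01 xy; have [] := hd y xy; first by rewrite /= in_itv.
by move=> h1 h2; split; [move: h1|move: h2]; rewrite -ball_normE.
Qed.

Lemma uniform_cont01 f e : cont01 f -> 0 < e ->
  exists2 d, 0 < d & forall x, 0 <= x <= 1 -> forall y, 0 <= y <= 1 -> `|x - y| < d ->
    close e (f x) (f y).
Proof.
move=> fc e0.
pose P d x := forall y, 0 <= y <= 1 -> `|x - y| < d -> close e (f x) (f y).
apply: (@cover_interval 0 1 P) => [d d' x d0 dd h y y01 xy|x x01].
  by apply: h => //; apply: lt_le_trans dd.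
have e20 : 0 < e / 2 by rewrite divr_gt0.
have [d d0 hd] := fc _ x e20 x01.
exists (d / 2); first by rewrite divr_gt0.
move=> y y01 xy z z01 yz; apply: (@close_half e _ (f x)).
  apply: closeC; apply: hd => //; apply: lt_trans xy _; lra.
apply: hd => //; apply: le_lt_trans (ler_distD y _ _) _; lra.
Qed.

(** Disjoint compact arcs are at positive distance: [cover_interval] is applied over the second arc
    for each point of the first, then over the first. *)
Lemma separation f g (a b c d : R) : cont01 f -> cont01 g ->
  0 <= a -> b <= 1 -> 0 <= c -> d <= 1 ->
  (forall x y, a <= x <= b -> c <= y <= d -> f x <> g y) ->
  exists2 e, 0 < e & forall x, a <= x <= b -> forall y, c <= y <= d -> ~ close e (f x) (g y).
Proof.
move=> fc gc a0 b1 c0 d1 fg.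
have in01 x : a <= x <= b -> 0 <= x <= 1.
  by move=> /andP[h1 h2]; rewrite (le_trans a0 h1) (le_trans h2 b1).
have in01' x : c <= x <= d -> 0 <= x <= 1.
  by move=> /andP[h1 h2]; rewrite (le_trans c0 h1) (le_trans h2 d1).
pose P e x := forall y, c <= y <= d -> ~ close e (f x) (g y).
apply: (@cover_interval a b P) => [e e' x e0 ee h y yI cl|x xI].
  by apply: (h y yI); apply: close_le cl.
have [e e0 he] : exists2 e, 0 < e & forall y, c <= y <= d -> ~ close e (f x) (g y).
  apply: (@cover_interval c d (fun e y => ~ close e (f x) (g y))) => [e e' y e0 ee h cl|y yI].
    by apply: h; apply: close_le cl.
  have [e e0 he] := neq_not_close (fg x y xI yI).
  have e20 : 0 < e / 2 by rewrite divr_gt0.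
  have [r r0 hr] := gc _ y e20 (in01' _ yI).
  exists (Num.min r (e / 2)); first by rewrite lt_min r0.
  move=> z zI; rewrite lt_min => /andP[yz _] cl; apply: he.
  apply: (@close_half e _ (g z)); first by apply: close_le cl; rewrite ge_min lexx orbT.
  by apply: closeC; apply: hr yz; exact: in01'.
have e20 : 0 < e / 2 by rewrite divr_gt0.
have [r r0 hr] := fc _ x e20 (in01 _ xI).
exists (Num.min r (e / 2)); first by rewrite lt_min r0.
move=> z zI; rewrite lt_min => /andP[xz _] y yI cl; apply: (he y yI).
apply: (@close_half e _ (f z)); first by apply: hr xz; exact: in01.
by apply: close_le cl; rewrite ge_min lexx orbT.
Qed.

Lemma fin_pos_min (I : finType) (P : I -> R -> Prop) :
  (forall i e e', 0 < e' -> e' <= e -> P i e -> P i e') ->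
  (forall i, exists2 e, 0 < e & P i e) -> exists2 e, 0 < e & forall i, P i e.
Proof.
move=> mono h; have /fin_all_exists2[e e0 eP] := h.
exists (\big[Num.min/1]_i e i).
  by elim/big_ind: _ => // x y x0 y0; rewrite lt_min x0.
move=> i; apply: mono (eP i); last exact: bigmin_le.
by elim/big_ind: _ => // x y x0 y0; rewrite lt_min x0.
Qed.

End Compactness.

(** * Cells of the plane and the triangular lattice *)

Section Cells.
Variable R : realType.
Implicit Types (P Q : R * R) (c : int * int).

(* Square cells in rows sheared by half a cell: cells of nearby points are equal
   or adjacent in the triangular lattice. *)
Definition cell (d : R) P : int * int :=
  (Num.floor (P.1 / d - (Num.floor (P.2 / d))%:~R / 2), Num.floor (P.2 / d)).

Definition arrow c c' := [\/ c' = (c.1 + 1, c.2), c' = (c.1, c.2 + 1) | c' = (c.1 - 1, c.2 + 1)].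

Lemma floor_eq_dist (x y : R) : Num.floor x = Num.floor y -> `|x - y| < 1.
Proof.
move=> h; have := floor_le x; have := floorD1_gt x; have := floor_le y; have := floorD1_gt y.
rewrite h !intrD => h1 h2 h3 h4; rewrite ltr_norml; apply/andP; split; lra.
Qed.

Lemma floor_close (x y : R) : x < y + 1 -> Num.floor x <= Num.floor y + 1.
Proof.
move=> h; have := floor_le x; have := floorD1_gt y.
rewrite -ltzD1 -(ltr_int R) !intrD; lra.
Qed.

Lemma dist_div (d x y e : R) : 0 < d -> (`|x / d - y / d| < e) = (`|x - y| < e * d).
Proof.
by move=> d0; rewrite -mulrBl normrM normfV (gtr0_norm d0) ltr_pdivrMr.
Qed.

Lemma same_cell d P Q : 0 < d -> cell d P = cell d Q -> close d P Q.
Proof.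
move=> d0 [h1 h2]; rewrite h2 in h1; split.
  have := floor_eq_dist h1.
  by rewrite opprB addrA subrK dist_div // mul1r.
by have := floor_eq_dist h2; rewrite dist_div // mul1r.
Qed.

(** One row up, the shear by half a cell outweighs a horizontal move of less than half a cell, so
    the column index stays or drops by 1; a step to [(i + 1, j + 1)], which the lattice lacks,
    cannot occur. *)
Lemma cell_step d P Q : 0 < d -> close (d / 2) P Q ->
  [\/ cell d P = cell d Q, arrow (cell d P) (cell d Q) | arrow (cell d Q) (cell d P)].
Proof.
move=> d0 [h1 h2].
have : `|P.1 / d - Q.1 / d| < 2^-1 by rewrite dist_div // mulrC.
have : `|P.2 / d - Q.2 / d| < 2^-1 by rewrite dist_div // mulrC.
rewrite /cell /arrow; move: (P.1 / d) (P.2 / d) (Q.1 / d) (Q.2 / d) => x y x' y' {h1 h2}.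
rewrite !ltr_norml => /andP[h1 h2] /andP[h3 h4].
have up : Num.floor y' <= Num.floor y + 1 by apply: floor_close; lra.
have dn : Num.floor y <= Num.floor y' + 1 by apply: floor_close; lra.
have row (j : int) (u u' : R) : - 2^-1 < u - u' -> u - u' < 2^-1 ->
    let f := Num.floor (u - j%:~R / 2) in let f' := Num.floor (u' - j%:~R / 2) in
    [\/ f = f', f' = f + 1 | f = f' + 1].
  move=> k1 k2 f f'.
  have e1 : f <= f' + 1 by apply: floor_close; lra.
  have e2 : f' <= f + 1 by apply: floor_close; lra.
  move: f f' e1 e2 => f f'; clear => e1 e2.
  by case: (ltgtP f f') => h; [constructor 2|constructor 3|constructor 1]; lia.
have slant (j : int) (u u' : R) : - 2^-1 < u - u' -> u - u' < 2^-1 ->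
    let f := Num.floor (u - j%:~R / 2) in let f' := Num.floor (u' - (j + 1)%:~R / 2) in
    f' = f \/ f' = f - 1.
  move=> k1 k2 f f'.
  have e1 : f' <= f by apply: le_floor; rewrite intrD; lra.
  have e2 : f <= f' + 1 by apply: floor_close; rewrite intrD; lra.
  move: f f' e1 e2 => f f'; clear => e1 e2.
  by case: (ltgtP f f') => h; [lia|right; lia|left].
have [jE|[jE|jE]] : Num.floor y' = Num.floor y \/ Num.floor y' = Num.floor y + 1 \/ Num.floor y = Num.floor y' + 1.
  move: up dn; move: (Num.floor y) (Num.floor y') => j j'; clear; lia.
- rewrite jE; have [->|->|->] := row (Num.floor y) _ _ h3 h4.
  + by constructor 1.
  + by constructor 2; constructor 1.
  + by constructor 3; constructor 1.
- rewrite jE; have [->|->] := slant (Num.floor y) _ _ h3 h4.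
  + by constructor 2; constructor 2.
  + by constructor 2; constructor 3.
rewrite jE.
have [||->|->] := slant (Num.floor y') x' x; try lra.
  by constructor 3; constructor 2.
by constructor 3; constructor 3.
Qed.

Definition shift (B : nat) (i : int) : nat := absz (i + B%:Z)%R.

Definition lattice_point (B : nat) c : 'I_(2 * B).+1 * 'I_(2 * B).+1 :=
  (inord (shift B c.1), inord (shift B c.2)).

Definition bounded (B : nat) c := (absz c.1 <= B)%N /\ (absz c.2 <= B)%N.

Lemma shift_le B i : (absz i <= B)%N -> (shift B i < (2 * B).+1)%N.
Proof. rewrite /shift; lia. Qed.

Lemma shift_inj B i j : (absz i <= B)%N -> (absz j <= B)%N -> shift B i = shift B j -> i = j.
Proof. rewrite /shift; lia. Qed.

Lemma shiftS B i : (absz i <= B)%N -> (absz (i + 1)%R <= B)%N ->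
  shift B (i + 1)%R = (shift B i).+1.
Proof. rewrite /shift; lia. Qed.

Lemma lattice_point_inj B c c' : bounded B c -> bounded B c' ->
  lattice_point B c = lattice_point B c' -> c = c'.
Proof.
case: c c' => [i j] [i' j'] [/= b1 b2] [/= b3 b4] h.
have := congr1 (fun x => val x.1) h; have := congr1 (fun x => val x.2) h.
rewrite /= !inordK ?shift_le // => h2 h1.
by rewrite (shift_inj b1 b3 h1) (shift_inj b2 b4 h2).
Qed.

Lemma arrow_link B c c' : bounded B c -> bounded B c' -> arrow c c' ->
  exists2 k, k \in lat_D (2 * B) &
    link (@lat_s _) (@lat_t _) k (lattice_point B c) (lattice_point B c').
Proof.
have lt k : (absz k <= B)%N -> (absz (k + 1)%R <= B)%N -> (shift B k < 2 * B)%N.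
  by move=> h h'; rewrite -ltnS -(shiftS h h') shift_le.
case: c => [i j] [/= b1 b2] [b3 b4] [] cE; rewrite cE /= in b3 b4 *.
- exists (inord (shift B i), inord (shift B j), Some false).
    by rewrite inE inordK ?lt // shift_le.
  by rewrite /link /lat_s /lat_t /lattice_point /= !inordK ?shift_le // shiftS // !eqxx.
- exists (inord (shift B i), inord (shift B j), Some true).
    by rewrite inE inordK ?lt // shift_le.
  by rewrite /link /lat_s /lat_t /lattice_point /= !inordK ?shift_le // shiftS // !eqxx.
have iE : i = i - 1 + 1 by rewrite subrK.
have b1' : (absz (i - 1 + 1)%R <= B)%N by rewrite -iE.
exists (inord (shift B (i - 1)), inord (shift B j), None).
  by rewrite inE !inordK ?shift_le // !lt.
rewrite /link /lat_s /lat_t /lattice_point /= !inordK ?shift_le //.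
by rewrite [in shift B i]iE !shiftS // !eqxx.
Qed.

End Cells.

(** * Drawings satisfy Mac Lane's criterion *)

Section Drawing.
Variables (R : realType) (G : mgraph) (p : vertex G -> R * R) (arc : edge G -> R -> R * R).
Hypothesis dr : plane_drawing p arc.
Notation V := (vertex G).
Notation E := (edge G).
Variables (s t : E -> V).
Hypothesis st_ends : forall e, [/\ ends e = [set s e; t e], arc e 0 = p (s e) & arc e 1 = p (t e)].

Lemma drawing_loopless e : s e != t e.
Proof.
have [h _ _] := st_ends e; have := card_ends e; rewrite h cards2.
by case: (s e != t e).
Qed.

Lemma arc_vertex e x v : 0 <= x <= 1 -> arc e x = p v ->
  x = 0 /\ s e = v \/ x = 1 /\ t e = v.
Proof.
have pinj := drawing_vertex_inj dr; have [_ h0 h1] := st_ends e.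
move=> /andP[x0 x1] h; have [xE|xn0] := eqVneq x 0.
  by left; split=> //; apply: pinj; rewrite -h0 -xE.
have [xE|xn1] := eqVneq x 1; first by right; split=> //; apply: pinj; rewrite -h1 -xE.
case: (@drawing_arc_vertex _ _ _ _ dr e x v _ h).
by rewrite in_itv /= !lt_neqAle x0 x1 eq_sym xn0 xn1.
Qed.

Lemma arc_meet e f x y : 0 <= x <= 1 -> 0 <= y <= 1 -> arc e x = arc f y ->
  e = f /\ x = y \/ exists v, (x = 0 /\ s e = v \/ x = 1 /\ t e = v) /\
    (y = 0 /\ s f = v \/ y = 1 /\ t f = v).
Proof.
have ends_v g (z : R) : z = 0 \/ z = 1 -> exists v, arc g z = p v.
  by have [_ h0 h1] := st_ends g; case=> ->; [exists (s g)|exists (t g)].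
have itv (z : R) : 0 <= z <= 1 -> (z = 0 \/ z = 1) \/ z \in `]0, 1[.
  move=> /andP[z0 z1]; have [zE|zn0] := eqVneq z 0; first by left; left.
  have [zE|zn1] := eqVneq z 1; first by left; right.
  by right; rewrite in_itv /= !lt_neqAle z0 z1 eq_sym zn0 zn1.
move=> x01 y01 h; case: (itv x x01) => [/(ends_v e)[v xv]|xI].
  right; exists v; split; [exact: arc_vertex xv|apply: arc_vertex => //; by rewrite -h].
case: (itv y y01) => [/(ends_v f)[v yv]|yI].
  right; exists v; split; [apply: arc_vertex => //; by rewrite h|exact: arc_vertex yv].
left; have ef := drawing_arc_arc dr xI yI h; split=> //.
by apply: (drawing_arc_inj dr (e := f)); rewrite ?in_itv // -[in LHS]ef.
Qed.

Definition piece_fun (X : V + E * 'I_3) : R -> R * R :=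
  match X with inl v => fun=> p v | inr (e, _) => arc e end.

Definition piece_lo (X : V + E * 'I_3) : R := if X is inr (_, q) then q%:R / 3 else 0.

Definition piece_hi (X : V + E * 'I_3) : R := if X is inr (_, q) then (q.+1)%:R / 3 else 1.

Definition on_piece X x := piece_lo X <= x <= piece_hi X.

Definition piece_at (X : V + E * 'I_3) v := match X with
  | inl w => w = v
  | inr (e, q) => q = 0%N :> nat /\ s e = v \/ q = 2%N :> nat /\ t e = v end.

Lemma piece_range X x : on_piece X x -> 0 <= x <= 1.
Proof.
case: X => [v|[e [[|[|[|q]]] q3]]] //; rewrite /on_piece /= => /andP[h1 h2]; lra.
Qed.

Lemma piece_cont X : cont01 (piece_fun X).
Proof.
case: X => [v|[e q]] /=; last exact/within_cont01/(drawing_arc_continuous dr).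
by move=> e x e0 _; exists 1 => // y _ _; split; rewrite subrr normr0.
Qed.

(** One distance serves the finitely many pairs of pieces: disjoint pieces are separated, and
    intersecting ones impose no condition. *)
Lemma pieces_separated : exists2 d : R, 0 < d & forall X Y x y,
  on_piece X x -> on_piece Y y -> close d (piece_fun X x) (piece_fun Y y) ->
  exists x' y', [/\ on_piece X x', on_piece Y y' & piece_fun X x' = piece_fun Y y'].
Proof.
pose P (XY : (V + E * 'I_3) * (V + E * 'I_3)) (d : R) := forall x y,
  on_piece XY.1 x -> on_piece XY.2 y -> close d (piece_fun XY.1 x) (piece_fun XY.2 y) ->
  exists x' y', [/\ on_piece XY.1 x', on_piece XY.2 y' & piece_fun XY.1 x' = piece_fun XY.2 y'].
have [|[X Y]|d d0 dP] := @fin_pos_min R _ P; last first.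
- by exists d => // X Y; exact: (dP (X, Y)).
- have [h|h] := pselect (exists x' y', [/\ on_piece X x', on_piece Y y' & piece_fun X x' = piece_fun Y y']).
    by exists 1 => // x y _ _ _.
  have lohi Z : 0 <= piece_lo Z /\ piece_hi Z <= 1.
    by case: Z => [v|[e [[|[|[|q]]] q3]]] //=; split; lra.
  have [l1 h1] := lohi X; have [l2 h2] := lohi Y.
  have [|d d0 hd] := separation (@piece_cont X) (@piece_cont Y) l1 h1 l2 h2.
    by move=> x y hx hy hxy; apply: h; exists x, y.
  by exists d => // x y hx hy cl; case: (hd x hx y hy cl).
by move=> [X Y] d d' d0 dd h x y hx hy cl; apply: (h x y hx hy); exact: close_le cl.
Qed.

Lemma third_absurd (x : R) : x <= 1%:R / 3 -> 2%:R / 3 <= x -> False.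
Proof. lra. Qed.

Lemma piece_at_eq X Y x y u v : on_piece X x -> on_piece Y y ->
  piece_fun X x = piece_fun Y y -> piece_at X u -> piece_at Y v -> u = v.
Proof.
have vert w e (q : 'I_3) z v' : on_piece (inr (e, q)) z -> arc e z = p w ->
    piece_at (inr (e, q)) v' -> w = v'.
  move=> hz /(arc_vertex (piece_range hz)); move: hz; rewrite /on_piece /=.
  by move=> /andP[k1 k2] [[zE <-]|[zE <-]] [[q0 <-]|[q2 <-]] //;
    rewrite zE ?q0 ?q2 in k1 k2; exfalso; lra.
move=> hx hy h; have := arc_meet; case: X Y hx hy h => [a|[e q]] [b|[f r]] hx hy /= h meet.
- by move=> <- <-; exact: (drawing_vertex_inj dr).
- by move=> <- pv; exact: vert hy (esym h) pv.
- by move=> pu <-; apply: esym; exact: vert hx h pu.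
move=> pu pv; have [[ef xy]|[w [wx wy]]] := meet _ _ _ _ (piece_range hx) (piece_range hy) h.
  subst f; subst y; move: hx hy; rewrite /on_piece /= => /andP[k1 k2] /andP[k3 k4].
  case: pu pv => [[q0 <-]|[q2 <-]] [[r0 <-]|[r2 <-]] //;
    rewrite ?q0 ?q2 ?r0 ?r2 in k1 k2 k3 k4;
      solve [case: (third_absurd k2 k3)|case: (third_absurd k4 k1)].
have [_ h0 h1] := st_ends e; have [_ h0' h1'] := st_ends f.
have ew : arc e x = p w by case: wx => [[-> <-]|[-> <-]].
have fw : arc f y = p w by case: wy => [[-> <-]|[-> <-]].
by rewrite -(vert w _ _ _ _ hx ew pu) -(vert w _ _ _ _ hy fw pv).
Qed.

Lemma mid_interior e (q : 'I_3) x : q = 1%N :> nat -> on_piece (inr (e, q)) x -> 0 < x < 1.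
Proof. by rewrite /on_piece /= => -> /andP[h1 h2]; lra. Qed.

Lemma mid_eq e f (q r : 'I_3) x y : q = 1%N :> nat ->
  on_piece (inr (e, q)) x -> on_piece (inr (f, r)) y -> arc e x = arc f y -> e = f.
Proof.
move=> q1 hx hy h; have /andP[x0 x1] := mid_interior q1 hx.
have [[//]|[w [[[xE _]|[xE _]] _]]] := arc_meet (piece_range hx) (piece_range hy) h.
  by rewrite xE ltxx in x0.
by rewrite xE ltxx in x1.
Qed.

Theorem drawing_planar : maclane s t [set: E].
Proof.
have [d d0 dP] := pieces_separated.
have [eta eta0 unif] : exists2 eta : R, 0 < eta & forall e x, 0 <= x <= 1 -> forall y, 0 <= y <= 1 ->
    `|x - y| < eta -> close (d / 2) (arc e x) (arc e y).
  apply: (@fin_pos_min R E (fun e eta => forall x, 0 <= x <= 1 -> forall y, 0 <= y <= 1 ->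
    `|x - y| < eta -> close (d / 2) (arc e x) (arc e y))).
    by move=> e a b b0 ba h x x01 y y01 xy; apply: h => //; apply: lt_le_trans ba.
  move=> e; apply: uniform_cont01; last by rewrite divr_gt0.
  exact/within_cont01/(drawing_arc_continuous dr).
(* Ensures [1 / m < eta], so consecutive sample points, at parameter distance [1 / (3 * m)], lie
   within [d / 2] of each other. *)
pose m := (Num.truncn eta^-1).+1.
have m0 : 0 < m%:R :> R by rewrite ltr0n.
have meta : m%:R^-1 < eta.
  by rewrite invf_plt ?posrE // truncnS_gt.
pose N := (3 * m)%N.
have N0 : 0 < N%:R :> R by rewrite ltr0n /N.
have NE : N%:R = 3 * m%:R :> R by rewrite /N natrM.
pose zcell e i := cell d (arc e (i%:R / N%:R)).
pose vcell v := cell d (p v).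
have [B [Bv Be]] : exists B, (forall v, bounded B (vcell v)) /\ forall e i, (i <= N)%N -> bounded B (zcell e i).
  pose sz (c : int * int) := (absz c.1 + absz c.2)%N.
  exists (\sum_v sz (vcell v) + \sum_e \sum_(i < N.+1) sz (zcell e i))%N; split.
    by move=> v; rewrite (bigD1 v) //= /bounded /sz; split; lia.
  move=> e i iN; rewrite (bigD1 e) //= (bigD1 (Ordinal (iN : (i < N.+1)%N))) //= /bounded /sz.
  by split; lia.
pose a e i := lattice_point B (zcell e i).
pose cv v := lattice_point B (vcell v).
have frac i : (i <= N)%N -> 0 <= (i%:R / N%:R : R) <= 1.
  by move=> iN; rewrite divr_ge0 ?ler0n //= ler_pdivrMr // mul1r ler_nat.
have on_third e (q : 'I_3) i : (q * m <= i <= q.+1 * m)%N -> on_piece (inr (e, q)) (i%:R / N%:R).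
  move=> /andP[h1 h2]; have N3 : 0 < 3 * m%:R :> R by rewrite -NE.
  have c3 (z : R) : z / 3 * (3 * m%:R) = z * m%:R by rewrite mulrA divfK // pnatr_eq0.
  rewrite /on_piece /= NE ler_pdivlMr // ler_pdivrMr // !c3 -!natrM !ler_nat.
  exact/andP.
have nearE v x : near_vertex s t m a cv v x -> exists X u,
    [/\ piece_at X v, on_piece X u, bounded B (cell d (piece_fun X u)) &
     x = lattice_point B (cell d (piece_fun X u))].
  case=> [->|[e [i [se im ->]]]|[e [i [te /andP[i1 i2] ->]]]].
  - by exists (inl v), 0; split; rewrite /on_piece /= ?lexx ?ler01 //; exact: Bv.
  - have iN : (i <= N)%N by rewrite /N; lia.
    exists (inr (e, ord0)), (i%:R / N%:R); split => //; [by left|apply: on_third;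
      rewrite /=; lia|exact: Be].
  have iN : (i <= N)%N by rewrite /N; lia.
  exists (inr (e, ord_max)), (i%:R / N%:R); split => //; [by right|apply: on_third;
    rewrite /=; lia|exact: Be].
pose q1 : 'I_3 := Ordinal (isT : (1 < 3)%N).
have midE e x : mid_edge m a e x -> exists u,
    [/\ on_piece (inr (e, q1)) u, bounded B (cell d (arc e u)) &
     x = lattice_point B (cell d (arc e u))].
  case=> i /andP[h1 h2] ->; have iN : (i <= N)%N by rewrite /N; lia.
  by exists (i%:R / N%:R); split=> //; [apply: on_third; rewrite /=; lia|exact: Be].
(* The cell size is the separation distance [d], so pieces that share a lattice point really
   intersect. *)
have touch X Y u w : on_piece X u -> on_piece Y w ->
    bounded B (cell d (piece_fun X u)) -> bounded B (cell d (piece_fun Y w)) ->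
    lattice_point B (cell d (piece_fun X u)) = lattice_point B (cell d (piece_fun Y w)) ->
    exists x' y', [/\ on_piece X x', on_piece Y y' & piece_fun X x' = piece_fun Y y'].
  by move=> hu hw b1 b2 /(lattice_point_inj b1 b2)/(same_cell d0); exact: dP.
apply: (@discretization_planar _ _ _ _ s t _ _ _ drawing_loopless (lattice_planar (2 * B)) m a cv).
- by move=> e; have [_ h0 _] := st_ends e; rewrite /a /zcell mul0r h0.
- by move=> e; have [_ _ h1] := st_ends e; rewrite /a /zcell divff ?gt_eqF // h1.
- move=> e i iN; have iN' : (i <= N)%N := ltnW iN.
  have cl : close (d / 2) (arc e (i%:R / N%:R)) (arc e (i.+1%:R / N%:R)).
    apply: unif; rewrite ?frac //; apply: le_lt_trans meta.
    rewrite distrC -mulrBl -natrB // subSnn mul1r ger0_norm ?invr_ge0 ?ler0n //.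
    by rewrite lef_pV2 ?posrE // ler_nat /N; lia.
  have [h|h|h] := cell_step d0 cl.
  + by left; rewrite /a /zcell h.
  + by right; apply: arrow_link h; apply: Be.
  + have [k kD kl] := arrow_link (Be e i.+1 iN) (Be e i iN') h.
    by right; exists k; rewrite // linkC.
- move=> u v x /nearE[X [x1 [pX oX bX xE]]] /nearE[Y [y1 [pY oY bY]]]; rewrite xE => h.
  have [x' [y' [hx hy hxy]]] := touch _ _ _ _ oX oY bX bY h.
  exact: piece_at_eq hx hy hxy pX pY.
- move=> e f x /midE[x1 [oX bX xE]] /midE[y1 [oY bY]]; rewrite xE => h.
  have [x' [y' [hx hy hxy]]] := touch (inr (e, q1)) (inr (f, q1)) _ _ oX oY bX bY h.
  exact: mid_eq hx hy hxy.
move=> e v x /nearE[X [x1 [pX oX bX xE]]] /midE[y1 [oY bY]]; rewrite xE => h.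
have [x' [y' [hx hy hxy]]] := touch X (inr (e, q1)) _ _ oX oY bX bY h.
case: X pX hx hxy {oX bX xE h} => [w|[f q]] /= pX hx hxy.
  have /andP[y0 y1'] := mid_interior (erefl : q1 = 1%N :> nat) hy.
  have [[yE _]|[yE _]] := arc_vertex (piece_range hy) (esym hxy).
    by rewrite yE ltxx in y0.
  by rewrite yE ltxx in y1'.
have ef := mid_eq (erefl : q1 = 1%N :> nat) hy hx (esym hxy); subst f.
by case: pX => [[_ <-]|[_ <-]]; [left|right].
Qed.

End Drawing.

(** * From edge connectivity to the circular flow *)

Section Final.
Variables (G : mgraph) (s t : edge G -> vertex G).
Hypothesis st_ends : forall e, ends e = [set s e; t e].

(** An odd cut below 11 has at most 9 edges; deleting it leaves the graph connected, so no edge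
    crosses it, although an odd cut is not empty. *)
Lemma edge_connected_odd11 : edge_connected 10 G -> odd11 s t [set: edge G].
Proof.
case=> _ conn X oX; rewrite leqNgt; apply/negP => lt.
pose F := [set e | (s e \in X) (+) (t e \in X)].
have FE : dcut s t [set: edge G] X = #|F|.
  rewrite /dcut /F -sum1dep_card [RHS]big_mkcond.
  by apply: eq_big => e; rewrite ?inE // => _; case: (_ (+) _).
have F10 : (#|F| < 10)%N.
  by rewrite -FE; move: oX lt; move: (dcut _ _ _ _) => k; clear; lia.
have [e eF] : exists e, e \in F.
  by apply/card_gt0P; rewrite -FE; case: (dcut _ _ _ _) oX.
have cl : fingraph.closed (adj_avoiding F) (mem X).
  move=> u v /existsP[f /andP[fF /eqP fE]].
  have same : (s f \in X) = (t f \in X).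
    by move: fF; rewrite inE; case: (s f \in X); case: (t f \in X).
  have : (s f \in [set u; v]) && (t f \in [set u; v]) by rewrite -fE st_ends !inE !eqxx orbT.
  have : (u \in [set s f; t f]) && (v \in [set s f; t f]) by rewrite -st_ends fE !inE !eqxx orbT.
  by rewrite !inE => /andP[/orP[] /eqP-> /orP[] /eqP->] _; rewrite ?same.
have := fingraph.closed_connect cl (conn F F10 (s e) (t e)).
by move: eF; rewrite inE /= => + h; rewrite h addbb.
Qed.

Lemma small_circular_flow (g : edge G -> int) : small_values g ->
  (forall v, excess s t g v = 0) -> has_circular_flow 5 2 G.
Proof.
(* With tails [t] and heads [s], inflow minus outflow is exactly [excess]. *)
move=> sg g0; exists t, s, g; split.
- by move=> e; rewrite st_ends finset.setUC.
- move=> v; apply/eqP;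
  rewrite -subr_eq0 -[X in _ == X](g0 v) /excess !(big_mkcond (fun e => _ == v)) /= -sumrB.
  apply/eqP; apply: eq_bigr => e _; rewrite mulrBr.
  by case: (s e == v); case: (t e == v); rewrite ?mulr1 ?mulr0.
by move=> e; case/or4P: (sg e) => /eqP->.
Qed.

End Final.

Theorem theorem1p3 (R : realType) (G : mgraph)
    (Gconn : edge_connected 10 G) (Gplanar : planar R G) :
  has_circular_flow 5 2 G.
Proof.
have [p [arc dr]] := Gplanar.
have /fin_all_exists[s /fin_all_exists[t st]] := drawing_arc_ends dr.
have sE e : ends e = [set s e; t e] by have [] := st e.
have [g sg g0] := reach_small_flow
  (odd11_planar_reach (drawing_planar dr st) (edge_connected_odd11 sE Gconn)).
exact (small_circular_flow sE sg g0).
Qed.
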